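(* Let $k(x,y)=\tfrac13+\tfrac12(x^2+y^2)-\max(x,y)$ on $[0,1]^2$, let $\boldsymbol\gamma$ be finite-intersection weights of order $\omega$, let $\eta\in\mathbb N$ satisfy $|\{u\in\mathcal U:\gamma_u>0,\ i\in u\}|\le\eta$ for all $i\in\mathbb N$, and put $d=\eta(\omega-1)+1$. Let $\boldsymbol a=(\tfrac12,\tfrac12,\dots)$. Let $\$(\nu)=O(\nu^s)$ with $s>0$. For $n\in\mathbb N$ let $Q_n=Q_{[d],n}$ be the randomized quadrature based on a scrambled polynomial lattice rule in $[0,1)^d$ described in the context. Then for every $\delta>0$ there exist constants $C=C(d,\delta)$ and $N_0$ such that for every $N\ge N_0$ one can choose $m$, $L_1<\dots<L_m$ and $n_1\ge\dots\ge n_m$ such that the multilevel algorithm $Q$ whose building blocks $Q_{v_k,\boldsymbol a}$ are derived from the $Q_{n_k}$ as described in the context satisfies $\mathrm{cost}_{\mathrm{var}}(Q,B(K))\le N$ and $$e(Q,B(K))^2\le CN^{-3+\delta}\quad\text{if }\mathrm{decay}_{\boldsymbol\gamma}\ge1+3s,$$ $$e(Q,B(K))^2\le CN^{-\frac{\mathrm{decay}_{\boldsymbol\gamma}-1}{s}+\delta}\quad\text{if }1+3s>\mathrm{decay}_{\boldsymbol\gamma}>1.$$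
   Context: **Function spaces.** $[n]=\{1,\dots,n\}$; $\mathcal U$ is the set of finite subsets of $\mathbb N$. $D=[0,1]$, $\rho$ is Lebesgue measure on $[0,1]$, $\mu$ the product measure on $[0,1]^{\mathbb N}$. Weights $\boldsymbol\gamma=(\gamma_u)_{u\in\mathcal U}$ are non-negative, $\gamma_\emptyset=1$, $\sum_{u\in\mathcal U}\gamma_u<\infty$. $k_u(\boldsymbol x,\boldsymbol y)=\prod_{j\in u}k(x_j,y_j)$ ($k_\emptyset=1$), $H_u$ is the reproducing kernel Hilbert space with kernel $k_u$ (its elements depend only on the coordinates in $u$), with norm $\|f\|_{k_u}^2=\int_{[0,1]^u}(f^{(u)})^2$, $f^{(u)}$ the weak mixed first derivative in the variables in $u$. $K=\sum_{u\in\mathcal U}\gamma_uk_u$, defined on the set $\mathfrak X$ of all $\boldsymbol x\in[0,1]^{\mathbb N}$ with $\sum_u\gamma_uk_u(\boldsymbol x,\boldsymbol x)<\infty$; $B(K)$ is the closed unit ball of the reproducing kernel Hilbert space $H(K)$. $I(f)=\int f\,d\mu$. **Weights.** Finite-order weights of order $\omega$: $\gamma_u=0$ for $|u|>\omega$. Finite-intersection weights: finite-order weights for which there is $\varrho\in\mathbb N$ with $|\{v\in\mathcal U:\gamma_v>0,\ u\cap v\neq\emptyset\}|\le1+\varrho$ for all $u$ with $\gamma_u>0$. $\widehat\gamma_u=\gamma_uk(\frac12,\frac12)^{|u|}$; $u_1,u_2,\dots$ orders the (infinitely many) non-empty $u$ with $\gamma_u>0$ so that $\widehat\gamma_{u_1}\ge\widehat\gamma_{u_2}\ge\cdots$;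 $\mathrm{decay}_{\boldsymbol\gamma}=\sup\{q\in\mathbb R:\lim_{j\to\infty}\widehat\gamma_{u_j}j^q=0\}$. There is a map $\phi:\mathbb N\to[d]$ that is injective on every $u$ with $\gamma_u>0$; fix one. **Scrambled polynomial lattice rules.** Let $b$ be prime, $M\in\mathbb N$, $\mathbb Z_b$ the field with $b$ elements, $p(x)\in\mathbb Z_b[x]$ with $\deg p=M$, $\boldsymbol q=(q_1,\dots,q_d)\in\mathbb Z_b[x]^d$. Let $\nu_M(\sum_{l\ge w}t_lx^{-l})=\sum_{l=\max(1,w)}^Mt_lb^{-l}$ on formal Laurent series over $\mathbb Z_b$. For $0\le h<b^M$ with $h=\sum_{r<M}h_rb^r$ put $\overline h(x)=\sum_{r<M}h_rx^r$ and $\boldsymbol x_h=(\nu_M(\overline hq_1/p),\dots,\nu_M(\overline hq_d/p))\in[0,1)^d$. These $b^M$ points form a polynomial lattice point set. Owen scrambling replaces each point $\boldsymbol x$ with $x_j=\sum_l\xi_{j,l}b^{-l}$ by $\boldsymbol y$ with $y_j=\sum_l\eta_{j,l}b^{-l}$, $\eta_{j,1}=\pi_j(\xi_{j,1})$, $\eta_{j,l}=\pi_{j,\xi_{j,1},\dots,\xi_{j,l-1}}(\xi_{j,l})$ ($l\ge2$), all $\pi$'s being mutually independent uniformly random permutations of $\{0,\dots,b-1\}$ (the same for all points of the point set). For $n=b^M$, $Q_{[d],n}(f)=\frac1n\sum_{i=1}^nf(\boldsymbol x_i)$, with $\{\boldsymbol x_i\}$ a scrambled polynomial lattice point set (which exists)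 such that for all $1\le\tau<3$, all $\emptyset\ne u\subseteq[d]$ and $f_u\in H_u$: $\mathrm{Var}(Q_{[d],n}(f_u))\le\big(\sum_{z_u\in w\subseteq[z_u]}C_{b,1/\tau}^{|w|}\big)^\tau(n-1)^{-\tau}\|f_u\|_{k_u}^2$, where $z_u=\max u$ and $C_{b,\lambda}=\max\big(\frac{b-1}{3^\lambda}\frac{b^{3\lambda-1}}{b^{3\lambda-1}-1},\frac{b^{2\lambda}}{(b+1)^\lambda3^\lambda}\big)$. For general $n$ with $b^M\le n<b^{M+1}$ one uses the rule with $b^M$ points and gives the superfluous points weight zero. **Multilevel algorithm.** $v_0=\emptyset$, $v_k=\bigcup_{j\in[L_k]}u_j$; $(\boldsymbol x_v;\boldsymbol a)$ has coordinates $x_j$, $j\in v$, and $a_j$, $j\notin v$; $(\Psi_kf)(\boldsymbol x)=f(\boldsymbol x_{v_k};\boldsymbol a)$ for $k\ge1$, $\Psi_0=0$. $Q_{v_k,\boldsymbol a}(f)=\sum_{i=1}^{n_k}w_if(\boldsymbol t^{(i,k)}_{v_k};\boldsymbol a)$ has the same weights $w_i$ as $Q_{n_k}$, and for $\nu\in v_k$ the $\nu$th coordinate $t^{(i,k)}_\nu$ is a scrambled version of the $\phi(\nu)$th coordinate of the $i$th underlying lattice point, the scramblings for different $\nu\in v_k$ being independent. $Q(f)=\sum_{k=1}^mQ_{v_k,\boldsymbol a}(f-\Psi_{k-1}f)$, with independent summands. **Cost and error.** $\$:\mathbb N\cup\{0\}\to[0,\infty)$ is monotone increasing. For strictly increasing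 sequences $\mathbf v=(v_i')$ of non-empty sets in $\mathcal U$ and an anchor $\boldsymbol a\in\mathfrak X$, $c_{\mathbf v,\boldsymbol a}(\boldsymbol x)=\inf\{\$(|v_i'|):x_j=a_j\ \forall j\notin v_i'\}$ ($\inf\emptyset=\infty$). $\mathrm{cost}_{\mathrm{var}}(Q,B(K))=\inf_{\mathbf v,\boldsymbol a}\sup_{f\in B(K)}\mathbb E(\text{sum of }c_{\mathbf v,\boldsymbol a}(\boldsymbol x)\text{ over the evaluation points used by }Q)$. $e(Q,B(K))=\big(\sup_{f\in B(K)}\mathbb E((I(f)-Q(f))^2)\big)^{1/2}$. *)

(* Defs.v *)
From HB Require Import structures.
From mathcomp Require Import all_boot all_order all_algebra all_fingroup finmap.
From mathcomp Require Import all_classical all_reals all_analysis.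

Set Implicit Arguments.
Unset Strict Implicit.
Unset Printing Implicit Defensive.

Import Order.TTheory GRing.Theory Num.Theory.
Import numFieldNormedType.Exports.
Local Open Scope classical_set_scope.
Local Open Scope ring_scope.

(* A Hilbert space of functions on [X] in which the sections [K(., y)], y in X,
   represent point evaluation.  By Moore-Aronszajn it exists for every positive
   semi-definite [K] and is unique up to isometry.  Its elements are read as
   functions through [rkhs_ev]; the values of [rkhs_ev f] and of [K] outside
   [X] are irrelevant. *)
Record rkhs (R : realType) (T : Type) (X : set T) (K : T -> T -> R) := Rkhs {
  rkhs_space :> completeNormedModType R ;
  rkhs_ev : rkhs_space -> T -> R ;
  rkhs_dot : rkhs_space -> rkhs_space -> R ;
  rkhs_evP : forall (c : R) (f g : rkhs_space) (x : T), X x ->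
    rkhs_ev (c *: f + g) x = c * rkhs_ev f x + rkhs_ev g x ;
  rkhs_ev_inj : forall f g : rkhs_space,
    (forall x, X x -> rkhs_ev f x = rkhs_ev g x) -> f = g ;
  rkhs_dotC : forall f g : rkhs_space, rkhs_dot f g = rkhs_dot g f ;
  rkhs_dotP : forall (c : R) (f g h : rkhs_space),
    rkhs_dot (c *: f + g) h = c * rkhs_dot f h + rkhs_dot g h ;
  rkhs_dot_norm : forall f : rkhs_space, rkhs_dot f f = `|f| ^+ 2 ;
  rkhs_reproducing : forall y, X y -> exists ky : rkhs_space,
    (forall x, X x -> rkhs_ev ky x = K x y) /\
    (forall f : rkhs_space, rkhs_dot f ky = rkhs_ev f y) }.

Definition rkhs_ball (R : realType) (T : Type) (X : set T) (K : T -> T -> R)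
    (H : rkhs X K) : set (T -> R) :=
  [set rkhs_ev h | h in [set h : H | `|h| <= 1]].

Section Kernels.
Variable R : realType.

Definition kern (x y : R) : R :=
  3^-1 + 2^-1 * (x ^+ 2 + y ^+ 2) - Num.max x y.

Definition cube (I : Type) : set (I -> R) := [set x | forall j, 0 <= x j <= 1].

Definition kprod (d : nat) (u : {set 'I_d}) (x y : 'I_d -> R) : R :=
  \prod_(j in u) kern (x j) (y j).

(* Variables are numbered from 0. *)
Definition kseq (u : {fset nat}) (x y : nat -> R) : R :=
  \prod_(j <- u) kern (x j) (y j).

Definition weights := {fset nat} -> R.
Implicit Type gamma : weights.

Definition domX gamma : set (nat -> R) :=
  [set x | cube x /\
    (\esum_(u in [set: {fset nat}]) (gamma u * kseq u x x)%:E < +oo)%E].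

(* The sum over all finite u converges absolutely on [domX gamma]; its value
   is the sum of the positive parts minus that of the negative parts. *)
Definition kernK gamma (x y : nat -> R) : R :=
  let t := fun u => gamma u * kseq u x y in
  fine (\esum_(u in [set: {fset nat}]) (t^\+ u)%:E) -
  fine (\esum_(u in [set: {fset nat}]) (t^\- u)%:E).

Definition is_weights gamma : Prop :=
  [/\ forall u, 0 <= gamma u, gamma fset0 = 1 &
      (\esum_(u in [set: {fset nat}]) (gamma u)%:E < +oo)%E].

Definition finite_order gamma (omega : nat) : Prop :=
  forall u : {fset nat}, (omega < #|` u|)%N -> gamma u = 0.

Definition finite_intersection gamma (omega : nat) : Prop :=
  finite_order gamma omega /\
  exists rho : nat, forall u, 0 < gamma u ->
    ([set v | 0 < gamma v /\ (u `&` v != fset0)%fset] #<= `I_(1 + rho))%card.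

Definition gamma_hat gamma (u : {fset nat}) : R :=
  gamma u * kern 2^-1 2^-1 ^+ #|` u|.

(* [us j] is u_{j+1}. *)
Definition ordering gamma (us : nat -> {fset nat}) : Prop :=
  [/\ injective us,
      range us = [set u | u != fset0 /\ 0 < gamma u] &
      forall i j, (i <= j)%N -> gamma_hat gamma (us j) <= gamma_hat gamma (us i)].

Definition decay gamma (us : nat -> {fset nat}) : \bar R :=
  ereal_sup [set q%:E | q in
    [set q : R | (fun j => gamma_hat gamma (us j) * j.+1%:R `^ q) @ \oo --> (0 : R)]].

End Kernels.

Definition cylinders (R : realType) : set (set (nat -> R)) :=
  [set A | exists (j : nat) (B : set R),
     measurable B /\ A = [set x : nat -> R | B (x j)]].

Definition seqsp (R : realType) := g_sigma_algebraType (@cylinders R).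

Definition is_product_measure (R : realType) (mu : probability (seqsp R) R) : Prop :=
  forall (u : {fset nat}) (A : nat -> set R), (forall j, measurable (A j)) ->
    mu [set x : nat -> R | forall j, j \in u -> A j (x j)] =
    (\prod_(j <- u) lebesgue_measure (A j `&` `[0%R, 1%R]))%E.

(* A family of mutually independent, uniformly distributed random permutations
   of the digits {0, ..., b-1}, which are identified with the field 'F_b. *)
Definition iid_uniform_perms (R : realType) (dsp : measure_display)
    (Omega : measurableType dsp) (P : probability Omega R) (b : nat)
    (I : eqType) (pi : I -> Omega -> {perm 'F_b}) : Prop :=
  [/\ forall i s, measurable (pi i @^-1` [set s]),
      forall i s, P (pi i @^-1` [set s]) = (b`!%:R^-1)%:E &
      forall (r : seq I) (A : I -> set {perm 'F_b}), uniq r ->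
        P [set w | forall i, i \in r -> A i (pi i w)] =
        (\prod_(i <- r) P (pi i @^-1` A i))%E].

(* Coefficient of x^{-l} in the formal Laurent series of g / p: the constant
   coefficient of the polynomial part of x^l g / p. *)
Definition laurent_coef (F : fieldType) (g p : {poly F}) (l : nat) : F :=
  ((g * 'X^l) %/ p)`_0.

Section Lattice.
Variables (R : realType) (b d : nat).
(* For every M, a modulus of degree M and a generating vector. *)
Variables (p : nat -> {poly 'F_b}) (q : nat -> 'I_d -> {poly 'F_b}).

Definition hbar (M h : nat) : {poly 'F_b} :=
  \poly_(r < M) ((h %/ b ^ r) %% b)%:R.

(* A coordinate of a point is represented by its base b digits: the value at
   [l] is the coefficient of b^{-(l+1)}.  Rules with n points use
   M = trunc_log b n, i.e. b^M <= n < b^(M+1).  The superfluous points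
   b^M <= i < n repeat earlier ones and have weight zero. *)
Definition lattice_digit (n i : nat) (j : 'I_d) (l : nat) : 'F_b :=
  let M := trunc_log b n in
  if (l < M)%N then laurent_coef (hbar M i * q M j) (p M) l.+1 else 0.

Definition rule_weight (n i : nat) : R :=
  let M := trunc_log b n in
  if (i < b ^ M)%N then (b ^ M)%:R^-1 else 0.

(* Owen scrambling of a coordinate with digits [xi]; [sigma] gives the
   permutation attached to each string of preceding digits. *)
Definition scramble (sigma : seq 'F_b -> {perm 'F_b}) (xi : nat -> 'F_b) : R :=
  limn (series (fun l : nat =>
    (sigma (mkseq xi l) (xi l) : nat)%:R / b%:R ^+ l.+1 : R)).

(* Permutations are indexed by a coordinate and a digit string. *)
Definition rule_d (Omega : Type) (pi : 'I_d * seq 'F_b -> Omega -> {perm 'F_b})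
    (n : nat) (f : ('I_d -> R) -> R) (w : Omega) : R :=
  \sum_(i < n) rule_weight n i *
    f (fun j => scramble (fun s => pi (j, s) w) (lattice_digit n i j)).

Definition C_b (lambda : R) : R :=
  Num.max
    ((b%:R - 1) / 3 `^ lambda *
       (b%:R `^ (3 * lambda - 1) / (b%:R `^ (3 * lambda - 1) - 1)))
    (b%:R `^ (2 * lambda) / ((b%:R + 1) `^ lambda * 3 `^ lambda)).

(* M = 0 is excluded: there the factor (n - 1)^{-tau} is infinite on paper but 0
   for [powR].  [z] is the maximum of [u]. *)
Definition variance_bound (dsp : measure_display) (Omega : measurableType dsp)
    (P : probability Omega R) (pi : 'I_d * seq 'F_b -> Omega -> {perm 'F_b})
    (H : forall u : {set 'I_d}, rkhs (@cube R 'I_d) (@kprod R d u)) : Prop :=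
  forall (M : nat) (tau : R) (u : {set 'I_d}) (z : 'I_d) (f : H u),
    (0 < M)%N -> 1 <= tau < 3 -> z \in u -> (forall j, j \in u -> (j <= z)%N) ->
    (variance P (rule_d pi (b ^ M) (rkhs_ev f)) <=
     ((\sum_(w : {set 'I_d} | (z \in w) && [forall j in w, (j <= z)%N])
         C_b (1 / tau) ^+ #|w|) `^ tau *
      ((b ^ M)%:R - 1) `^ (- tau) * `|f| ^+ 2)%:E)%E.

Variables (phi : nat -> 'I_d) (us : nat -> {fset nat}) (a : nat -> R).
(* [L k] and [n k] are used for k = 1, ..., m. *)
Variables (m : nat) (L n : nat -> nat).
Variables (Omega : Type).
(* Permutations are indexed by level, variable and digit string. *)
Variable pi : (nat * nat) * seq 'F_b -> Omega -> {perm 'F_b}.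

Definition anchored (v : {fset nat}) (x : nat -> R) : nat -> R :=
  fun j => if j \in v then x j else a j.

Definition ml_set (k : nat) : {fset nat} :=
  if k is 0%N then fset0 else \big[fsetU/fset0]_(j < L k) us j.

Definition Psi (k : nat) (f : (nat -> R) -> R) : (nat -> R) -> R :=
  if k is 0%N then cst 0 else fun x => f (anchored (ml_set k) x).

Definition ml_point (k i : nat) (w : Omega) : nat -> R :=
  anchored (ml_set k) (fun nu =>
    scramble (fun s => pi ((k, nu), s) w) (lattice_digit (n k) i (phi nu))).

Definition ml_level (k : nat) (f : (nat -> R) -> R) (w : Omega) : R :=
  \sum_(i < n k) rule_weight (n k) i * f (ml_point k i w).

Definition ml_alg (f : (nat -> R) -> R) (w : Omega) : R :=
  \sum_(1 <= k < m.+1) ml_level k (f \- Psi k.-1 f) w.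

(* All points at which [ml_alg] evaluates its argument, with multiplicity:
   level k evaluates both f and Psi_{k-1} f, except that Psi_0 = 0 needs no
   evaluation.  Points of weight zero are counted as well. *)
Definition ml_nodes (w : Omega) : seq (nat -> R) :=
  flatten [seq flatten [seq
      ml_point k i w ::
        (if k == 1%N then [::] else [:: anchored (ml_set k.-1) (ml_point k i w)])
    | i <- iota 0 (n k)] | k <- iota 1 m].

End Lattice.

Section CostError.
Variables (R : realType) (dsp : measure_display) (Omega : measurableType dsp).
Variable P : probability Omega R.
Local Notation fct := ((nat -> R) -> R).

(* The infimum of the empty set is +oo. *)
Definition point_cost (cost : nat -> R) (v : nat -> {fset nat}) (a x : nat -> R)
    : \bar R :=
  ereal_inf [set (cost #|` v i|)%:E | i in
    [set i | forall j, j \notin v i -> x j = a j]].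

(* [nodes f w] lists the evaluation points used for the input f. *)
Definition cost_var (cost : nat -> R) (X : set (nat -> R)) (B : set fct)
    (nodes : fct -> Omega -> seq (nat -> R)) : \bar R :=
  ereal_inf [set c | exists (v : nat -> {fset nat}) (a : nat -> R),
    [/\ forall i, v i != fset0, forall i, (v i `<` v i.+1)%fset, X a &
      c = ereal_sup [set
        (\int[P]_w \sum_(x <- nodes f w) point_cost cost v a x)%E | f in B]]].

Definition error (mu : probability (seqsp R) R) (X : set (nat -> R)) (B : set fct)
    (Q : fct -> Omega -> R) : \bar R :=
  (ereal_sup [set 'E_P[fun w => ((\int[mu]_(x in X) f x - Q f w) ^+ 2)%R] | f in B]
    `^ 2^-1)%E.

End CostError.

(* Main.v *)
Require Import Defs.
From HB Require Import structures.
From mathcomp Require Import all_boot all_order all_algebra all_fingroup finmap.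
From mathcomp Require Import all_classical all_reals all_analysis.
From mathcomp Require Import measurable_realfun random_variable ring lra zify.

Set Implicit Arguments.
Unset Strict Implicit.
Unset Printing Implicit Defensive.

Import Order.TTheory GRing.Theory Num.Theory.
Import numFieldNormedType.Exports.
Local Open Scope classical_set_scope.
Local Open Scope ring_scope.

(* The constant [C] is 1: since [N0] may depend on all the data, every constant
   and every logarithmic factor is absorbed by the loss [delta].

   For this reason the errors of the levels may be added by Cauchy-Schwarz, and
   so may the contributions of the sets [u] to one level.  Writing [tail L] for
   the sum of gamma_(u_j) over j >= L, the squared bias is at most [4 * tail (L m)], and
   the variance of level [k] is at most a constant times
   [(n k)^(-tau) * tail (L k.-1)].  With [L k = B ^ k], [n k] about
   [N^(1-eps) * B^(-k * s)] and [tail L <= C * L^(-r)] for every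
   [r < decay - 1], both are at most [N^(-min 3 (r / s) + eps')].

   The variance bound at one level is proved for finite combinations
   of kernel sections, which are dense: there the components f_u are explicit,
   and fixing the variables outside [v_k] at the anchor does not increase the
   norm of f_u.  Each component is carried to the d-dimensional rule by an
   injection that extends the inverse of [phi] on [u]; the two rules have the
   same law because both are uniform limits of the same functions of finitely
   many independent uniform permutations. *)

(** * The kernel and reproducing kernel Hilbert spaces *)

(** An [rkhs] provides point evaluation and an inner product, but no splitting of an element of [HK]
    into components f_u. On a combination of sections K(., y) the splitting is explicit: f_u is
    gamma_u times the same combination of sections k_u(., y). Its squared norm in H_u is gamma_u^2
    times [gram u s], and the sum of gamma_u times [gram u s] over all u is the squared norm in
    [HK]. Cauchy-Schwarz with weights gamma_u then leaves one tail of the weights times the norm of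
    f.

    Every rule value is a uniform limit of functions of finitely many permutations. This one
    property, [pcont], yields measurability, boundedness and a mean that does not depend on the
    probability space.

    The error is the bias minus the centred levels because a scrambled point is uniformly
    distributed: its cells of side b^(-l) are equally likely, exactly as under [mu].

    The cost refers to a strictly increasing sequence of sets, while adding one more u_j to a union
    need not enlarge it. Multiplying the number of sets by eta * omega + 1 forces a new variable, by
    double counting. *)

Section Kern.
Variable R : realType.
Implicit Types x y : R.

Lemma kernC x y : kern x y = kern y x.
Proof. by rewrite /kern maxC (addrC (x ^+ 2)). Qed.

Lemma kern_bound x y : 0 <= x <= 1 -> 0 <= y <= 1 -> `|kern x y| <= 1.
Proof.
move=> /andP[x0 x1] /andP[y0 y1]; rewrite /kern ler_norml.
by case: (lerP x y) => xy; apply/andP; split; nra.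
Qed.

Lemma kern_lip x x' y : 0 <= x <= 1 -> 0 <= x' <= 1 ->
  `|kern x y - kern x' y| <= 2 * `|x - x'|.
Proof.
move=> /andP[x0 x1] /andP[x'0 x'1].
have -> : kern x y - kern x' y =
    2^-1 * (x - x') * (x + x') - (Num.max x y - Num.max x' y).
  by rewrite /kern; ring.
rewrite (le_trans (ler_normB _ _))// (_ : 2 * _ = `|x - x'| + `|x - x'|); last by ring.
apply: lerD.
  rewrite mulrAC normrM -[leRHS]mul1r ler_wpM2r// ler_norml; apply/andP; split; nra.
case: (lerP x y) => ?; case: (lerP x' y) => ?; rewrite ?subrr ?normr0//;
  rewrite ler_norml; case: (ger0P (x - x')) => ?; apply/andP; split; lra.
Qed.

Lemma prod_bound (I : Type) (r : seq I) (a : I -> R) :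
  (forall i, `|a i| <= 1) -> `|\prod_(i <- r) a i| <= 1.
Proof.
move=> a1; elim: r => [|i r IH]; first by rewrite big_nil normr1.
by rewrite big_cons normrM mulr_ile1.
Qed.

Lemma prod_diff (I : Type) (r : seq I) (a b : I -> R) :
  (forall i, `|a i| <= 1) -> (forall i, `|b i| <= 1) ->
  `|\prod_(i <- r) a i - \prod_(i <- r) b i| <= \sum_(i <- r) `|a i - b i|.
Proof.
move=> a1 b1; elim: r => [|i r IH]; first by rewrite !big_nil subrr normr0.
rewrite !big_cons.
set A := \prod_(_ <- _) _; set B := \prod_(_ <- _) _.
have -> : a i * A - b i * B = (a i - b i) * A + b i * (A - B) by ring.
rewrite (le_trans (ler_normD _ _))// lerD// normrM.
  by rewrite ler_piMr// prod_bound.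
by rewrite (le_trans _ IH)// ler_piMl.
Qed.

Lemma kseqC u (x y : nat -> R) : kseq u x y = kseq u y x.
Proof. by apply: eq_bigr => j _; rewrite kernC. Qed.

Lemma kprodC d (u : {set 'I_d}) (x y : 'I_d -> R) : kprod u x y = kprod u y x.
Proof. by apply: eq_bigr => j _; rewrite kernC. Qed.

Lemma kseq_bound u (x y : nat -> R) : cube x -> cube y -> `|kseq u x y| <= 1.
Proof. by move=> cx cy; apply: prod_bound => j; apply: kern_bound. Qed.

Lemma kseq_lip u (x x' y : nat -> R) : cube x -> cube x' -> cube y ->
  `|kseq u x y - kseq u x' y| <= \sum_(j <- u) 2 * `|x j - x' j|.
Proof.
move=> cx cx' cy; rewrite (le_trans (prod_diff _ _ _))//.
- by move=> j; apply: kern_bound.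
- by move=> j; apply: kern_bound.
by apply: ler_sum => j _; apply: kern_lip.
Qed.

Lemma kprod_lip d (u : {set 'I_d}) (x x' y : 'I_d -> R) :
  cube x -> cube x' -> cube y ->
  `|kprod u x y - kprod u x' y| <= \sum_j 2 * `|x j - x' j|.
Proof.
move=> cx cx' cy; rewrite /kprod.
rewrite -[X in `|X - _|]big_filter -[X in `|_ - X|]big_filter.
rewrite (le_trans (prod_diff _ _ _))//.
- by move=> j; apply: kern_bound.
- by move=> j; apply: kern_bound.
rewrite big_filter [leRHS](bigID (mem u))/= -[leLHS]addr0 lerD//.
  by apply: ler_sum => j _; apply: kern_lip.
by apply: sumr_ge0 => j _; rewrite mulr_ge0.
Qed.

End Kern.

Section Rkhs.
Variables (R : realType) (T : Type) (X : set T) (K : T -> T -> R) (H : rkhs X K).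
Implicit Types f g h : H.
Local Notation dot := (@rkhs_dot R T X K H).
Local Notation ev := (@rkhs_ev R T X K H).

Lemma rdotDl f g h : dot (f + g) h = dot f h + dot g h.
Proof. by rewrite -[f]scale1r rkhs_dotP mul1r scale1r. Qed.

Lemma rdot0l h : dot 0 h = 0.
Proof. by apply: (addrI (dot 0 h)); rewrite -rdotDl !addr0. Qed.

Lemma rdotZl c f h : dot (c *: f) h = c * dot f h.
Proof. by rewrite -[c *: f]addr0 rkhs_dotP rdot0l addr0. Qed.

Lemma rdotNl f h : dot (- f) h = - dot f h.
Proof. by rewrite -scaleN1r rdotZl mulN1r. Qed.

Lemma rdotBl f g h : dot (f - g) h = dot f h - dot g h.
Proof. by rewrite rdotDl rdotNl. Qed.

Lemma rdotZr c f h : dot h (c *: f) = c * dot h f.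
Proof. by rewrite rkhs_dotC rdotZl (rkhs_dotC h). Qed.

Lemma rdotBr f g h : dot h (f - g) = dot h f - dot h g.
Proof. by rewrite rkhs_dotC rdotBl !(rkhs_dotC h). Qed.

Lemma rdot_suml (I : Type) (r : seq I) (F : I -> H) h :
  dot (\sum_(i <- r) F i) h = \sum_(i <- r) dot (F i) h.
Proof.
elim: r => [|i r IH]; first by rewrite !big_nil rdot0l.
by rewrite !big_cons rdotDl IH.
Qed.

Lemma rdot_sumr (I : Type) (r : seq I) (F : I -> H) h :
  dot h (\sum_(i <- r) F i) = \sum_(i <- r) dot h (F i).
Proof.
by rewrite rkhs_dotC rdot_suml; apply: eq_bigr => i _; rewrite rkhs_dotC.
Qed.

Lemma rdot_sqrB f g t : `|f - t *: g| ^+ 2 =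
  `|f| ^+ 2 - 2 * t * dot f g + t ^+ 2 * `|g| ^+ 2.
Proof.
rewrite -!rkhs_dot_norm rdotBl !rdotBr !rdotZl !rdotZr (rkhs_dotC g f).
ring.
Qed.

Lemma rkhs_CS f g : dot f g ^+ 2 <= `|f| ^+ 2 * `|g| ^+ 2.
Proof.
have [g0|g0] := eqVneq (`|g|) 0.
  have /eqP := g0; rewrite normr_eq0 => /eqP ->.
  by rewrite rkhs_dotC rdot0l expr0n/= normr0 expr0n/= mulr0.
have g2 : 0 < `|g| ^+ 2 by rewrite exprn_gt0// lt_def g0 normr_ge0.
have := sqr_ge0 (`|f - (dot f g / `|g| ^+ 2) *: g|).
rewrite rdot_sqrB.
set a := dot f g; set b := `|g| ^+ 2 in g2 *; set c := `|f| ^+ 2.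
have -> : c - 2 * (a / b) * a + (a / b) ^+ 2 * b = c - a ^+ 2 / b.
  by field; rewrite gt_eqF.
by rewrite subr_ge0 ler_pdivrMr.
Qed.

Lemma rev0 x : X x -> ev 0 x = 0.
Proof.
move=> Xx; apply: (addrI (ev 0 x)).
by rewrite addr0 -[in RHS](addr0 (0 : H)) -[0 in RHS](scale1r (0 : H))
  rkhs_evP// mul1r scale1r.
Qed.

Lemma revZ c f x : X x -> ev (c *: f) x = c * ev f x.
Proof. by move=> Xx; rewrite -[c *: f]addr0 rkhs_evP// rev0// addr0. Qed.

Lemma revD f g x : X x -> ev (f + g) x = ev f x + ev g x.
Proof. by move=> Xx; rewrite -[f]scale1r rkhs_evP// mul1r scale1r. Qed.

Lemma revB f g x : X x -> ev (f - g) x = ev f x - ev g x.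
Proof. by move=> Xx; rewrite revD// -scaleN1r revZ// mulN1r. Qed.

Lemma rev_sum (I : Type) (r : seq I) (F : I -> H) x : X x ->
  ev (\sum_(i <- r) F i) x = \sum_(i <- r) ev (F i) x.
Proof.
move=> Xx; elim: r => [|i r IH]; first by rewrite !big_nil rev0.
by rewrite !big_cons revD// IH.
Qed.

Definition ksec (y : T) : H :=
  if pselect (X y) is left Xy then projT1 (cid (rkhs_reproducing H Xy)) else 0.

Lemma ksecP y : X y -> (forall x, X x -> ev (ksec y) x = K x y) /\
    (forall f : H, dot f (ksec y) = ev f y).
Proof. by rewrite /ksec; case: pselect => // Xy _; case: cid. Qed.

Lemma ev_ksec x y : X x -> X y -> ev (ksec y) x = K x y.
Proof. by move=> Xx /ksecP[+ _]; exact. Qed.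

Lemma dot_ksec f y : X y -> dot f (ksec y) = ev f y.
Proof. by move=> /ksecP[_]; exact. Qed.

Lemma rkhs_ker_sym x y : X x -> X y -> K x y = K y x.
Proof.
by move=> Xx Xy; rewrite -ev_ksec// -dot_ksec// rkhs_dotC dot_ksec// ev_ksec.
Qed.

Lemma norm_ksec y : X y -> `|ksec y| ^+ 2 = K y y.
Proof. by move=> Xy; rewrite -rkhs_dot_norm dot_ksec// ev_ksec. Qed.

Lemma rev_bound f y : X y -> ev f y ^+ 2 <= `|f| ^+ 2 * K y y.
Proof. by move=> Xy; rewrite -norm_ksec// -dot_ksec// rkhs_CS. Qed.

Lemma rev_dist f x y : X x -> X y ->
  (ev f x - ev f y) ^+ 2 <= `|f| ^+ 2 * (K x x - 2 * K x y + K y y).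
Proof.
move=> Xx Xy; rewrite -!dot_ksec// -rdotBr (le_trans (rkhs_CS _ _))// ler_wpM2l//.
rewrite -[ksec y]scale1r rdot_sqrB !norm_ksec// dot_ksec// ev_ksec//.
by rewrite (rkhs_ker_sym Xy Xx) le_eqVlt; apply/orP; left; apply/eqP; ring.
Qed.

Definition comb (s : seq (R * {y | X y})) : H :=
  \sum_(c <- s) c.1 *: ksec (sval c.2).

Lemma ev_comb s x : X x ->
  ev (comb s) x = \sum_(c <- s) c.1 * K x (sval c.2).
Proof.
move=> Xx; rewrite rev_sum//; apply: eq_bigr => c _.
by rewrite revZ// ev_ksec//; case: c.2.
Qed.

Lemma dot_comb f s : dot f (comb s) = \sum_(c <- s) c.1 * ev f (sval c.2).
Proof.
rewrite rdot_sumr; apply: eq_bigr => c _.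
by rewrite rdotZr dot_ksec//; case: c.2.
Qed.

Lemma norm_comb s : `|comb s| ^+ 2 =
  \sum_(c <- s) \sum_(c' <- s) c.1 * c'.1 * K (sval c.2) (sval c'.2).
Proof.
rewrite -rkhs_dot_norm dot_comb; apply: eq_bigr => c _.
rewrite ev_comb; last by case: c.2.
by rewrite mulr_sumr; apply: eq_bigr => c' _; rewrite mulrA.
Qed.

Lemma combD s t : comb (s ++ t) = comb s + comb t.
Proof. by rewrite /comb big_cat. Qed.

Lemma combZ a s : exists t, comb t = a *: comb s.
Proof.
exists [seq (a * c.1, c.2) | c <- s]; rewrite /comb big_map scaler_sumr.
by apply: eq_bigr => c _; rewrite scalerA.
Qed.

(** Projection onto the closed span: a minimizing sequence of combinations is Cauchy, and [f] minus
    its limit is orthogonal to every section. By the reproducing property the difference vanishes on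
    [X], so it is zero. *)
Lemma comb_dense f e : 0 < e -> exists s, `|f - comb s| < e.
Proof.
move=> e0.
pose D := [set `|f - comb s| ^+ 2 | s in [set: seq (R * {y | X y})]].
have D0 : has_inf D.
  split; first by exists (`|f - comb [::]| ^+ 2), [::].
  by exists 0 => _ [s _ <-]; exact: sqr_ge0.
have infD s : inf D <= `|f - comb s| ^+ 2.
  by apply: ge_inf; [case: D0|exists s].
have /choice[g gP] : forall n, exists s, `|f - comb s| ^+ 2 < inf D + n.+1%:R^-1.
  move=> n; have [|_ [s _ <-] Hs] := @inf_adherent _ D n.+1%:R^-1 _ D0.
    by rewrite invr_gt0.
  by exists s.
(* parallelogram law *)
have par n m : `|comb (g n) - comb (g m)| ^+ 2 <=
    2 * n.+1%:R^-1 + 2 * m.+1%:R^-1.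
  have [t tE] := combZ 2^-1 (g n ++ g m).
  have := infD t; have := gP n; have := gP m; rewrite tE combD.
  have -> : f - 2^-1 *: (comb (g n) + comb (g m)) =
      2^-1 *: ((f - comb (g n)) - (-1) *: (f - comb (g m))).
    rewrite scaleN1r opprK addrACA -opprD scalerBr; congr (_ - _).
    have {1}-> : f = (2^-1 + 2^-1) *: f by rewrite -[LHS]scale1r; congr (_ *: _); field.
    by rewrite scalerDl scalerDr.
  have -> : comb (g n) - comb (g m) =
      - ((f - comb (g n)) - 1 *: (f - comb (g m))).
    by rewrite scale1r opprB opprB [RHS]addrC addrA subrK.
  rewrite normrN normrZ exprMn !rdot_sqrB ger0_norm//.
  set a := dot _ _; set A := `|f - comb (g n)| ^+ 2; set B := `|f - comb (g m)| ^+ 2.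
  move: a A B (inf D) (n.+1%:R^-1) (m.+1%:R^-1) => a A B i u v.
  lra.
have cg : cvgn (comb \o g).
  apply: cauchy_cvg; apply: cauchy_exP => r r0.
  pose N := Num.truncn (4 / r ^+ 2).
  have HN : 4 * N.+1%:R^-1 < r ^+ 2.
    rewrite ltr_pdivrMr// -ltr_pdivrMl ?exprn_gt0// mulrC truncnS_gt//.
  exists (comb (g N)); exists N => // n /= Nn.
  rewrite -ball_normE /ball_/= -ltr_sqr ?nnegrE ?normr_ge0 ?(ltW r0)//.
  apply: le_lt_trans (par N n) _; apply: le_lt_trans HN.
  have : n.+1%:R^-1 <= N.+1%:R^-1 :> R by rewrite lef_pV2 ?posrE// ler_nat ltnS.
  by move: (n.+1%:R^-1) (N.+1%:R^-1) => u v; lra.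
set p := limn (comb \o g).
(* The competitor adds d / (K y y + 1) times [ksec y] to [comb (g n)]; it cannot beat the infimum.
   The added 1 avoids a division by zero. *)
have perp : forall n y, X y -> dot (f - comb (g n)) (ksec y) ^+ 2 <=
    (K y y + 1) * n.+1%:R^-1.
  move=> n y Xy; set d := dot _ _.
  have k0 : 0 <= K y y by rewrite -norm_ksec// sqr_ge0.
  have := infD (g n ++ [:: (d / (K y y + 1), exist _ y Xy)]).
  rewrite combD opprD addrA /(comb [:: _]) big_seq1/= rdot_sqrB -/d norm_ksec//.
  have := gP n; set k := K y y in k0 *; set A := `|_| ^+ 2; set i := inf D.
  set v := n.+1%:R^-1 => h1 h2.
  rewrite mulrC -ler_pdivrMr; last by lra.
  have -> : d ^+ 2 / (k + 1) = 2 * (d / (k + 1)) * d - (d / (k + 1)) ^+ 2 * (k + 1).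
    by field; lra.
  have := sqr_ge0 (d / (k + 1)); lra.
have fp : f = p.
  apply: (@rkhs_ev_inj _ _ _ _ H) => y Xy; apply/eqP; rewrite -subr_eq0.
  rewrite -sqrf_eq0 eq_le sqr_ge0 andbT; apply/ler_addgt0Pr => r r0; rewrite add0r.
  have k0 : 0 <= K y y by rewrite -norm_ksec// sqr_ge0.
  (* With this [c] both evaluations at [y] lie within squared distance r / 4 of that of
     [comb (g N)]; the factor 2 in [h4] then gives r in total. *)
  pose c := r / (4 * (K y y + 1)).
  have c0 : 0 < c by rewrite divr_gt0// mulr_gt0//; lra.
  have [N1 _ HN1] := cvgr_dist_lt _ _ cg (Num.min 1 c) ltac:(by rewrite lt_min ltr01).
  pose N := maxn N1 (Num.truncn c^-1).
  have := HN1 N (leq_maxl _ _); rewrite /= -/p => pN.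
  have Nc : N.+1%:R^-1 <= c.
    rewrite invf_ple ?posrE// ltW// (lt_le_trans (truncnS_gt _))// ler_nat ltnS.
    exact: leq_maxr.
  have := perp N y Xy; rewrite dot_ksec// revB//.
  have := rev_bound (p - comb (g N)) Xy; rewrite revB//.
  set A := ev f y; set B := ev p y; set E := ev _ y => h1 h2.
  have h3 : `|p - comb (g N)| ^+ 2 <= c.
    move: pN; rewrite lt_min => /andP[p1 pc]; apply: ltW; apply: le_lt_trans pc.
    by rewrite expr2 ler_piMl// ltW.
  have h4 : (A - B) ^+ 2 <= 2 * (A - E) ^+ 2 + 2 * (B - E) ^+ 2.
    by have := sqr_ge0 (A + B - 2 * E); nra.
  have h5 : (A - E) ^+ 2 <= (K y y + 1) * c by apply: le_trans h2 _; apply: ler_wpM2l => //; lra.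
  have h6 : (B - E) ^+ 2 <= (K y y + 1) * c.
    apply: le_trans h1 _; rewrite mulrC; apply: ler_pM => //; lra.
  have : (K y y + 1) * c = r / 4 by rewrite /c; field; lra.
  lra.
have [N _ HN] := cvgr_dist_lt _ _ cg e e0.
by exists (g N); have := HN N (leqnn _); rewrite /= -/p -fp.
Qed.

End Rkhs.

(** * Tails of the weights and the truncated kernel *)

Section Weights.
Variables (R : realType) (gamma : weights R) (us : nat -> {fset nat}).
Hypotheses (wg : is_weights gamma) (og : ordering gamma us).

Definition tail J : R := fine (\sum_(J <= j <oo) (gamma (us j))%:E)%E.

(** The leading 1 is the term of the empty set, which [us] does not list. *)
Definition kern_trunc J (x y : nat -> R) : R :=
  1 + \sum_(0 <= j < J) gamma (us j) * kseq (us j) x y.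

Let g0 u : 0 <= gamma u. Proof. by case: wg. Qed.

Lemma us_neq0 j : us j != fset0.
Proof.
have : range us (us j) by exists j.
by case: og => _ -> _ [].
Qed.

Lemma us_gt0 j : 0 < gamma (us j).
Proof.
have : range us (us j) by exists j.
by case: og => _ -> _ [].
Qed.

(** The finite sets split into the empty set, the range of [us] and sets of weight zero; injectivity
    of [us] turns the middle part into a series. *)
Lemma esum_weights (t : {fset nat} -> R) : (forall u, 0 <= t u) ->
  (forall u, gamma u = 0 -> t u = 0) ->
  (\esum_(u in [set: {fset nat}]) (t u)%:E =
   (t fset0)%:E + \sum_(0 <= j <oo) (t (us j))%:E)%E.
Proof.
move=> t0 tg.
rewrite (esumID [set fset0])//; last by move=> u _; rewrite lee_fin.
rewrite setTI setTI esum_set1 ?lee_fin//; congr (_ + _)%E.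
have [usI usR _] := og.
rewrite (esumID (range us)); last by move=> u _; rewrite lee_fin.
rewrite [X in (_ + X)%E]esum1 ?adde0; last first.
  move=> u [u0 ur]; rewrite tg//; apply/eqP; rewrite eq_le g0 andbT leNgt.
  apply/negP => gu; apply: ur; rewrite usR; split => //.
  by apply/eqP.
rewrite setIidr; last by move=> u [j _ <-] /= /eqP; rewrite (negPf (us_neq0 j)).
rewrite (@reindex_esum _ _ _ [set: nat] (range us) us); last first.
  by split => // i j _ _; exact: usI.
by rewrite nneseries_esumT// => j; rewrite lee_fin.
Qed.

Lemma sum_weights_fin : (\sum_(0 <= j <oo) (gamma (us j))%:E < +oo)%E.
Proof.
have [_ _] := wg; rewrite esum_weights//; apply: le_lt_trans.
by rewrite leeDr// lee_fin.
Qed.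

Lemma tail_fin J : (\sum_(J <= j <oo) (gamma (us j))%:E)%E \is a fin_num.
Proof.
rewrite ge0_fin_numE; last by apply: nneseries_ge0 => j _ _; rewrite lee_fin.
apply: le_lt_trans sum_weights_fin.
rewrite (@nneseries_split _ _ 0%N J); last by move=> j _; rewrite lee_fin.
by rewrite add0n leeDr// sume_ge0// => j _; rewrite lee_fin.
Qed.

Lemma tailE J : (tail J)%:E = (\sum_(J <= j <oo) (gamma (us j))%:E)%E.
Proof. by rewrite fineK// tail_fin. Qed.

Lemma tail_ge0 J : 0 <= tail J.
Proof. by rewrite -lee_fin tailE; apply: nneseries_ge0 => j _ _; rewrite lee_fin. Qed.

Lemma tail_cvg e : 0 < e -> exists J, tail J < e.
Proof.
move=> e0; have := @nneseries_tail_cvg R (fun j => (gamma (us j))%:E) xpredT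
  sum_weights_fin (fun j _ => ltac:(by rewrite lee_fin)).
under eq_fun do rewrite -tailE.
move=> /fine_cvgP[_] /cvgrPdist_lt/(_ e e0)[J _ /(_ J (leqnn J))] /=.
by rewrite sub0r normrN ger0_norm ?tail_ge0//; exists J.
Qed.

Lemma sum_tail I J : (I <= J)%N ->
  \sum_(I <= j < J) gamma (us j) + tail J = tail I.
Proof.
move=> IJ; apply: EFin_inj; rewrite EFinD !tailE -sumEFin.
rewrite (@nneseries_split _ _ I (J - I)); last by move=> j _; rewrite lee_fin.
by rewrite subnKC.
Qed.

Lemma sum_le_tail I J : (I <= J)%N -> \sum_(I <= j < J) gamma (us j) <= tail I.
Proof. by move=> /sum_tail <-; rewrite lerDl tail_ge0. Qed.

Lemma le_tail I J : (I <= J)%N -> tail J <= tail I.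
Proof.
move=> /sum_tail <-; rewrite lerDr.
by apply: sumr_ge0 => j _.
Qed.

Lemma nneseries_trunc (a : nat -> R) J : (forall j, 0 <= a j <= gamma (us j)) ->
  [/\ (\sum_(0 <= j <oo) (a j)%:E)%E \is a fin_num,
   \sum_(0 <= j < J) a j <= fine (\sum_(0 <= j <oo) (a j)%:E)%E &
   fine (\sum_(0 <= j <oo) (a j)%:E)%E <= \sum_(0 <= j < J) a j + tail J].
Proof.
move=> ag; have a0 j : (0 <= (a j)%:E)%E by rewrite lee_fin; case/andP: (ag j).
have fa : (\sum_(0 <= j <oo) (a j)%:E)%E \is a fin_num.
  rewrite ge0_fin_numE; last by apply: nneseries_ge0 => j _ _.
  apply: le_lt_trans sum_weights_fin; apply: lee_nneseries => j //.
  by rewrite lee_fin; case/andP: (ag j).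
split=> //.
  rewrite -lee_fin fineK// -sumEFin; apply: nneseries_lim_ge => j _ _; exact: a0.
rewrite -lee_fin fineK// EFinD tailE -sumEFin (@nneseries_split _ _ 0%N J)// add0n.
apply: leeD => //; apply: lee_nneseries => j //.
by rewrite lee_fin; case/andP: (ag j).
Qed.

(** Positive and negative parts are truncated separately. Each error lies between 0 and [tail J], so
    the error of their difference stays below one tail instead of two. *)
Lemma kernK_trunc J x y : cube x -> cube y ->
  `|kernK gamma x y - kern_trunc J x y| <= tail J.
Proof.
move=> cx cy; rewrite /kernK.
set t := fun u => gamma u * kseq u x y.
have tg u : `|t u| <= gamma u.
  by rewrite /t normrM (ger0_norm (g0 u)) ler_piMr// kseq_bound.
rewrite !esum_weights.
- set p := fun j => t^\+ (us j); set m := fun j => t^\- (us j).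
  have t0 : t fset0 = 1 by rewrite /t /kseq big_seq_fset0 mulr1; case: wg.
  have -> : t^\+ fset0 = 1 by rewrite /funrpos t0 max_l.
  have -> : t^\- fset0 = 0 by rewrite /funrneg t0 max_r// oppr_le0.
  have [|fp p1 p2] := @nneseries_trunc p J.
    move=> j; rewrite /p /funrpos le_max lexx orbT/= ge_max g0 andbT.
    exact: le_trans (ler_norm _) (tg _).
  have [|fm m1 m2] := @nneseries_trunc m J.
    move=> j; rewrite /m /funrneg le_max lexx orbT/= ge_max g0 andbT.
    by rewrite (le_trans _ (tg _))// -normrN ler_norm.
  rewrite fineD// fineD//= add0r.
  have -> : kern_trunc J x y = 1 + (\sum_(0 <= j < J) p j - \sum_(0 <= j < J) m j).
    rewrite /kern_trunc -sumrB; congr (_ + _); apply: eq_bigr => j _.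
    by rewrite /p /m -[LHS]/(t (us j)) -[in LHS](funrposBneg t).
  rewrite ler_norml; apply/andP; split; lra.
- by move=> u; rewrite /funrneg le_max lexx orbT.
- by move=> u gu; rewrite /funrneg /t gu mul0r oppr0 maxxx.
- by move=> u; rewrite /funrpos le_max lexx orbT.
- by move=> u gu; rewrite /funrpos /t gu mul0r maxxx.
Qed.

(** On the cube k_u(x, x) is at most 1, so summability of the weights settles convergence at every
    point. *)
Lemma domX_cube : domX gamma = @cube R nat.
Proof.
apply/seteqP; split => [x []//|x cx]; split=> //.
have [_ _] := wg; apply: le_lt_trans; apply: le_esum => u _.
rewrite lee_fin ler_piMr// (le_trans (ler_norm _))// kseq_bound//.
Qed.

Lemma kern_trunc_bound J x y : cube x -> cube y -> `|kern_trunc J x y| <= 1 + tail 0.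
Proof.
move=> cx cy; rewrite /kern_trunc (le_trans (ler_normD _ _))// normr1 lerD//.
rewrite (le_trans (ler_norm_sum _ _ _))//.
rewrite (le_trans _ (@sum_le_tail 0 J _))//; apply: ler_sum => j _.
by rewrite normrM (ger0_norm (g0 _)) ler_piMr// kseq_bound.
Qed.

Lemma kernK_bound x y : cube x -> cube y -> `|kernK gamma x y| <= 1 + 2 * tail 0.
Proof.
move=> cx cy; have := kernK_trunc 0 cx cy; have := kern_trunc_bound 0 cx cy.
rewrite !ler_norml => /andP[? ?] /andP[? ?]; apply/andP; split; lra.
Qed.

End Weights.

(** * Expectation and variance of bounded random variables *)

(** Applied with weights gamma_u to the sets u within a level, and with weights 1 to the bias and
    the levels. *)
Lemma sum_CS (R : realFieldType) (I : Type) (r : seq I) (x p : I -> R) :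
  (forall i, 0 < p i) ->
  (\sum_(i <- r) x i) ^+ 2 <=
    (\sum_(i <- r) p i) * (\sum_(i <- r) (p i)^-1 * x i ^+ 2).
Proof.
move=> p0; elim: r => [|i r IH]; first by rewrite !big_nil expr0n mulr0.
rewrite !big_cons; move: IH.
set D := x i; set S := \sum_(_ <- r) x _; set A := \sum_(_ <- r) p _.
set B := \sum_(_ <- r) _ * _ => IH.
have A0 : 0 <= A by apply: sumr_ge0 => j _; exact: ltW.
have B0 : 0 <= B by apply: sumr_ge0 => j _; rewrite mulr_ge0 ?sqr_ge0// invr_ge0 ltW.
have q0 := p0 i; set q := p i in q0 *.
have -> : (q + A) * (q^-1 * D ^+ 2 + B) = D ^+ 2 + A * B + (q * B + A * D ^+ 2 / q).
  by field; rewrite gt_eqF.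
have -> : (D + S) ^+ 2 = D ^+ 2 + S ^+ 2 + 2 * D * S by ring.
rewrite !lerD//.
(* [2 D S <= q B + A D^2 / q] by AM-GM and [S^2 <= A B] *)
have [A0'|A0'] := eqVneq A 0.
  have : S ^+ 2 <= 0 by rewrite (le_trans IH)// A0' mul0r.
  move=> S2; have /eqP -> : S == 0 by rewrite -sqrf_eq0 eq_le S2 sqr_ge0.
  by rewrite mulr0 A0' !mul0r addr0; apply: mulr_ge0 => //; exact: ltW.
have Apos : 0 < A by rewrite lt_def A0' A0.
have : S ^+ 2 / A <= B by rewrite ler_pdivrMr// mulrC.
move=> SB; apply: (@le_trans _ _ (q * (S ^+ 2 / A) + A * D ^+ 2 / q)); last first.
  by rewrite lerD2r; apply: ler_wpM2l => //; exact: ltW.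
rewrite -subr_ge0.
have -> : q * (S ^+ 2 / A) + A * D ^+ 2 / q - 2 * D * S =
    (q * S - A * D) ^+ 2 / (q * A) by field; rewrite !gt_eqF.
by rewrite divr_ge0 ?sqr_ge0// ltW// mulr_gt0.
Qed.

Section Ex.
Variables (R : realType) (d : measure_display) (T : measurableType d).
Variable P : probability T R.
Implicit Types X Y : T -> R.

Lemma measurable_fun_approx (D : set T) X :
  (forall e, 0 < e -> exists Y, measurable_fun D Y /\
     forall x, D x -> `|X x - Y x| <= e) -> measurable_fun D X.
Proof.
move=> H.
have /choice[Y YP] : forall n, exists Y, measurable_fun D Y /\
    forall x, D x -> `|X x - Y x| <= n.+1%:R^-1.
  by move=> n; apply: H; rewrite invr_gt0.
apply: (@measurable_fun_cvg _ _ _ _ Y) => [n|x Dx]; first by case: (YP n).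
apply/cvgrPdist_le => e e0.
have [N _ HN] := near_infty_natSinv_lt (PosNum e0).
exists N => // n /HN /= ne.
by case: (YP n) => _ /(_ x Dx) /le_trans; apply; exact: ltW.
Qed.

(** Under a probability such functions are integrable, and they are closed under sums and products,
    so means and variances need no other integrability condition. *)
Definition bounded_mfun X := measurable_fun setT X /\ exists C, forall w, `|X w| <= C.

Definition Ex X : R := \int[P]_w X w.

Lemma bm_int X : bounded_mfun X -> P.-integrable setT (EFin \o X).
Proof.
move=> [mX [C XC]]; apply: measurable_bounded_integrable => //.
  by rewrite (le_lt_trans (probability_le1 P measurableT))// ltry.
exists C; split; first exact: num_real.
by move=> r Cr x _ /=; apply: le_trans (XC x) _; exact: ltW.
Qed.

Lemma bmD X Y : bounded_mfun X -> bounded_mfun Y -> bounded_mfun (fun w => X w + Y w).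
Proof.
move=> [mX [C XC]] [mY [D YD]]; split; first exact: measurable_funD.
by exists (C + D) => w; apply: le_trans (ler_normD _ _) _; exact: lerD.
Qed.

Lemma bmM X Y : bounded_mfun X -> bounded_mfun Y -> bounded_mfun (fun w => X w * Y w).
Proof.
move=> [mX [C XC]] [mY [D YD]]; split; first exact: measurable_funM.
by exists (C * D) => w; rewrite normrM; apply: ler_pM.
Qed.

Lemma bm_cst r : bounded_mfun (fun=> r).
Proof. by split; [exact: measurable_cst|exists `|r|]. Qed.

Lemma bmZ r X : bounded_mfun X -> bounded_mfun (fun w => r * X w).
Proof. exact: bmM (bm_cst r). Qed.

Lemma bmB X Y : bounded_mfun X -> bounded_mfun Y -> bounded_mfun (fun w => X w - Y w).
Proof.
move=> bX bY; rewrite (_ : (fun w => _) = fun w => X w + (-1) * Y w).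
  exact/bmD/bmZ.
by apply/funext => w; rewrite mulN1r.
Qed.

Lemma bm_sqr X : bounded_mfun X -> bounded_mfun (fun w => X w ^+ 2).
Proof. by move=> bX; have := bmM bX bX; under eq_fun do rewrite -expr2. Qed.

Lemma bm_sum (I : Type) (r : seq I) (X : I -> T -> R) :
  (forall i, bounded_mfun (X i)) -> bounded_mfun (fun w => \sum_(i <- r) X i w).
Proof.
move=> bX; elim: r => [|i r IH]; first by under eq_fun do rewrite big_nil; exact: bm_cst.
by under eq_fun do rewrite big_cons; exact: bmD.
Qed.

Lemma bm_indic (A : set T) : measurable A -> bounded_mfun (\1_A).
Proof.
move=> mA; split; first exact: measurable_indic.
by exists 1 => w; rewrite indicE; case: (_ \in _); rewrite ?normr1 ?normr0.
Qed.

Lemma ExE X : bounded_mfun X -> 'E_P[X]%E = (Ex X)%:E.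
Proof.
by move=> bX; rewrite unlock /Ex /Rintegral fineK//; exact/integrable_fin_num/bm_int.
Qed.

Lemma ExD X Y : bounded_mfun X -> bounded_mfun Y -> Ex (fun w => X w + Y w) = Ex X + Ex Y.
Proof. by move=> bX bY; apply: RintegralD => //; exact: bm_int. Qed.

Lemma ExB X Y : bounded_mfun X -> bounded_mfun Y -> Ex (fun w => X w - Y w) = Ex X - Ex Y.
Proof. by move=> bX bY; apply: RintegralB => //; exact: bm_int. Qed.

Lemma ExZ r X : bounded_mfun X -> Ex (fun w => r * X w) = r * Ex X.
Proof. by move=> bX; apply: RintegralZl => //; exact: bm_int. Qed.

Lemma Ex_cst r : Ex (fun=> r) = r.
Proof. by rewrite /Ex Rintegral_cst// [X in fine X]probability_setT mulr1. Qed.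

Lemma Ex_le X Y : bounded_mfun X -> bounded_mfun Y -> (forall w, X w <= Y w) -> Ex X <= Ex Y.
Proof. by move=> bX bY XY; apply: le_Rintegral => //; exact: bm_int. Qed.

Lemma Ex_sum (I : Type) (r : seq I) (X : I -> T -> R) :
  (forall i, bounded_mfun (X i)) -> Ex (fun w => \sum_(i <- r) X i w) = \sum_(i <- r) Ex (X i).
Proof.
move=> bX; elim: r => [|i r IH].
  by under [in LHS]eq_fun do rewrite big_nil; rewrite Ex_cst big_nil.
under [in LHS]eq_fun do rewrite big_cons.
by rewrite ExD// ?IH ?big_cons//; exact: bm_sum.
Qed.

Lemma Ex_indic (A : set T) : measurable A -> Ex (\1_A) = fine (P A).
Proof. by move=> mA; rewrite /Ex /Rintegral integral_indic// setIT. Qed.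

Lemma Ex_dist X Y e : bounded_mfun X -> bounded_mfun Y -> (forall w, `|X w - Y w| <= e) ->
  `|Ex X - Ex Y| <= e.
Proof.
move=> bX bY XY; rewrite ler_norml; apply/andP; split.
  rewrite lerBrDl -[X in _ + X]Ex_cst -ExD//; last exact: bm_cst.
  apply: Ex_le => //; first by apply: bmD => //; exact: bm_cst.
  by move=> w; have := XY w; rewrite ler_norml => /andP[]; lra.
rewrite lerBlDl -[X in _ + X]Ex_cst -ExD//; last exact: bm_cst.
apply: Ex_le => //; first by apply: bmD => //; exact: bm_cst.
by move=> w; have := XY w; rewrite ler_norml => /andP[]; lra.
Qed.

Lemma Ex_le_cst X c : bounded_mfun X -> (forall w, X w <= c) -> Ex X <= c.
Proof. by move=> bX Xc; rewrite -[leRHS]Ex_cst; apply: Ex_le => //; exact: bm_cst. Qed.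

Lemma Ex_ge0 X : (forall w, 0 <= X w) -> 0 <= Ex X.
Proof. by move=> X0; exact: Rintegral_ge0. Qed.

Lemma Ex_simple (I : finType) (F : I -> R) (A : I -> set T) :
  (forall i, measurable (A i)) ->
  bounded_mfun (fun w => \sum_i F i * \1_(A i) w) /\
  Ex (fun w => \sum_i F i * \1_(A i) w) = \sum_i F i * fine (P (A i)).
Proof.
move=> mA; have bA i : bounded_mfun (fun w => F i * \1_(A i) w) by exact/bmZ/bm_indic.
split; first exact: bm_sum.
rewrite Ex_sum//; apply: eq_bigr => i _; rewrite ExZ ?Ex_indic//.
exact: bm_indic.
Qed.

Lemma sum_indic_eq (I : finType) (F : I -> R) (Z : T -> I) w :
  \sum_i F i * \1_(Z @^-1` [set i]) w = F (Z w).
Proof.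
rewrite (bigD1 (Z w))//= big1 ?addr0.
  by rewrite indicE mem_set// mulr1.
move=> i iZ; rewrite indicE memNset ?mulr0//= => Zi.
by rewrite Zi eqxx in iZ.
Qed.

Definition Var X : R := Ex (fun w => (X w - Ex X) ^+ 2).

Lemma bm_dev X : bounded_mfun X -> bounded_mfun (fun w => (X w - Ex X) ^+ 2).
Proof. by move=> bX; apply/bm_sqr/bmB => //; exact: bm_cst. Qed.

Lemma varianceEx X : bounded_mfun X -> variance P X = (Var X)%:E.
Proof.
move=> bX; rewrite /variance covariance.unlock (ExE bX)/= /Var -ExE; last exact: bm_dev.
by congr expectation; apply/funext => w; rewrite expr2.
Qed.

Lemma Var_cst r : Var (fun=> r) = 0.
Proof. by rewrite /Var !Ex_cst subrr expr0n. Qed.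

Lemma Var_ge0 X : 0 <= Var X.
Proof. by apply: Ex_ge0 => w; exact: sqr_ge0. Qed.

Lemma VarZ r X : bounded_mfun X -> Var (fun w => r * X w) = r ^+ 2 * Var X.
Proof.
move=> bX; rewrite /Var ExZ// -(ExZ _ (bm_dev bX)); congr Ex.
by apply/funext => w; rewrite -mulrBr exprMn.
Qed.

Lemma VarDc c X : bounded_mfun X -> Var (fun w => X w + c) = Var X.
Proof.
move=> bX; rewrite /Var ExD//; last exact: bm_cst.
by rewrite Ex_cst; congr Ex; apply/funext => w; rewrite opprD addrACA subrr addr0.
Qed.

Lemma VarB X Y : bounded_mfun X -> bounded_mfun Y -> Var (fun w => X w - Y w) <= 2 * Var X + 2 * Var Y.
Proof.
move=> bX bY; have bX2 := bm_dev bX; have bY2 := bm_dev bY.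
rewrite /Var -(ExZ _ bX2) -(ExZ _ bY2) -(ExD (bmZ _ bX2) (bmZ _ bY2)) (ExB bX bY).
apply: Ex_le.
- by rewrite -(ExB bX bY); apply/bm_dev/bmB.
- by apply: bmD; exact: bmZ.
by move=> w; have := sqr_ge0 ((X w - Ex X) + (Y w - Ex Y)); nra.
Qed.

Lemma Var_sum (I : Type) (r : seq I) (X : I -> T -> R) (p : I -> R) :
  (forall i, bounded_mfun (X i)) -> (forall i, 0 < p i) ->
  Var (fun w => \sum_(i <- r) X i w) <=
    (\sum_(i <- r) p i) * (\sum_(i <- r) Var (X i) / p i).
Proof.
move=> bX p0.
have -> : \sum_(i <- r) Var (X i) / p i =
    Ex (fun w => \sum_(i <- r) (p i)^-1 * (X i w - Ex (X i)) ^+ 2).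
  rewrite Ex_sum; first by apply: eq_bigr => i _; rewrite (ExZ _ (bm_dev (bX i))) mulrC.
  by move=> i; exact/bmZ/bm_dev.
rewrite -ExZ; last by apply: bm_sum => i; exact/bmZ/bm_dev.
rewrite /Var (Ex_sum _ bX); apply: Ex_le.
- by rewrite -(Ex_sum _ bX); apply/bm_dev/bm_sum.
- by apply: bmZ; apply: bm_sum => i; exact/bmZ/bm_dev.
by move=> w; rewrite -sumrB; exact: sum_CS.
Qed.

(** The difference Y - X and its mean are at most e in absolute value, so the centred difference is
    at most 2 e; [VarB] does the rest. *)
Lemma Var_approx X Y e : bounded_mfun X -> bounded_mfun Y -> (forall w, `|X w - Y w| <= e) ->
  Var X <= 2 * Var Y + 2 * (2 * e) ^+ 2.
Proof.
move=> bX bY XY.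
have -> : X = fun w => Y w - (Y w - X w) by apply/funext => w; rewrite subKr.
apply: le_trans (VarB _ _) _ => //; first exact: bmB.
rewrite lerD2l ler_wpM2l//; apply: Ex_le_cst; first exact/bm_dev/bmB.
move=> w; rewrite ExB// -[leLHS]real_normK ?num_real// ler_pXn2r ?nnegrE//;
  last by rewrite mulr_ge0// (le_trans _ (XY w)).
apply: le_trans (ler_normB _ _) _; rewrite mulrDl mul1r lerD//.
  by rewrite distrC.
by rewrite distrC; exact: Ex_dist.
Qed.

End Ex.
Arguments Ex_dist {R d T} P {X Y e}.

(** * Functions of independent uniform permutations *)

Section Pcont.
Variables (R : realType) (b : nat) (I : eqType).
Local Notation S := {perm 'F_b}.

(* Uniform continuity for the product topology on the assignments of permutations. *)
Definition pcont (Phi : (I -> S) -> R) := forall e, 0 < e -> exists r : seq I,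
  forall s s', (forall i, i \in r -> s i = s' i) -> `|Phi s - Phi s'| <= e.

Lemma pcont_cst c : pcont (fun=> c).
Proof. by move=> e e0; exists [::] => s s' _; rewrite subrr normr0 ltW. Qed.

Lemma pcontD Phi Psi : pcont Phi -> pcont Psi -> pcont (fun s => Phi s + Psi s).
Proof.
move=> c1 c2 e e0; have e2 : 0 < e / 2 by rewrite divr_gt0.
have [r1 h1] := c1 _ e2; have [r2 h2] := c2 _ e2.
exists (r1 ++ r2) => s s' ss'; rewrite opprD addrACA (splitr e).
apply: le_trans (ler_normD _ _) _; apply: lerD; [apply: h1|apply: h2] => i ir;
  by apply: ss'; rewrite mem_cat ir ?orbT.
Qed.

Lemma pcontZ c Phi : pcont Phi -> pcont (fun s => c * Phi s).
Proof.
move=> c1 e e0; have c0 : 0 < `|c| + 1 by rewrite ltr_pwDr.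
have [r h] := c1 _ (divr_gt0 e0 c0); exists r => s s' ss'.
rewrite -mulrBr normrM (le_trans (ler_wpM2l _ (h _ _ ss')))//.
by rewrite mulrCA ger_pMr// ler_pdivrMr// mul1r lerDl.
Qed.

Lemma pcont_sum (J : Type) (r : seq J) (Phi : J -> (I -> S) -> R) :
  (forall j, pcont (Phi j)) -> pcont (fun s => \sum_(j <- r) Phi j s).
Proof.
move=> c1; elim: r => [|j r IH].
  by under eq_fun do rewrite big_nil; exact: pcont_cst.
by under eq_fun do rewrite big_cons; exact: pcontD.
Qed.

Definition perm_ext (r : seq I) (t : (size r).-tuple S) : I -> S :=
  fun i => nth 1%g t (index i r).
Arguments perm_ext : clear implicits.

(** Up to an error 1, [Phi] takes only its values at the finitely many assignments
    [perm_ext r t]. *)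
Lemma pcont_bounded Phi : pcont Phi -> exists C, forall s, `|Phi s| <= C.
Proof.
move=> /(_ 1 ltr01)[r h].
exists (\sum_t `|Phi (perm_ext r t)| + 1) => s.
pose t := [tuple of map s (in_tuple r)].
have : `|Phi s - Phi (perm_ext r t)| <= 1.
  apply: h => i ir; rewrite /perm_ext /= (nth_map i) ?index_mem//.
  by rewrite nth_index.
have : `|Phi (perm_ext r t)| <= \sum_t `|Phi (perm_ext r t)|.
  by rewrite (bigD1 t)//= lerDl; exact: sumr_ge0.
have := ler_normD (Phi s - Phi (perm_ext r t)) (Phi (perm_ext r t)); rewrite subrK.
lra.
Qed.

Lemma pcontM Phi Psi : pcont Phi -> pcont Psi -> pcont (fun s => Phi s * Psi s).
Proof.
move=> c1 c2 e e0; have [C1 b1] := pcont_bounded c1; have [C2 b2] := pcont_bounded c2.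
have C10 : 0 <= C1 by exact: le_trans (b1 (fun=> 1%g)).
have C20 : 0 <= C2 by exact: le_trans (b2 (fun=> 1%g)).
have C0 : 0 < C1 + C2 + 1 by lra.
have [r1 h1] := c1 _ (divr_gt0 e0 C0); have [r2 h2] := c2 _ (divr_gt0 e0 C0).
exists (r1 ++ r2) => s s' ss'.
have -> : Phi s * Psi s - Phi s' * Psi s' =
  (Phi s - Phi s') * Psi s + Phi s' * (Psi s - Psi s') by ring.
apply: le_trans (ler_normD _ _) _; rewrite !normrM.
have H1 : `|Phi s - Phi s'| <= e / (C1 + C2 + 1).
  by apply: h1 => i ir; apply: ss'; rewrite mem_cat ir.
have H2 : `|Psi s - Psi s'| <= e / (C1 + C2 + 1).
  by apply: h2 => i ir; apply: ss'; rewrite mem_cat ir orbT.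
apply: (@le_trans _ _ (e / (C1 + C2 + 1) * C2 + C1 * (e / (C1 + C2 + 1)))).
  by apply: lerD; apply: ler_pM.
rewrite mulrC -mulrDl mulrA ler_pdivrMr// mulrC ler_pM2l//; lra.
Qed.

Section Law.
Variables (dsp : measure_display) (Omega : measurableType dsp).
Variables (P : probability Omega R) (pi : I -> Omega -> S).
Hypothesis ipi : iid_uniform_perms P pi.

Lemma perms_cell (r : seq I) (t : (size r).-tuple S) : uniq r ->
  let A := (fun w => [tuple of map (pi^~ w) (in_tuple r)]) @^-1` [set t] in
  measurable A /\ P A = (b`!%:R^-1 ^+ size r)%:E.
Proof.
move=> ur A; have [mpi Ppi Ipi] := ipi.
have AE : A = [set w | forall i, i \in r -> [set perm_ext r t i] (pi i w)].
  apply/seteqP; split => w /=.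
    move=> /(congr1 val)/= tE i ir.
    by rewrite /perm_ext -tE (nth_map i) ?index_mem// nth_index.
  move=> h; apply/val_inj/(@eq_from_nth _ 1%g); first by rewrite [RHS]size_tuple size_map.
  move=> k; rewrite [X in (_ < X)%N -> _]size_map => kr; rewrite /= (nth_map (tnth (in_tuple r) (Ordinal kr)))//.
  by rewrite h ?mem_nth// /perm_ext index_uniq.
split.
  rewrite (_ : A = \bigcap_(i in [set` r]) (pi i @^-1` [set perm_ext r t i])).
    apply: fin_bigcap_measurable => //; exact: finite_seq.
  by rewrite AE; apply/seteqP; split.
rewrite AE (Ipi r (fun i => [set perm_ext r t i]) ur); under eq_bigr do rewrite Ppi.
rewrite prodEFin; congr (_%:E).
by rewrite big_const_seq count_predT iter_mulr_1.
Qed.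

Lemma pcont_step (r : seq I) Phi : uniq r ->
  let X := fun w => Phi (perm_ext r [tuple of map (pi^~ w) (in_tuple r)]) in
  bounded_mfun X /\
  Ex P X = \sum_(t : (size r).-tuple S) Phi (perm_ext r t) * b`!%:R^-1 ^+ size r.
Proof.
move=> ur X.
have XE : X = fun w => \sum_t Phi (perm_ext r t) *
    \1_((fun w => [tuple of map (pi^~ w) (in_tuple r)]) @^-1` [set t]) w.
  by apply/funext => w; rewrite sum_indic_eq.
rewrite XE; have [|bX ->] := Ex_simple P (fun t => Phi (perm_ext r t))
    (A := fun t => (fun w => [tuple of map (pi^~ w) (in_tuple r)]) @^-1` [set t]).
  by move=> t; case: (perms_cell t ur).
by split=> //; apply: eq_bigr => t _; have [_ ->] := perms_cell t ur.
Qed.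

Lemma pcont_approx Phi e : pcont Phi -> 0 < e -> exists2 r : seq I, uniq r &
  forall w, `|Phi (pi^~ w) - Phi (perm_ext r [tuple of map (pi^~ w) (in_tuple r)])| <= e.
Proof.
move=> c e0; have [r h] := c _ e0; exists (undup r); first exact: undup_uniq.
move=> w; apply: h => i ir; rewrite /perm_ext /= (nth_map i) ?index_mem ?mem_undup//.
by rewrite nth_index ?mem_undup.
Qed.

Lemma pcont_bm Phi : pcont Phi -> bounded_mfun (fun w => Phi (pi^~ w)).
Proof.
move=> c; split; last first.
  by have [C h] := pcont_bounded c; exists C => w; exact: h.
apply: measurable_fun_approx => e e0.
have [r ur h] := pcont_approx c e0.
have [[mX _] _] := @pcont_step r Phi ur.
by eexists; split; [exact: mX|move=> w _; exact: h].
Qed.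

End Law.

(** Both means are within e / 2 of the average in [pcont_step], taken over all tuples of
    permutations, which mentions neither the probability nor the family. *)
Lemma pcont_law dsp (Omega : measurableType dsp) (P : probability Omega R) pi
    dsp0 (Omega0 : measurableType dsp0) (P0 : probability Omega0 R) pi0 Phi :
  iid_uniform_perms P pi -> iid_uniform_perms P0 pi0 -> pcont Phi ->
  Ex P (fun w => Phi (pi^~ w)) = Ex P0 (fun w => Phi (pi0^~ w)).
Proof.
move=> ipi ipi0 c; apply/eqP; rewrite -subr_eq0 -normr_eq0 eq_le normr_ge0 andbT.
apply/ler_addgt0Pr => e e0; rewrite add0r.
have e2 : 0 < e / 2 by rewrite divr_gt0.
have [r0 h] := c _ e2; set r := undup r0.
have ur : uniq r by exact: undup_uniq.
have H s : `|Phi s - Phi (perm_ext r [tuple of map s (in_tuple r)])| <= e / 2.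
  apply: h => i ir; rewrite /perm_ext /= (nth_map i) ?index_mem ?mem_undup//.
  by rewrite nth_index ?mem_undup.
have [b1 E1] := pcont_step ipi Phi ur; have [b2 E2] := pcont_step ipi0 Phi ur.
have := Ex_dist P (pcont_bm ipi c) b1 (fun w => H (pi^~ w)); rewrite E1.
have := Ex_dist P0 (pcont_bm ipi0 c) b2 (fun w => H (pi0^~ w)); rewrite E2 distrC.
set v := \sum_t _ => h1 h2.
rewrite -(subrKA v) (splitr e) (le_trans (ler_normD _ _))// lerD//.
Qed.

Lemma pcont_Var dsp (Omega : measurableType dsp) (P : probability Omega R) pi
    dsp0 (Omega0 : measurableType dsp0) (P0 : probability Omega0 R) pi0 Phi :
  iid_uniform_perms P pi -> iid_uniform_perms P0 pi0 -> pcont Phi ->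
  Var P (fun w => Phi (pi^~ w)) = Var P0 (fun w => Phi (pi0^~ w)).
Proof.
move=> ipi ipi0 c; rewrite /Var (pcont_law ipi ipi0 c).
set m := Ex P0 _.
have c2 : pcont (fun s => (Phi s - m) * (Phi s - m)).
  by apply: pcontM; apply: pcontD => //; exact: pcont_cst.
exact: (pcont_law ipi ipi0 c2).
Qed.

End Pcont.

(** * Owen scrambling *)

Section Scramble.
Variables (R : realType) (b : nat).
Hypothesis pb : prime b.
Local Notation S := {perm 'F_b}.
Implicit Types (sigma : seq 'F_b -> S) (xi : nat -> 'F_b).

Let b0 : (0 : R) < b%:R. Proof. by rewrite ltr0n prime_gt0. Qed.

Definition scr_digit sigma xi (l : nat) : nat := sigma (mkseq xi l) (xi l).

(** The first [l] scrambled digits read as an integer: the point lies in the closed interval of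
    length b^(-l) that starts at [scr_cell] / b^l. *)
Fixpoint scr_cell sigma xi (l : nat) : nat :=
  if l is l'.+1 then b * scr_cell sigma xi l' + scr_digit sigma xi l' else 0.

Lemma scr_digit_lt sigma xi l : (scr_digit sigma xi l < b)%N.
Proof. by rewrite -[ltnRHS](Fp_cast pb) ltn_ord. Qed.

Lemma scr_cell_lt sigma xi l : (scr_cell sigma xi l < b ^ l)%N.
Proof.
elim: l => [//|l IH] /=; have := scr_digit_lt sigma xi l; rewrite expnS.
nia.
Qed.

(** Digit i carries the weight b^(l - 1 - i) in the integer. The lemma turns an event about a cell
    into one condition per permutation. *)
Lemma scr_cellP sigma xi l (c : nat) : (c < b ^ l)%N ->
  scr_cell sigma xi l = c <->
  forall i, (i < l)%N -> scr_digit sigma xi i = ((c %/ b ^ (l.-1 - i)) %% b)%N.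
Proof.
elim: l c => [|l IH] c; first by rewrite expn0 ltnS leqn0 => /eqP -> /=.
move=> cl /=; have bp := prime_gt0 pb.
have dl := scr_digit_lt sigma xi l.
have -> : (b * scr_cell sigma xi l + scr_digit sigma xi l)%N = c <->
    scr_cell sigma xi l = (c %/ b)%N /\ scr_digit sigma xi l = (c %% b)%N.
  split=> [<-|[-> ->]]; last by rewrite mulnC -divn_eq.
  by rewrite mulnC divnMDl// modnMDl divn_small// modn_small// addn0.
rewrite IH; last by rewrite ltn_divLR// mulnC -expnS.
split=> [[h1 h2] i|h].
  rewrite ltnS leq_eqVlt => /predU1P[->|il]; first by rewrite subnn expn0 divn1.
  rewrite h1// -divnMA -expnS; congr ((_ %/ b ^ _) %% _)%N.
  by case: l il {IH cl dl h1 h2} => // l il; rewrite /= subSn.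
split; last by rewrite h// subnn expn0 divn1.
move=> i il; rewrite h ?leqW// -divnMA -expnS.
congr ((_ %/ b ^ _) %% _)%N.
by case: l il {IH cl dl h} => // l il; rewrite /= subSn.
Qed.

Lemma scr_cellE sigma xi l :
  series (fun l => (sigma (mkseq xi l) (xi l) : nat)%:R / b%:R ^+ l.+1 : R) l =
  (scr_cell sigma xi l)%:R / (b ^ l)%:R.
Proof.
elim: l => [|l IH]; first by rewrite seriesEnat/= big_geq// mul0r.
rewrite seriesSr IH /= natrD natrM !natrX -/(scr_digit sigma xi l) exprS.
have bl : (0 : R) < b%:R ^+ l by rewrite exprn_gt0.
by field; rewrite !gt_eqF.
Qed.

(** Partial sums increase, and since a digit is at most b - 1, the terms from n to n + m add up to
    at most b^(-n) - b^(-(n + m)). This telescoping bound also gives convergence. *)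
Lemma scr_trunc_near sigma xi l :
  (scr_cell sigma xi l)%:R / (b ^ l)%:R <= scramble R sigma xi /\
  scramble R sigma xi <= (scr_cell sigma xi l)%:R / (b ^ l)%:R + (b ^ l)%:R^-1.
Proof.
rewrite /scramble; set u := series _.
have ui : {homo u : n m / (n <= m)%N >-> n <= m}.
  apply/nondecreasing_seqP => n; rewrite /u seriesSr lerDl.
  by rewrite divr_ge0// exprn_ge0// ltW.
have ub n m : u (n + m)%N <= u n + ((b ^ n)%:R^-1 - (b ^ (n + m))%:R^-1).
  elim: m => [|m IH]; first by rewrite addn0 subrr addr0.
  rewrite addnS /u seriesSr -/u.
  have : (scr_digit sigma xi (n + m))%:R <= b%:R - 1 :> R.
    by rewrite lerBrDr natr1 ler_nat scr_digit_lt.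
  rewrite -/(scr_digit sigma xi (n + m)).
  move: IH; rewrite !natrX !exprS.
  set B := b%:R ^+ (n + m); set v := b%:R ^+ n; set x := (scr_digit _ _ _)%:R => IH xb.
  have B0 : 0 < B by rewrite exprn_gt0.
  have : x / (b%:R * B) <= (b%:R - 1) / (b%:R * B).
    by rewrite ler_pM2r// invr_gt0 mulr_gt0.
  have -> : (b%:R - 1) / (b%:R * B) = B^-1 - (b%:R * B)^-1.
    by field; rewrite !gt_eqF.
  lra.
have uc : cvgn u.
  apply: nondecreasing_is_cvgn => //; exists 1 => _ [n _ <-].
  have := ub 0%N n; rewrite add0n expn0 invr1 {2}/u seriesEnat/= big_geq// add0r.
  by move=> /le_trans; apply; rewrite gerBl invr_ge0.
rewrite -scr_cellE -/u; split; first exact: nondecreasing_cvgn_le.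
apply: limr_le => //; exists l => // n /= ln.
have := ub l (n - l)%N; rewrite subnKC// => /le_trans; apply.
by rewrite lerD2l gerBl invr_ge0.
Qed.

Lemma scramble01 sigma xi : 0 <= scramble R sigma xi <= 1.
Proof.
have [] := scr_trunc_near sigma xi 0; rewrite /= mul0r add0r invr1.
by move=> -> ->.
Qed.

End Scramble.

Section Points.
Variables (R : realType) (b : nat) (J : eqType).
Hypothesis pb : prime b.
Local Notation S := {perm 'F_b}.

Definition spoint (s : J * seq 'F_b -> S) (xi : J -> nat -> 'F_b) : J -> R :=
  fun j => scramble R (fun w => s (j, w)) (xi j).

Lemma cube_spoint s xi : cube (spoint s xi).
Proof. by move=> j; exact: scramble01. Qed.

(* Uniform continuity on the cube for the product topology. *)
Definition ucont (f : (J -> R) -> R) := forall e, 0 < e ->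
  exists (r : seq J) (h : R), 0 < h /\ forall x y, cube x -> cube y ->
    (forall j, j \in r -> `|x j - y j| <= h) -> `|f x - f y| <= e.

Lemma small_bpow (h : R) : 0 < h -> exists l, (b ^ l)%:R^-1 <= h.
Proof.
move=> h0; exists (Num.truncn h^-1).+1.
rewrite invf_ple ?posrE ?ltr0n ?expn_gt0 ?prime_gt0//.
rewrite ltW// (lt_le_trans (truncnS_gt _))// ler_nat ltnW//.
exact/ltn_expl/prime_gt1.
Qed.

Definition scr_idx (r : seq J) (xi : J -> nat -> 'F_b) l : seq (J * seq 'F_b) :=
  [seq (j, mkseq (xi j) i) | j <- r, i <- iota 0 l].

(** A permutation is addressed by the unscrambled digits before it. Hence the permutations that
    determine the first [l] digits of the coordinates in [r] form one fixed finite list. *)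
Lemma ucont_pcont f xi : ucont f -> pcont (fun s => f (spoint s xi)).
Proof.
move=> cf e e0; have [r [h [h0 H]]] := cf e e0.
have [l lh] := small_bpow h0.
exists (scr_idx r xi l) => s s' ss'; apply: H; [exact: cube_spoint..|].
move=> j jr; have cE : scr_cell (fun w => s (j, w)) (xi j) l =
    scr_cell (fun w => s' (j, w)) (xi j) l.
  have : forall i, (i < l)%N -> s (j, mkseq (xi j) i) = s' (j, mkseq (xi j) i).
    by move=> i il; apply/ss'/allpairs_f => //; rewrite mem_iota.
  elim: l {lh ss'} => [//|l IH] ss' /=; rewrite IH; last first.
    by move=> i il; apply: ss'; rewrite ltnS ltnW.
  by rewrite /scr_digit ss'.
have [a1 a2] := scr_trunc_near R pb (fun w => s (j, w)) (xi j) l.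
have [b1 b2] := scr_trunc_near R pb (fun w => s' (j, w)) (xi j) l.
rewrite -cE in b1 b2; rewrite (le_trans _ lh)// ler_norml /spoint.
move: a1 a2 b1 b2; set c := _ / _; set v := _^-1.
by move=> *; apply/andP; split; lra.
Qed.

End Points.

(** * Unbiasedness of a scrambled point *)

Section Grid.
Variables (R : realType) (d : measure_display) (T : measurableType d).
Variables (P : probability T R) (D : set T).
Variables (J : eqType) (r : seq J) (n : nat) (C : J -> T -> 'I_n.+1).
Hypothesis ur : uniq r.
Hypothesis cells : forall c : J -> 'I_n.+1,
  let A := D `&` [set w | forall j, j \in r -> C j w = c j] in
  measurable A /\ P A = (n.+1%:R^-1 ^+ size r)%:E.

Definition grid_ext (t : (size r).-tuple 'I_n.+1) : J -> 'I_n.+1 :=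
  fun j => nth ord0 t (index j r).

Definition grid_mean (F : (J -> 'I_n.+1) -> R) : R :=
  \sum_(t : (size r).-tuple 'I_n.+1) F (grid_ext t) * n.+1%:R^-1 ^+ size r.

(** Applied twice: to [mu] with [D] the cube, and to a scrambled point with [D] the whole space. As
    [grid_mean] mentions neither measure, it links the two integrals. *)
Lemma grid_simple (F : (J -> 'I_n.+1) -> R) :
  (forall c c', (forall j, j \in r -> c j = c' j) -> F c = F c') ->
  exists Y : T -> R, [/\ bounded_mfun Y, Ex P Y = grid_mean F,
    (forall w, D w -> Y w = F (C^~ w)) & (forall w, ~ D w -> Y w = 0)].
Proof.
move=> Fr.
pose A (t : (size r).-tuple 'I_n.+1) :=
  D `&` [set w | forall j, j \in r -> C j w = grid_ext t j].
have mA t : measurable (A t) by case: (cells (grid_ext t)).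
have [bY EY] := Ex_simple P (fun t => F (grid_ext t)) mA.
exists (fun w => \sum_t F (grid_ext t) * \1_(A t) w); split=> //.
- by rewrite EY; apply: eq_bigr => t _; have [_ ->] := cells (grid_ext t).
- move=> w Dw; pose t0 := [tuple of map (C^~ w) (in_tuple r)].
  have t0E j : j \in r -> grid_ext t0 j = C j w.
    by move=> jr; rewrite /grid_ext /= (nth_map j) ?index_mem// nth_index.
  rewrite (bigD1 t0)//= big1 ?addr0.
    rewrite indicE mem_set ?mulr1; first exact: Fr.
    by split=> // j jr; rewrite t0E.
  move=> t tt0; rewrite indicE memNset ?mulr0// => -[_ Aw].
  move/eqP: tt0; apply; apply/val_inj/(@eq_from_nth _ ord0).
    by rewrite [LHS]size_tuple [RHS]size_tuple.
  move=> k; rewrite [X in (_ < X)%N -> _]size_tuple => kr.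
  pose j := tnth (in_tuple r) (Ordinal kr).
  have jr : j \in r by exact: mem_tnth.
  have kE : k = index j r by rewrite /j (tnth_nth (tnth (in_tuple r) (Ordinal kr))) index_uniq.
  by have := Aw j jr; rewrite -t0E// /grid_ext -kE.
- move=> w Dw; rewrite big1// => t _.
  by rewrite indicE memNset ?mulr0// => -[].
Qed.

End Grid.

Section GridLim.
Variables (R : realType) (d : measure_display) (T : measurableType d).
Variables (P : probability T R) (D : set T) (mD : measurable D).

Lemma approx_bm (X : T -> R) :
  (forall e, 0 < e -> exists Y : T -> R, [/\ bounded_mfun Y,
    (forall w, D w -> `|X w - Y w| <= e) & (forall w, ~ D w -> Y w = 0)]) ->
  bounded_mfun (X \_ D).
Proof.
move=> H; split.
  apply/measurable_restrict => //; rewrite setTI.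
  apply: measurable_fun_approx => e /H[Y [[mY _] XY _]]; exists Y; split=> //.
  exact: measurable_funTS.
have [Y [[_ [C YC]] XY _]] := H 1 ltr01; exists (C + 1) => w.
rewrite patchE; case: ifPn => [/set_mem Dw|_].
  have := XY w Dw; have := YC w; have := ler_normD (X w - Y w) (Y w).
  rewrite subrK; lra.
by rewrite normr0 addr_ge0// (le_trans _ (YC w)).
Qed.

Lemma approx_Ex (X Y : T -> R) e : bounded_mfun (X \_ D) -> bounded_mfun Y -> 0 <= e ->
  (forall w, D w -> `|X w - Y w| <= e) -> (forall w, ~ D w -> Y w = 0) ->
  `|\int[P]_(w in D) X w - Ex P Y| <= e.
Proof.
move=> bX bY e0 XY Y0; rewrite Rintegral_mkcond; apply: Ex_dist => // w.
rewrite patchE; case: ifPn => [/set_mem|/negP Dw]; first exact: XY.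
by rewrite Y0 ?subrr ?normr0// => /mem_set.
Qed.

End GridLim.

Section Perms.
Variables (R : realType) (b : nat).
Hypothesis pb : prime b.
Local Notation S := {perm 'F_b}.

(** Composition with the transposition of x and y carries these permutations bijectively to those
    that fix x. *)
Lemma card_perm_at (x y : 'F_b) : #|[set s : S | s x == y]%SET| = (b.-1)`!.
Proof.
have -> : [set s : S | s x == y]%SET =
    ((fun s : S => (s * tperm x y)%g) @^-1: [set s : S | perm_on [set~ x] s])%SET.
  apply/setP => s; rewrite !inE /perm_on; apply/eqP/fintype.subsetP => [sxy z|h].
    by rewrite !inE; apply: contraNneq => ->; rewrite permM sxy tpermR.
  have : (s * tperm x y)%g x = x.
    by apply/eqP; apply: contraT => /h; rewrite !inE eqxx.
  rewrite permM => /(congr1 (tperm x y)); rewrite tpermK => ->.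
  by rewrite tpermL.
rewrite card_preimset; last exact: mulIg.
by rewrite cardsE card_perm cardsC1 card_Fp.
Qed.

Variables (dsp : measure_display) (Omega : measurableType dsp).
Variables (P : probability Omega R) (I : eqType) (pi : I -> Omega -> S).
Hypothesis ipi : iid_uniform_perms P pi.

Lemma perm_at_prob i (x y : 'F_b) :
  measurable (pi i @^-1` [set s | s x = y]) /\
  P (pi i @^-1` [set s | s x = y]) = (b%:R^-1)%:E.
Proof.
have [mpi Ppi _] := ipi.
pose F (s : S) : R := (s x == y)%:R.
have [bY EY] := Ex_simple P F (mpi i).
have mE : measurable (pi i @^-1` [set s | s x = y]).
  rewrite (_ : _ @^-1` _ = \bigcup_(s in [set s : S | s x = y]) pi i @^-1` [set s]).
    by apply: fin_bigcup_measurable => //; exact: finite_finset.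
  by apply/seteqP; split => [w /= h|w [s /= <- ->]//]; exists (pi i w).
split=> //.
have YE : (fun w => \sum_s F s * \1_(pi i @^-1` [set s]) w) =
    \1_(pi i @^-1` [set s | s x = y]).
  apply/funext => w; rewrite (sum_indic_eq _ (pi i)) /F indicE; congr ((nat_of_bool _)%:R).
  by apply/eqP/idP => [h|/set_mem]; rewrite ?inE.
rewrite YE Ex_indic// in EY.
rewrite -[LHS]fineK; last by rewrite fin_num_measure.
rewrite EY; congr (_%:E); under eq_bigr do rewrite Ppi /=.
rewrite -mulr_suml.
have -> : \sum_s F s = (b.-1)`!%:R.
  rewrite -(card_perm_at x y) -sum1dep_card natr_sum [RHS]big_mkcond/=.
  by apply: eq_bigr => s _; rewrite /F; case: eqP.
rewrite -{2}(prednK (prime_gt0 pb)) factS prednK ?prime_gt0// natrM.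
have bne : (b%:R : R) != 0 by rewrite pnatr_eq0 -lt0n prime_gt0.
have fne : ((b.-1)`!%:R : R) != 0 by rewrite pnatr_eq0 -lt0n fact_gt0.
by field; rewrite bne fne.
Qed.

Lemma perms_at_prob (r : seq I) (x y : I -> 'F_b) : uniq r ->
  let A := [set w | forall i, i \in r -> pi i w (x i) = y i] in
  measurable A /\ P A = (b%:R^-1 ^+ size r)%:E.
Proof.
move=> ur A; have [_ _ Ipi] := ipi.
split.
  rewrite (_ : A = \bigcap_(i in [set` r]) (pi i @^-1` [set s | s (x i) = y i])).
    apply: fin_bigcap_measurable; first exact: finite_seq.
    by move=> i _; case: (perm_at_prob i (x i) (y i)).
  by apply/seteqP; split.
rewrite /A (Ipi r (fun i => [set s | s (x i) = y i]) ur).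
rewrite (eq_bigr (fun=> (b%:R^-1)%:E)); last by move=> i _; case: (perm_at_prob i (x i) (y i)).
by rewrite prodEFin big_const_seq count_predT iter_mulr_1.
Qed.

End Perms.

Section Unbiased.
Variables (R : realType) (b : nat).
Hypothesis pb : prime b.
Local Notation S := {perm 'F_b}.

(** Prescribing a cell prescribes [l] digits, each of them one value of one permutation. The
    [size r * l] permutations have distinct indices, differing in the coordinate or in the length of
    the address, so independence gives a product of factors 1 / b. *)
Lemma scr_cells_prob (dsp : measure_display) (Omega : measurableType dsp)
    (P : probability Omega R) (J : eqType) (pi : J * seq 'F_b -> Omega -> S)
    (xi : J -> nat -> 'F_b) (r : seq J) l n (c : J -> 'I_n.+1) :
  iid_uniform_perms P pi -> uniq r -> n.+1 = (b ^ l)%N ->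
  let A := [set w | forall j, j \in r ->
    inord (scr_cell (fun s => pi (j, s) w) (xi j) l) = c j] in
  measurable A /\ P A = (n.+1%:R^-1 ^+ size r)%:E.
Proof.
move=> ipi ur nE A.
(* The length of an address is the position of the digit to which its permutation is applied. *)
pose x (p : J * seq 'F_b) := xi p.1 (size p.2).
pose y (p : J * seq 'F_b) : 'F_b := inord ((c p.1 %/ b ^ (l.-1 - size p.2)) %% b).
have uidx : uniq (scr_idx r xi l).
  apply: allpairs_uniq_dep => //; first by move=> j _; exact: iota_uniq.
  move=> [j i] [j' i'] /= _ _ [-> /(congr1 size)]; rewrite !size_mkseq => -> //.
have szidx : size (scr_idx r xi l) = (size r * l)%N.
  by rewrite size_allpairs size_iota.
have [mA PA] := perms_at_prob pb ipi x y uidx.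
suff -> : A = [set w | forall p, p \in scr_idx r xi l -> pi p w (x p) = y p].
  split; first exact: mA.
  by rewrite PA szidx mulnC exprM nE natrX exprVn.
have cl j : (c j < b ^ l)%N by rewrite -nE.
have cE w j : inord (scr_cell (fun s => pi (j, s) w) (xi j) l) = c j <->
    scr_cell (fun s => pi (j, s) w) (xi j) l = c j.
  split=> [<-|->]; last by rewrite inord_val.
  by rewrite inordK// nE scr_cell_lt.
have yE j i : (y (j, mkseq (xi j) i) : nat) = ((c j %/ b ^ (l.-1 - i)) %% b)%N.
  by rewrite /y /= size_mkseq inordK// Fp_cast// ltn_mod prime_gt0.
apply/seteqP; split => w /= h.
  move=> p /allpairsP[[j i] [/= jr]]; rewrite mem_iota/= add0n => il ->.
  rewrite /x /= size_mkseq; apply/val_inj; rewrite /= yE.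
  by have /cE/(scr_cellP pb _ _ (cl j))/(_ i il) := h j jr.
move=> j jr; apply/cE/(scr_cellP pb _ _ (cl j)) => i il.
have hji : pi (j, mkseq (xi j) i) w (xi j i) = y (j, mkseq (xi j) i).
  have := h (j, mkseq (xi j) i); rewrite /x /= size_mkseq; apply.
  by apply/allpairs_f => //; rewrite mem_iota.
by rewrite /scr_digit hji yE.
Qed.

Variable mu : probability (seqsp R) R.
Hypothesis hmu : is_product_measure mu.

Lemma measurable_coord (j : nat) (B : set R) : measurable B ->
  measurable ([set x : seqsp R | B (x j)] : set (seqsp R)).
Proof. by move=> mB; apply: sub_sigma_algebra; exists j, B. Qed.

Lemma measurable_cube : measurable (@cube R nat : set (seqsp R)).
Proof.
rewrite (_ : @cube R nat = \bigcap_j [set x : seqsp R | `[0, 1]%classic (x j)]).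
  by apply: bigcapT_measurable => j; exact: measurable_coord.
apply/seteqP; split => [x cx j _ /=|x cx j]; first by rewrite in_itv/=; exact: cx.
by have := cx j I; rewrite /= in_itv.
Qed.

Lemma mu_cube : mu (@cube R nat) = 1%E.
Proof.
suff : mu.-negligible (~` (@cube R nat : set (seqsp R))).
  move=> /(measure_negligible (measurableC measurable_cube)) m0.
  have := probability_setC mu measurable_cube.
  rewrite [X in X = _](_ : _ = 0%E)//.
  have : mu (@cube R nat) \is a fin_num by apply: fin_num_measure; exact: measurable_cube.
  by case: (mu _) => // x _ /= [] /esym/eqP; rewrite subr_eq0 => /eqP <-.
rewrite (_ : ~` _ = \bigcup_j [set x : seqsp R | (~` `[0, 1]%classic) (x j)]).
  apply: negligible_bigcup => j; exists [set x : seqsp R | (~` `[0, 1]%classic) (x j)].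
  have mI : measurable (~` `[0, 1]%classic : set R) by exact: measurableC.
  split=> //; first exact: measurable_coord.
  have := @hmu [fset j]%fset (fun=> ~` `[0, 1]%classic) (fun=> mI).
  rewrite big_seq_fset1 setICl measure0 => <-.
  congr (mu _); apply/seteqP; split => [x /= h i|x /= h]; last by apply: h; rewrite inE.
  by rewrite inE => /eqP ->.
apply/seteqP; split => [x /= /existsNP[j xj]|x [j _] /= xj cx].
  by exists j => //=; rewrite in_itv.
by apply: xj; rewrite in_itv/=; exact: cx.
Qed.

(** Half-open boxes, the last one closed so that they partition [0, 1]; correspondingly [cellof]
    sends 1 to the last cell through [minn]. *)
Definition box n (c : 'I_n.+1) : set R :=
  if (c < n)%N then `[c%:R / n.+1%:R, c.+1%:R / n.+1%:R[%classic
  else `[c%:R / n.+1%:R, 1]%classic.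

Definition cellof n (x : R) : 'I_n.+1 := inord (minn (Num.truncn (x * n.+1%:R)) n).

Lemma cellofP n (c : 'I_n.+1) (x : R) : 0 <= x <= 1 -> cellof n x = c <-> box c x.
Proof.
move=> /andP[x0 x1].
have n0 : (0 : R) < n.+1%:R by [].
have xn : 0 <= x * n.+1%:R by rewrite mulr_ge0.
have /andP[t1 t2] := truncn_itv xn.
have -> : cellof n x = c <-> minn (Num.truncn (x * n.+1%:R)) n = c.
  split=> [<-|h]; first by rewrite inordK// ltnS geq_minr.
  by apply/val_inj; rewrite /= inordK// ltnS geq_minr.
rewrite /box; case: ltnP => cn /=; rewrite in_itv/=.
  rewrite ler_pdivrMr// ltr_pdivlMr//.
  split=> [|/andP[c1 c2]].
    move=> mc; have tc : Num.truncn (x * n.+1%:R) = c by move: mc cn; rewrite /minn; case: ifP => [//|_ <-]; rewrite ltnn.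
    by rewrite -tc t1 t2.
  have -> : Num.truncn (x * n.+1%:R) = c by apply: truncn_def; rewrite c1 c2.
  by apply/minn_idPl; exact: ltnW.
have cE : (c : nat) = n by apply/eqP; rewrite eqn_leq cn -ltnS ltn_ord.
rewrite cE ler_pdivrMr// x1 andbT; split.
  by move=> /minn_idPr nt; rewrite (le_trans _ t1)// ler_nat.
move=> nx; apply/minn_idPr; rewrite -ltnS -(ltr_nat R).
exact: le_lt_trans t2.
Qed.

Lemma box_measure n (c : 'I_n.+1) :
  measurable (box c) /\ lebesgue_measure (box c `&` `[0, 1]) = (n.+1%:R^-1)%:E.
Proof.
have n0 : (0 : R) < n.+1%:R by [].
have sub : box c `<=` `[0, 1]%classic.
  move=> x; rewrite /box; case: ltnP => cn /=; rewrite !in_itv/= => /andP[h1 h2].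
    rewrite (le_trans _ h1) ?divr_ge0//= ltW// (lt_le_trans h2)//.
    by rewrite ler_pdivrMr// mul1r ler_nat.
  by rewrite (le_trans _ h1) ?divr_ge0.
rewrite setIidl// /box; case: ltnP => cn; split=> //; rewrite lebesgue_measure_itv/=.
  rewrite lte_fin ltr_pM2r ?invr_gt0// ltr_nat ltnS leqnn -EFinB -mulrBl.
  by rewrite -natrB// subSnn mul1r.
have cE : (c : nat) = n by apply/eqP; rewrite eqn_leq cn -ltnS ltn_ord.
rewrite cE lte_fin ltr_pdivrMr// mul1r ltr_nat ltnS leqnn -EFinB; congr (_%:E).
by rewrite -natr1; field; rewrite natr1 gt_eqF.
Qed.

Lemma mu_cells_prob (u : {fset nat}) n (c : nat -> 'I_n.+1) :
  let A := (@cube R nat : set (seqsp R)) `&`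
    [set x | forall j, j \in (u : seq nat) -> cellof n (x j) = c j] in
  measurable A /\ mu A = (n.+1%:R^-1 ^+ size u)%:E.
Proof.
pose B : set (seqsp R) := [set x : nat -> R | forall j, j \in u -> box (c j) (x j)].
have mB : measurable B.
  rewrite (_ : B = \bigcap_(j in [set` u]) [set x : seqsp R | box (c j) (x j)]).
    apply: fin_bigcap_measurable; first exact: finite_fset.
    by move=> j _; apply: measurable_coord; case: (box_measure (c j)).
  by apply/seteqP; split.
have BE : mu B = (n.+1%:R^-1 ^+ size u)%:E.
  rewrite (hmu u (fun j => proj1 (box_measure (c j)))).
  rewrite (eq_bigr (fun=> (n.+1%:R^-1)%:E)); last by move=> j _; case: (box_measure (c j)).
  by rewrite prodEFin big_const_seq count_predT iter_mulr_1.
rewrite (_ : _ `&` _ = @cube R nat `&` B).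
  split; first exact: measurableI measurable_cube mB.
  rewrite -BE; apply/eqP; rewrite eq_le; apply/andP; split.
    by rewrite setIC; apply: measureIl => //; exact: measurable_cube.
  have mc : measurable (~` (cube (I:=nat) : set (seqsp R))) by apply: measurableC; exact: measurable_cube.
  have m0 : mu (~` (cube (I:=nat))) = 0%E.
    rewrite probability_setC ?mu_cube ?subee//; exact: measurable_cube.
  rewrite -[leRHS]adde0 -m0.
  apply: le_trans (measureU2 _ _ mc); last exact: measurableI measurable_cube mB.
  apply: le_measure; rewrite ?inE//.
    by apply: measurableU => //; exact: measurableI measurable_cube mB.
  by move=> x Bx; have [cx|] := pselect (cube x); [left|right].
by apply/seteqP; split => x /= [cx h]; split => // j ju; exact/(cellofP _ (cx j))/h.
Qed.

Definition gridpt (u : seq nat) n (c : nat -> 'I_n.+1) : nat -> R :=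
  fun j => if j \in u then (c j)%:R / n.+1%:R else 0.

Lemma cube_gridpt u n (c : nat -> 'I_n.+1) : cube (gridpt u c).
Proof.
move=> j; rewrite /gridpt; case: ifP => _; last by rewrite lexx ler01.
by rewrite divr_ge0//= ler_pdivrMr// mul1r ler_nat ltnW.
Qed.

Lemma ucont_grid (f : (nat -> R) -> R) e : ucont f -> 0 < e ->
  exists (u : {fset nat}) (l n : nat), n.+1 = (b ^ l)%N /\
    forall x (c : nat -> 'I_n.+1), cube x ->
    (forall j, j \in u -> `|x j - (c j)%:R / n.+1%:R| <= (b ^ l)%:R^-1) ->
    `|f x - f (gridpt u c)| <= e.
Proof.
move=> cf e0; have [r [h [h0 H]]] := cf e e0.
have [l lh] := small_bpow pb h0.
exists [fset j in r]%fset, l, (b ^ l).-1; split.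
  by rewrite prednK// expn_gt0 prime_gt0.
move=> x c cx xc; apply: H => //; first exact: cube_gridpt.
move=> j jr; have ju : j \in [fset j in r]%fset by rewrite inE.
by rewrite /gridpt ju (le_trans (xc j ju)).
Qed.

Lemma ucont_mu (f : (nat -> R) -> R) (u : {fset nat}) l n e : ucont f -> 0 < e ->
  n.+1 = (b ^ l)%N ->
  (forall x (c : nat -> 'I_n.+1), cube x ->
    (forall j, j \in u -> `|x j - (c j)%:R / n.+1%:R| <= (b ^ l)%:R^-1) ->
    `|f x - f (gridpt u c)| <= e) ->
  exists Y : seqsp R -> R, [/\ bounded_mfun Y, Ex mu Y = grid_mean (u : seq nat) (fun c : nat -> 'I_n.+1 => f (gridpt u c)),
    (forall x, cube x -> `|f x - Y x| <= e) & (forall x, ~ cube x -> Y x = 0)].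
Proof.
move=> cf e0 nE H.
have [|||Y [bY EY YD Y0]] := @grid_simple R _ (seqsp R) mu (cube (I:=nat)) nat (u : seq nat) n
    (fun j x => cellof n (x j)) _ _ (fun c : nat -> 'I_n.+1 => f (gridpt u c)).
- exact: fset_uniq.
- by move=> c; exact: mu_cells_prob.
- move=> c c' cc'; congr f; apply/funext => j; rewrite /gridpt.
  by case: ifP => // ju; rewrite cc'.
exists Y; split=> // x cx; rewrite YD//; apply: H => // j ju.
have [] : `[(cellof n (x j))%:R / n.+1%:R, (cellof n (x j)).+1%:R / n.+1%:R]%classic (x j).
  have := (cellofP (cellof n (x j)) (cx j)).1 erefl; rewrite /box.
  case: ltnP => cn /=; rewrite !in_itv/= => /andP[-> h2]; first exact: ltW.
  rewrite (le_trans h2)// ler_pdivlMr// mul1r ler_nat//.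
rewrite /= in_itv/= => /andP[h1 h2].
rewrite ger0_norm ?subr_ge0// lerBlDl (le_trans h2)//.
by rewrite -nE -[in leLHS]natr1 mulrDl mul1r.
Qed.

Lemma ucont_bm (f : (nat -> R) -> R) : ucont f ->
  @bounded_mfun R _ (seqsp R) (f \_ (@cube R nat)).
Proof.
move=> cf; apply: approx_bm; first exact: measurable_cube.
move=> e e0; have [u [l [n [nE H]]]] := ucont_grid cf e0.
have [Y [bY _ Y1 Y2]] := ucont_mu cf e0 nE H.
by exists Y.
Qed.

(** In finitely many coordinates both [mu] and the scrambled point give all cells of side b^(-l) the
    same mass, and [f] is nearly constant on a cell. Both sides are thus within e / 2 of one grid
    mean. *)
Lemma scramble_unbiased (dsp : measure_display) (Omega : measurableType dsp)
    (P : probability Omega R) (pi : nat * seq 'F_b -> Omega -> S)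
    (xi : nat -> nat -> 'F_b) (f : (nat -> R) -> R) :
  iid_uniform_perms P pi -> ucont f ->
  Ex P (fun w => f (spoint R (pi^~ w) xi)) = \int[mu]_(x in cube (I:=nat)) f x.
Proof.
move=> ipi cf; apply/eqP; rewrite -subr_eq0 -normr_eq0 eq_le normr_ge0 andbT.
apply/ler_addgt0Pr => e e0; rewrite add0r.
have e2 : 0 < e / 2 by rewrite divr_gt0.
have [u [l [n [nE H]]]] := ucont_grid cf e2.
have [Y [bY EY Y1 Y2]] := ucont_mu cf e2 nE H.
have h1 := approx_Ex mu (ucont_bm cf) bY (ltW e2) Y1 Y2.
have [|||Z [bZ EZ ZD _]] := @grid_simple R _ Omega P setT nat (u : seq nat) n
    (fun j w => inord (scr_cell (fun s => pi (j, s) w) (xi j) l)) _ _ (fun c : nat -> 'I_n.+1 => f (gridpt u c)).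
- exact: fset_uniq.
- by move=> c; rewrite setTI; exact: (scr_cells_prob xi c ipi (fset_uniq u) nE).
- move=> c c' cc'; congr f; apply/funext => j; rewrite /gridpt.
  by case: ifP => // ju; rewrite cc'.
have bX := pcont_bm ipi (ucont_pcont pb xi cf).
have h2 : `|Ex P (fun w => f (spoint R (pi^~ w) xi)) - Ex P Z| <= e / 2.
  apply: (Ex_dist P bX bZ) => w; rewrite ZD//; apply: H; first exact: cube_spoint.
  move=> j ju; have [h3 h4] := scr_trunc_near R pb (fun s => pi (j, s) w) (xi j) l.
  rewrite inordK ?nE ?scr_cell_lt// /spoint ger0_norm ?subr_ge0//.
  by rewrite lerBlDl.
rewrite EY in h1; rewrite EZ in h2.
rewrite (splitr e) -(subrKA (grid_mean (u : seq nat) (fun c : nat -> 'I_n.+1 => f (gridpt u c)))).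
by rewrite (le_trans (ler_normD _ _))// lerD// distrC.
Qed.

End Unbiased.

(** * Variance of one level *)

Section Ucont.
Variables (R : realType).

Lemma ucontD (J : eqType) (f g : (J -> R) -> R) : ucont f -> ucont g ->
  ucont (fun x => f x + g x).
Proof.
move=> cf cg e e0; have e2 : 0 < e / 2 by rewrite divr_gt0.
have [r1 [h1 [h10 H1]]] := cf _ e2; have [r2 [h2 [h20 H2]]] := cg _ e2.
exists (r1 ++ r2), (Num.min h1 h2); split; first by rewrite lt_min h10.
move=> x y cx cy xy; rewrite opprD addrACA (splitr e).
rewrite (le_trans (ler_normD _ _))// lerD//.
  by apply: H1 => // j jr; have := xy j; rewrite mem_cat jr le_min => /(_ isT)/andP[].
by apply: H2 => // j jr; have := xy j; rewrite mem_cat jr orbT le_min => /(_ isT)/andP[].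
Qed.

Lemma ucontZ (J : eqType) c (f : (J -> R) -> R) : ucont f ->
  ucont (fun x => c * f x).
Proof.
move=> cf e e0; have c0 : 0 < `|c| + 1 by rewrite ltr_pwDr.
have [r [h [h0 H]]] := cf _ (divr_gt0 e0 c0); exists r, h; split=> //.
move=> x y cx cy xy; rewrite -mulrBr normrM (le_trans (ler_wpM2l _ (H x y cx cy xy)))//.
by rewrite mulrCA ger_pMr// ler_pdivrMr// mul1r lerDl.
Qed.

Lemma ucontB (J : eqType) (f g : (J -> R) -> R) : ucont f -> ucont g ->
  ucont (fun x => f x - g x).
Proof.
move=> cf cg; have := ucontD cf (ucontZ (-1) cg).
by under eq_fun do rewrite mulN1r.
Qed.

Lemma ucont_sum (J : eqType) (I : Type) (r : seq I) (f : I -> (J -> R) -> R) :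
  (forall i, ucont (f i)) -> ucont (fun x => \sum_(i <- r) f i x).
Proof.
move=> cf; elim: r => [|i r IH].
  under eq_fun do rewrite big_nil.
  by move=> e e0; exists [::], 1; split=> // x y _ _ _; rewrite subrr normr0 ltW.
by under eq_fun do rewrite big_cons; exact: ucontD.
Qed.

Lemma sum_le_size (I : eqType) (r : seq I) (g : I -> R) c :
  (forall i, i \in r -> g i <= c) -> \sum_(i <- r) g i <= (size r)%:R * c.
Proof.
elim: r => [|i r IH] H; first by rewrite big_nil mul0r.
rewrite big_cons /= -natr1 mulrDl mul1r addrC lerD//.
  by apply: IH => k kr; apply: H; rewrite inE kr orbT.
by apply: H; rewrite inE eqxx.
Qed.

Lemma lip_ucont (J : eqType) (f : (J -> R) -> R) (r : seq J) C : 0 <= C ->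
  (forall x y, cube x -> cube y -> `|f x - f y| <= C * \sum_(j <- r) `|x j - y j|) ->
  ucont f.
Proof.
move=> C0 H e e0; pose M := C * (size r)%:R + 1.
have M0 : 0 < M by rewrite ltr_wpDl// mulr_ge0.
exists r, (e / M); split; first by rewrite divr_gt0.
move=> x y cx cy xy; rewrite (le_trans (H x y cx cy))//.
rewrite (le_trans (ler_wpM2l C0 (sum_le_size xy)))//.
have -> : C * ((size r)%:R * (e / M)) = e * (C * (size r)%:R / M) by ring.
by rewrite ger_pMr// ler_pdivrMr// mul1r lerDl.
Qed.

Lemma cube_anchored (a : nat -> R) v x : cube a -> cube x -> cube (anchored a v x).
Proof. by move=> ca cx j; rewrite /anchored; case: ifP. Qed.

Lemma ucont_anchored (a : nat -> R) v f : cube a -> ucont f ->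
  ucont (fun x => f (anchored a v x)).
Proof.
move=> ca cf e e0; have [r [h [h0 H]]] := cf e e0; exists r, h; split=> //.
move=> x y cx cy xy; apply: H; [exact: cube_anchored..|] => j jr.
by rewrite /anchored; case: ifP => _; [exact: xy|rewrite subrr normr0 ltW].
Qed.

Lemma sqr_le_norm (x e : R) : 0 <= e -> x ^+ 2 <= e ^+ 2 -> `|x| <= e.
Proof. by move=> e0; rewrite -[x ^+ 2]real_normK ?num_real// ler_sqr ?nnegrE. Qed.

Lemma ucont_kseq u (y : nat -> R) : cube y -> ucont (fun x => kseq u x y).
Proof.
move=> cy; apply: (@lip_ucont _ _ u 2) => // x x' cx cx'.
by rewrite mulr_sumr kseq_lip.
Qed.

(** The reproducing property bounds a squared increment of [f] by K(x,x) - 2 K(x,y) + K(y,y), which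
    is two increments of a Lipschitz kernel in one argument. Each has constant 2, whence the 4 in
    [M]. *)
Lemma ucont_Hd d (u : {set 'I_d}) (H : rkhs (@cube R 'I_d) (@kprod R d u)) (f : H) :
  ucont (rkhs_ev f).
Proof.
move=> e e0; pose M := 4 * (`|f| ^+ 2) * (size (enum 'I_d))%:R + 1.
have M0 : 0 < M by rewrite ltr_wpDl// !mulr_ge0// sqr_ge0.
exists (enum 'I_d), (e ^+ 2 / M); split; first by rewrite divr_gt0// exprn_gt0.
move=> x y cx cy xy; apply: sqr_le_norm; first exact: ltW.
rewrite (le_trans (rev_dist _ cx cy))//.
have S : \sum_j `|x j - y j| <= (size (enum 'I_d))%:R * (e ^+ 2 / M).
  by rewrite -big_enum; exact: sum_le_size.
have K4 : kprod u x x - 2 * kprod u x y + kprod u y y <=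
    4 * ((size (enum 'I_d))%:R * (e ^+ 2 / M)).
  have := kprod_lip u cx cy cx; have := kprod_lip u cx cy cy.
  rewrite -mulr_sumr (kprodC u y x) !ler_norml => /andP[h1 _] /andP[_ h2]; lra.
rewrite (le_trans (ler_wpM2l _ K4)) ?sqr_ge0//.
have -> : `|f| ^+ 2 * (4 * ((size (enum 'I_d))%:R * (e ^+ 2 / M))) =
    e ^+ 2 * ((4 * `|f| ^+ 2 * (size (enum 'I_d))%:R) / M) by ring.
by rewrite ger_pMr ?exprn_gt0// ler_pdivrMr// mul1r lerDl.
Qed.

End Ucont.

(** * Regularity of the functions in H(K) *)

Section HK.
Variables (R : realType) (gamma : weights R) (us : nat -> {fset nat}).
Hypotheses (wg : is_weights gamma) (og : ordering gamma us).
Variable HK : rkhs (domX gamma) (kernK gamma).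

Let g0 u : 0 <= gamma u. Proof. by case: wg. Qed.
Let dX x : cube x -> domX gamma x. Proof. by rewrite domX_cube. Qed.

Lemma kern_trunc_eq J x y z : (forall j i, (j < J)%N -> i \in us j -> x i = y i) ->
  kern_trunc gamma us J x z = kern_trunc gamma us J y z.
Proof.
move=> xy; congr (_ + _); rewrite big_nat [RHS]big_nat; apply: eq_bigr => j jJ.
congr (_ * _); rewrite /kseq big_seq [RHS]big_seq; apply: eq_bigr => i iu.
by rewrite (xy j).
Qed.

Lemma kern_truncC J x y : kern_trunc gamma us J x y = kern_trunc gamma us J y x.
Proof. by congr (_ + _); apply: eq_bigr => j _; rewrite kseqC. Qed.

(** Truncating the kernel costs one tail for each diagonal term and two for the mixed term. *)
Lemma HK_dist (f : HK) J x y : cube x -> cube y ->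
  (rkhs_ev f x - rkhs_ev f y) ^+ 2 <= `|f| ^+ 2 *
    (kern_trunc gamma us J x x - 2 * kern_trunc gamma us J x y + kern_trunc gamma us J y y +
     4 * tail gamma us J).
Proof.
move=> cx cy; rewrite (le_trans (rev_dist _ (dX cx) (dX cy)))// ler_wpM2l ?sqr_ge0//.
have := kernK_trunc wg og J cx cx; have := kernK_trunc wg og J cx cy.
have := kernK_trunc wg og J cy cy; rewrite !ler_norml.
by move=> /andP[_ ?] /andP[? _] /andP[_ ?]; lra.
Qed.

(** The truncated kernel cannot distinguish [x] from [y], so only the truncation errors survive.
    This gives the bias of the algorithm. *)
Lemma HK_near (f : HK) J x y : cube x -> cube y ->
  (forall j i, (j < J)%N -> i \in us j -> x i = y i) ->
  (rkhs_ev f x - rkhs_ev f y) ^+ 2 <= `|f| ^+ 2 * (4 * tail gamma us J).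
Proof.
move=> cx cy xy; rewrite (le_trans (HK_dist f J cx cy))// ler_wpM2l ?sqr_ge0//.
rewrite (kern_trunc_eq x xy) (kern_truncC _ y x) (kern_trunc_eq y xy); lra.
Qed.

Lemma kern_trunc_lip J x y z h : cube x -> cube y -> cube z ->
  (forall j i, (j < J)%N -> i \in us j -> `|x i - y i| <= h) ->
  `|kern_trunc gamma us J x z - kern_trunc gamma us J y z| <=
    h * \sum_(0 <= j < J) gamma (us j) * 2 * (size (us j))%:R.
Proof.
move=> cx cy cz xy; rewrite /kern_trunc opprD addrACA subrr add0r -sumrB mulr_sumr.
rewrite (le_trans (ler_norm_sum _ _ _))// big_nat [leRHS]big_nat.
apply: ler_sum => j jJ; rewrite -mulrBr normrM ger0_norm//.
have := kseq_lip (us j) cx cy cz; rewrite -mulr_sumr => /le_trans H.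
rewrite -!mulrA mulrCA ler_wpM2l//; apply: H.
by rewrite mulrCA ler_wpM2l// mulrC; apply: sum_le_size => i; exact: xy.
Qed.

Lemma HK_ucont (f : HK) : ucont (rkhs_ev f).
Proof.
move=> e e0; set A := `|f| ^+ 2.
have A0 : 0 <= A by exact: sqr_ge0.
(* Four tails and two kernel increments, each at most [c], make the 6. *)
pose c := e ^+ 2 / (6 * (A + 1)).
have c0 : 0 < c by rewrite divr_gt0 ?exprn_gt0// mulr_gt0// ltr_wpDl.
have [J Jc] := tail_cvg wg og c0.
pose M := \sum_(0 <= j < J) gamma (us j) * 2 * (size (us j))%:R + 1.
have M0 : 0 < M by rewrite ltr_wpDl// sumr_ge0// => j _; rewrite !mulr_ge0.
exists (flatten [seq (us j : seq nat) | j <- iota 0 J]), (c / M).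
split; first by rewrite divr_gt0.
move=> x y cx cy xy; apply: sqr_le_norm; first exact: ltW.
have xy' j i : (j < J)%N -> i \in us j -> `|x i - y i| <= c / M.
  move=> jJ iu; apply: xy; apply/flattenP; exists (us j : seq nat) => //.
  by apply/mapP; exists j => //; rewrite mem_iota.
have Mc : c / M * \sum_(0 <= j < J) gamma (us j) * 2 * (size (us j))%:R <= c.
  by rewrite -mulrA ger_pMr// mulrC ler_pdivrMr// mul1r lerDl.
have h1 := le_trans (kern_trunc_lip cx cy cx xy') Mc.
have h2 := le_trans (kern_trunc_lip cx cy cy xy') Mc.
rewrite (le_trans (HK_dist f J cx cy))//.
apply: (@le_trans _ _ (A * (6 * c))).
  apply: ler_wpM2l => //; move: h1 h2; rewrite (kern_truncC _ y x) !ler_norml.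
  by move=> /andP[_ ?] /andP[? _]; lra.
have A1 : 0 < A + 1 by rewrite ltr_wpDl.
have -> : A * (6 * c) = e ^+ 2 * (A / (A + 1)) by rewrite /c; field; rewrite gt_eqF.
by rewrite ger_pMr ?exprn_gt0// ler_pdivrMr// mul1r lerDl.
Qed.

End HK.

(** Indices without a preimage in [u] go to B + j, above all elements of [u]. Injectivity matters
    because permutations pulled back along [psi] must remain independent. *)
Lemma inverse_ext d (phi : nat -> 'I_d) (u : {fset nat}) :
  {in u &, injective phi} -> exists psi : 'I_d -> nat,
    injective psi /\ forall nu, nu \in u -> psi (phi nu) = nu.
Proof.
move=> phiI; pose P j nu := phi nu == j.
pose B := (\sum_(nu <- (u : seq nat)) nu).+1.
pose psi j := if has (P j) u then nth 0%N u (find (P j) u) else (B + j)%N.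
have psi_in j : has (P j) u -> psi j \in u /\ phi (psi j) = j.
  move=> hj; rewrite /psi hj; split; first by rewrite mem_nth// -has_find.
  by apply/eqP; exact: (nth_find 0%N hj).
have ltB nu : nu \in u -> (nu < B)%N.
  by move=> nuu; rewrite /B ltnS (big_rem nu)//= leq_addr.
exists psi; split=> [j j' jj'|nu nuu]; last first.
  have hnu : has (P (phi nu)) u by apply/hasP; exists nu => //; rewrite /P.
  by have [h1 h2] := psi_in _ hnu; exact: phiI.
have [hj|nj] := boolP (has (P j) u); have [hj'|nj'] := boolP (has (P j') u).
- by have [_ <-] := psi_in _ hj; have [_ <-] := psi_in _ hj'; rewrite jj'.
- have [/ltB + _] := psi_in _ hj; rewrite jj' /psi (negPf nj').
  by rewrite ltnNge leq_addr.
- have [/ltB + _] := psi_in _ hj'; rewrite -jj' /psi (negPf nj).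
  by rewrite ltnNge leq_addr.
- by move: jj'; rewrite /psi (negPf nj) (negPf nj') => /addnI/val_inj.
Qed.

Lemma iid_sub (R : realType) dsp (Omega : measurableType dsp)
    (P : probability Omega R) b (I I' : eqType) (pi : I -> Omega -> {perm 'F_b})
    (f : I' -> I) : injective f ->
  iid_uniform_perms P pi -> iid_uniform_perms P (pi \o f).
Proof.
move=> fI [mpi Ppi Ipi]; split=> [i s|i s|r A ur]; [exact: mpi|exact: Ppi|].
pose B i : set {perm 'F_b} := [set s | forall i', f i' = i -> A i' s].
have := Ipi [seq f i | i <- r] B; rewrite map_inj_uniq// => /(_ ur).
have BA i' : B (f i') = A i'.
  by apply/seteqP; split => [s /(_ i' erefl)//|s As k /fI ->].
rewrite big_map; under eq_bigr do rewrite BA.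
move=> <-; congr (P _); apply/seteqP; split => w /= h i ir.
  by have /mapP[i' i'r ->] := ir; rewrite BA; exact: h.
by have := h (f i); rewrite BA; apply; rewrite mem_map.
Qed.

Section Rule.
Variables (R : realType) (b : nat).
Hypothesis pb : prime b.
Local Notation S := {perm 'F_b}.

(** The index type is abstract so that one definition covers the given rule, over ['I_d], and a
    level of the algorithm, over [nat]. *)
Definition qrule (J : eqType) (dig : nat -> J -> nat -> 'F_b) (n : nat)
    (f : (J -> R) -> R) (s : J * seq 'F_b -> S) : R :=
  \sum_(i < n) rule_weight R b n i * f (spoint R s (dig i)).

Variables (J : eqType) (dig : nat -> J -> nat -> 'F_b).
Implicit Type f : (J -> R) -> R.

Lemma qrule_pcont n f : ucont f -> pcont (qrule dig n f).
Proof. by move=> cf; apply: pcont_sum => i; apply: pcontZ; exact: ucont_pcont. Qed.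

Lemma eq_qrule n f g s : (forall x, cube x -> f x = g x) ->
  qrule dig n f s = qrule dig n g s.
Proof. by move=> fg; apply: eq_bigr => i _; rewrite fg//; exact: cube_spoint. Qed.

Lemma qrule_sum (I : Type) (r : seq I) n (f : I -> (J -> R) -> R) s :
  qrule dig n (fun x => \sum_(i <- r) f i x) s = \sum_(i <- r) qrule dig n (f i) s.
Proof.
rewrite /qrule exchange_big/=; apply: eq_bigr => i _.
by rewrite mulr_sumr.
Qed.

Lemma qruleB n f g s :
  qrule dig n (fun x => f x - g x) s = qrule dig n f s - qrule dig n g s.
Proof. by rewrite /qrule -sumrB; apply: eq_bigr => i _; rewrite mulrBr. Qed.

Lemma qruleZ n c f s : qrule dig n (fun x => c * f x) s = c * qrule dig n f s.
Proof. by rewrite /qrule mulr_sumr; apply: eq_bigr => i _; rewrite mulrCA. Qed.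

Lemma rule_weight_pow M i : (i < b ^ M)%N -> rule_weight R b (b ^ M) i = (b ^ M)%:R^-1.
Proof. by move=> iM; rewrite /rule_weight trunc_expnK ?prime_gt1// iM. Qed.

Lemma qrule_cst M c s : qrule dig (b ^ M) (fun=> c) s = c.
Proof.
rewrite /qrule (eq_bigr (fun=> (b ^ M)%:R^-1 * c)); last first.
  by move=> i _; rewrite rule_weight_pow.
rewrite sumr_const card_ord -mulrnAl -[_^-1 *+ _]mulr_natr mulVf ?mul1r// pnatr_eq0.
by rewrite -lt0n expn_gt0 prime_gt0.
Qed.

Lemma qrule_dist M f g e s : (forall x, cube x -> `|f x - g x| <= e) ->
  `|qrule dig (b ^ M) f s - qrule dig (b ^ M) g s| <= e.
Proof.
move=> fg; rewrite -qruleB -[leRHS](qrule_cst M e s).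
rewrite (le_trans (ler_norm_sum _ _ _))//; apply: ler_sum => i _.
rewrite rule_weight_pow// normrM ger0_norm ?invr_ge0//.
by rewrite ler_wpM2l ?invr_ge0// fg//; exact: cube_spoint.
Qed.

End Rule.

(** * Variance of one component *)

Section Single.
Variables (R : realType) (d b : nat).
Variables (p : nat -> {poly 'F_b}) (q : nat -> 'I_d -> {poly 'F_b}).
Variables (dsp0 : measure_display) (Omega0 : measurableType dsp0).
Variables (P0 : probability Omega0 R) (pi0 : 'I_d * seq 'F_b -> Omega0 -> {perm 'F_b}).
Variable Hd : forall u : {set 'I_d}, rkhs (@cube R 'I_d) (@kprod R d u).
Hypotheses (pb : prime b) (ipi0 : iid_uniform_perms P0 pi0).
Hypothesis vb : variance_bound p q P0 pi0 Hd.
Variable phi : nat -> 'I_d.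
Variables (dsp : measure_display) (Omega : measurableType dsp).
Variables (P : probability Omega R) (pi : nat * seq 'F_b -> Omega -> {perm 'F_b}).
Hypothesis ipi : iid_uniform_perms P pi.

Local Notation digd n := (lattice_digit p q n).
Local Notation dig n := (fun i nu => lattice_digit p q n i (phi nu)).

(** The sum over all possible maxima [z] gives one constant that serves every set u. *)
Definition vconst (tau : R) : R := \sum_(z : 'I_d)
  (\sum_(w : {set 'I_d} | (z \in w) && [forall j in w, (j <= z)%N])
     C_b b (1 / tau) ^+ #|w|) `^ tau.

Lemma vconst_ge0 tau : 0 <= vconst tau.
Proof. by apply: sumr_ge0 => z _; exact: powR_ge0. Qed.

Lemma rule_d_Var M tau (u : {set 'I_d}) (f : Hd u) : (0 < M)%N -> 1 <= tau < 3 ->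
  u != finset.set0 -> Var P0 (fun w => qrule (digd (b ^ M)) (b ^ M) (rkhs_ev f) (pi0^~ w)) <=
  vconst tau * ((b ^ M)%:R - 1) `^ (- tau) * `|f| ^+ 2.
Proof.
move=> M0 tau3 /set0Pn[z0 z0u].
have [z zu zmax] := arg_maxnP (fun j : 'I_d => j : nat) z0u.
have := vb f M0 tau3 zu zmax.
rewrite (varianceEx P0 (pcont_bm ipi0 (qrule_pcont pb (digd (b ^ M)) (b ^ M) (ucont_Hd f)))).
rewrite lee_fin => /le_trans; apply.
rewrite ler_wpM2r ?sqr_ge0// ler_wpM2r ?powR_ge0// /vconst (bigD1 z)//= lerDl.
by apply: sumr_ge0 => z' _; exact: powR_ge0.
Qed.

Lemma kprod_comp (psi : 'I_d -> nat) (u u' : {fset nat}) (x y : nat -> R) :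
  injective psi -> (forall nu, nu \in u -> psi (phi nu) = nu) -> (u' `<=` u)%fset ->
  kprod [set j | psi j \in u']%SET (x \o psi) (y \o psi) = kseq u' x y.
Proof.
move=> psiI psiK /fsubsetP u'u; rewrite /kprod /kseq -big_enum.
rewrite -(big_map psi xpredT (fun nu => kern (x nu) (y nu)))/=.
apply: perm_big; apply: uniq_perm; [by rewrite map_inj_uniq// enum_uniq|exact: fset_uniq|].
move=> nu; apply/mapP/idP => [[j + ->]|nuu']; first by rewrite mem_enum inE.
by exists (phi nu); rewrite ?mem_enum ?inE psiK// u'u.
Qed.

Variables (X : set (nat -> R)) (a : nat -> R).
Hypotheses (Xcube : X `<=` @cube R nat) (ca : cube a).
Implicit Type s : seq (R * {y | X y}).

(** The squared norm in H_u of the combination of the sections k_u(., y). *)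
Definition gram (u : {fset nat}) s : R := \sum_(c <- s) \sum_(c' <- s)
  c.1 * c'.1 * kseq u (sval c.2) (sval c'.2).

Let cs (c : {y | X y}) : cube (sval c). Proof. by apply: Xcube; case: c. Qed.

Lemma cube_comp (psi : 'I_d -> nat) (y : nat -> R) : cube y -> cube (y \o psi).
Proof. by move=> cy j; exact: cy. Qed.

(** Transported to ['I_d], the Gram sum is a squared norm in the space [Hd] of the image of [u]
    under [phi]. *)
Lemma gram_ge0 u s : {in u &, injective phi} -> 0 <= gram u s.
Proof.
move=> phiI; have [psi [psiI psiK]] := inverse_ext phiI.
pose ud := [set j | psi j \in u]%SET.
pose t := [seq (c.1, exist (@cube R 'I_d) _ (cube_comp psi (cs c.2))) | c <- s].
suff -> : gram u s = `|comb (Hd ud) t| ^+ 2 by exact: sqr_ge0.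
rewrite norm_comb /t big_map; apply: eq_bigr => c _; rewrite big_map.
by apply: eq_bigr => c' _ /=; rewrite (kprod_comp _ _ psiI psiK).
Qed.

Lemma kseq_anchored u v (x y : nat -> R) :
  kseq u (anchored a v x) y = kseq (u `&` v)%fset x y * kseq (u `\` v)%fset a y.
Proof.
rewrite /kseq (bigID (mem v))/=; congr (_ * _); rewrite -big_filter.
  rewrite (perm_big (u `&` v)%fset)/=; last first.
    apply: uniq_perm; [by rewrite filter_uniq// fset_uniq|exact: fset_uniq|].
    by move=> j; rewrite mem_filter !inE andbC.
  rewrite big_seq [RHS]big_seq; apply: eq_bigr => j; rewrite !inE => /andP[_ jv].
  by rewrite /anchored jv.
rewrite (perm_big (u `\` v)%fset)/=; last first.
  apply: uniq_perm; [by rewrite filter_uniq// fset_uniq|exact: fset_uniq|].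
  by move=> j; rewrite mem_filter !inE.
rewrite big_seq [RHS]big_seq; apply: eq_bigr => j; rewrite !inE => /andP[jv _].
by rewrite /anchored (negPf jv).
Qed.

Lemma kseq_anch_in (w v : {fset nat}) (x y : nat -> R) : {subset w <= v} ->
  kseq w x (anchored a v y) = kseq w x y.
Proof.
move=> wv; rewrite /kseq big_seq [RHS]big_seq; apply: eq_bigr => j /wv jv.
by rewrite /anchored jv.
Qed.

Lemma kseq_anch_out (w v : {fset nat}) (x y : nat -> R) :
  (forall j, j \in w -> j \notin v) -> kseq w x (anchored a v y) = kseq w x a.
Proof.
move=> wv; rewrite /kseq big_seq [RHS]big_seq; apply: eq_bigr => j /wv jv.
by rewrite /anchored (negPf jv).
Qed.

(* Restricting the variables outside [v] to [a] does not increase the norm: by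
   Cauchy-Schwarz against the combination of the restricted kernel sections. *)
Lemma gram_anchored u v s : {in u &, injective phi} ->
  \sum_(c <- s) \sum_(c' <- s) c.1 * kseq (u `\` v)%fset a (sval c.2) *
    (c'.1 * kseq (u `\` v)%fset a (sval c'.2)) *
    kseq (u `&` v)%fset (sval c.2) (sval c'.2) <= gram u s.
Proof.
pose kappa (c : {y | X y}) := kseq (u `\` v)%fset a (sval c).
move=> phiI; have [psi [psiI psiK]] := inverse_ext phiI.
set A := (X in X <= _).
pose ud := [set j | psi j \in u]%SET; pose wd := [set j | psi j \in (u `&` v)%fset]%SET.
pose pt (y : nat -> R) (cy : cube y) := exist (@cube R 'I_d) _ (cube_comp psi cy).
pose t1 := [seq (c.1, pt _ (cs c.2)) | c <- s].
pose t2 := [seq (c.1 * kappa c.2, pt _ (cube_anchored (u `&` v)%fset ca (cs c.2))) | c <- s].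
pose t3 := [seq (c.1 * kappa c.2, pt _ (cs c.2)) | c <- s].
pose theta := kseq (u `\` v)%fset a a.
have uvE : (u `\` (u `&` v) = u `\` v)%fset by apply/fsetP => j; rewrite !inE; case: (j \in u); case: (j \in v).
have uuv : (u `&` (u `&` v) = u `&` v)%fset by rewrite fsetIA fsetIid.
have A3 : A = `|comb (Hd wd) t3| ^+ 2.
  rewrite norm_comb /t3 big_map; apply: eq_bigr => c _; rewrite big_map.
  by apply: eq_bigr => c' _ /=; rewrite (kprod_comp _ _ psiI psiK)// fsubsetIl.
have A0 : 0 <= A by rewrite A3 sqr_ge0.
have G1 : gram u s = `|comb (Hd ud) t1| ^+ 2.
  rewrite norm_comb /t1 big_map; apply: eq_bigr => c _; rewrite big_map.
  by apply: eq_bigr => c' _ /=; rewrite (kprod_comp _ _ psiI psiK).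
have G2 : `|comb (Hd ud) t2| ^+ 2 = theta * A.
  rewrite norm_comb /t2 big_map mulr_sumr; apply: eq_bigr => c _.
  rewrite big_map mulr_sumr; apply: eq_bigr => c' _ /=.
  rewrite (kprod_comp _ _ psiI psiK)// kseq_anchored uvE uuv.
  rewrite kseq_anch_in// kseq_anch_out; last first.
    by move=> j; rewrite !inE => /andP[/negPf-> _]; rewrite andbF.
  by rewrite -/theta -/(kappa c.2) -/(kappa c'.2); ring.
have G12 : rkhs_dot (comb (Hd ud) t1) (comb (Hd ud) t2) = A.
  rewrite dot_comb /t2 big_map /A; apply: eq_bigr => c _ /=.
  rewrite ev_comb; last exact/cube_comp/cube_anchored.
  rewrite /t1 big_map mulr_sumr; apply: eq_bigr => c' _ /=.
  rewrite (kprod_comp _ _ psiI psiK)// kseq_anchored uvE uuv -/(kappa c'.2).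
  by rewrite -/(kappa c.2); ring.
(* This reads A^2 <= [gram u s] * theta * A; the kernel is at most 1, hence so is [theta], and one
   factor A cancels. *)
have := rkhs_CS (comb (Hd ud) t1) (comb (Hd ud) t2); rewrite G12 -G1 G2 => CS.
have th1 : theta <= 1 by rewrite (le_trans (ler_norm _))// kseq_bound.
have g0 := gram_ge0 s phiI.
have [->//|An] := eqVneq A 0.
have Ap : 0 < A by rewrite lt_def An.
rewrite -(ler_pM2r Ap) -expr2 (le_trans CS)// ler_wpM2l//.
by rewrite ler_piMl.
Qed.

(** After anchoring, the function depends on u and v only through the variables in their
    intersection. If that is empty the rule is exact on a constant; otherwise [psi] turns the
    function into an element of some [Hd wd], to which the given bound applies. *)
Lemma single_Var u v s tau M : {in u &, injective phi} -> (0 < M)%N -> 1 <= tau < 3 ->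
  Var P (fun w => qrule (dig (b ^ M)) (b ^ M)
    (fun x => \sum_(c <- s) c.1 * kseq u (anchored a v x) (sval c.2)) (pi^~ w)) <=
  vconst tau * ((b ^ M)%:R - 1) `^ (- tau) * gram u s.
Proof.
move=> phiI M0 tau3; have gs0 := gram_ge0 s phiI.
have [uv0|uv0] := eqVneq (u `&` v)%fset fset0.
  have -> : (fun x => \sum_(c <- s) c.1 * kseq u (anchored a v x) (sval c.2)) =
      fun=> \sum_(c <- s) c.1 * kseq u a (sval c.2).
    apply/funext => x; apply: eq_bigr => c _; rewrite kseq_anchored uv0.
    have -> : (u `\` v)%fset = u.
      apply/fsetP => j; rewrite !inE; have /fsetP/(_ j) := uv0; rewrite !inE.
      by case: (j \in u); case: (j \in v).
    by rewrite /kseq big_seq_fset0 mul1r.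
  under [in Var _ _]eq_fun do rewrite qrule_cst//.
  by rewrite Var_cst mulr_ge0// mulr_ge0 ?vconst_ge0// powR_ge0.
have [psi [psiI psiK]] := inverse_ext phiI.
pose wd := [set j | psi j \in (u `&` v)%fset]%SET.
pose t := [seq (c.1 * kseq (u `\` v)%fset a (sval c.2),
  exist (@cube R 'I_d) _ (cube_comp psi (cs c.2))) | c <- s].
pose pi' := pi \o (fun js : 'I_d * seq 'F_b => (psi js.1, js.2)).
have ipi' : iid_uniform_perms P pi'.
  by apply: iid_sub ipi => -[j z] [j' z'] /= [/psiI -> ->].
have cG := ucont_Hd (comb (Hd wd) t).
have -> : (fun w => qrule (dig (b ^ M)) (b ^ M)
    (fun x => \sum_(c <- s) c.1 * kseq u (anchored a v x) (sval c.2)) (pi^~ w)) =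
    (fun w => qrule (digd (b ^ M)) (b ^ M) (rkhs_ev (comb (Hd wd) t)) (pi'^~ w)).
  apply/funext => w; apply: eq_bigr => i _; congr (_ * _).
  rewrite ev_comb; last exact: cube_spoint.
  rewrite /t big_map; apply: eq_bigr => c _ /=.
  rewrite kseq_anchored -mulrA; congr (_ * _); rewrite mulrC; congr (_ * _).
  rewrite -(kprod_comp _ _ psiI psiK); last exact: fsubsetIl.
  apply: eq_bigr => j; rewrite inE inE => /andP[ju jv]; congr (kern _ _).
  (* Variable [psi j] uses the lattice coordinate [phi (psi j)], so the transported rule has the
     digits of the given one. *)
  have phj : phi (psi j) = j by exact/psiI/psiK.
  by rewrite /spoint /= phj.
rewrite (pcont_Var ipi' ipi0 (qrule_pcont pb _ _ cG)).
apply: le_trans (rule_d_Var _ M0 tau3 _) _.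
  have [nu nuuv] : exists nu, nu \in (u `&` v)%fset by apply/fset0Pn.
  apply/set0Pn; exists (phi nu); rewrite inE psiK//.
  by move: nuuv; rewrite inE => /andP[].
rewrite ler_wpM2l ?mulr_ge0 ?vconst_ge0 ?powR_ge0//.
apply: le_trans (gram_anchored v s phiI); rewrite norm_comb /t big_map.
rewrite le_eqVlt; apply/orP; left; apply/eqP; apply: eq_bigr => c _.
by rewrite big_map; apply: eq_bigr => c' _ /=; rewrite (kprod_comp _ _ psiI psiK)// fsubsetIl.
Qed.

End Single.

(** * Variance of a function in H(K) at one level *)

Section Level.
Variables (R : realType) (d b : nat).
Variables (p : nat -> {poly 'F_b}) (q : nat -> 'I_d -> {poly 'F_b}).
Variables (dsp0 : measure_display) (Omega0 : measurableType dsp0).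
Variables (P0 : probability Omega0 R) (pi0 : 'I_d * seq 'F_b -> Omega0 -> {perm 'F_b}).
Variable Hd : forall u : {set 'I_d}, rkhs (@cube R 'I_d) (@kprod R d u).
Hypotheses (pb : prime b) (ipi0 : iid_uniform_perms P0 pi0).
Hypothesis vb : variance_bound p q P0 pi0 Hd.
Variables (gamma : weights R) (us : nat -> {fset nat}).
Hypotheses (wg : is_weights gamma) (og : ordering gamma us).
Variable HK : rkhs (domX gamma) (kernK gamma).
Variable phi : nat -> 'I_d.
Hypothesis phiI : forall u, 0 < gamma u -> {in u &, injective phi}.
Variables (dsp : measure_display) (Omega : measurableType dsp).
Variables (P : probability Omega R) (pi : nat * seq 'F_b -> Omega -> {perm 'F_b}).
Hypothesis ipi : iid_uniform_perms P pi.
Variable a : nat -> R.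
Hypothesis ca : cube a.

Local Notation dig n := (fun i nu => lattice_digit p q n i (phi nu)).
Implicit Type s : seq (R * {y | domX gamma y}).

Let g0 u : 0 <= gamma u. Proof. by case: wg. Qed.
Let dX x : cube x -> domX gamma x. Proof. by rewrite (domX_cube wg). Qed.
Let Xc : domX gamma `<=` @cube R nat. Proof. by move=> x []. Qed.
Let usI j : {in us j &, injective phi}. Proof. exact/phiI/(us_gt0 og). Qed.

Definition comb_trunc J s x : R := \sum_(c <- s) c.1 * kern_trunc gamma us J x (sval c.2).

Let F s v j (x : nat -> R) : R :=
  gamma (us j) * \sum_(c <- s) c.1 * kseq (us j) (anchored a v x) (sval c.2).

(** Sets with index below [L] lie in both [v'] and [v], so neither anchoring affects their terms.
    This cancellation is the source of the factor [tail L] in the variance. *)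
Lemma comb_trunc_diff L J s (v v' : {fset nat}) x : (L <= J)%N -> (v' `<=` v)%fset ->
  (forall j, (j < L)%N -> (us j `<=` v')%fset) ->
  comb_trunc J s (anchored a v x) - comb_trunc J s (anchored a v' x) =
  \sum_(L <= j < J) (F s v j x - F s v' j x).
Proof.
move=> LJ vv' uv'.
have E w : comb_trunc J s (anchored a w x) = \sum_(c <- s) c.1 + \sum_(0 <= j < J) F s w j x.
  rewrite /comb_trunc /F; under eq_bigr do rewrite /kern_trunc mulrDr mulr1 mulr_sumr.
  rewrite big_split/= exchange_big/=; congr (_ + _); apply: eq_bigr => j _.
  by rewrite mulr_sumr; apply: eq_bigr => c _; rewrite mulrCA.
rewrite !E opprD addrACA subrr add0r -sumrB (@big_cat_nat _ _ _ L)//=.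
rewrite [X in X + _]big_nat [X in X + _]big1 ?add0r// => j jL.
apply/eqP; rewrite subr_eq0; apply/eqP; congr (_ * _); apply: eq_bigr => c _.
congr (_ * _).
have h (w : {fset nat}) : (us j `<=` w)%fset ->
    kseq (us j) (anchored a w x) (sval c.2) = kseq (us j) x (sval c.2).
  by move=> /fsubsetP juw; rewrite kseqC kseq_anch_in// kseqC.
by rewrite !h ?uv'//; exact: fsubset_trans (uv' j jL) vv'.
Qed.

Let F_ucont s v j : ucont (F s v j).
Proof.
apply/ucontZ/ucont_sum => c; apply: ucontZ.
apply: (@ucont_anchored R a v (fun x => kseq (us j) x (sval c.2))) => //.
by apply/ucont_kseq/Xc; case: c.2.
Qed.

Let B (tau : R) M := vconst d b tau * ((b ^ M)%:R - 1) `^ (- tau).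

(** Cauchy-Schwarz with weights gamma_u: the weights sum to at most the tail, and a variance of
    order gamma_u^2 divided by gamma_u leaves gamma_u times [gram]. The 4 is 2 + 2 from [VarB], one
    2 for each anchoring. *)
Lemma comb_trunc_Var L J s v v' M tau : (L <= J)%N -> (v' `<=` v)%fset ->
  (forall j, (j < L)%N -> (us j `<=` v')%fset) -> (0 < M)%N -> 1 <= tau < 3 ->
  Var P (fun w => qrule (dig (b ^ M)) (b ^ M)
    (fun x => comb_trunc J s (anchored a v x) - comb_trunc J s (anchored a v' x)) (pi^~ w)) <=
  tail gamma us L * (4 * B tau M * \sum_(L <= j < J) gamma (us j) * gram (us j) s).
Proof.
move=> LJ vv' uv' M0 tau3; pose n := (b ^ M)%N.
have bF v0 j : bounded_mfun (fun w => qrule (dig n) n (F s v0 j) (pi^~ w)).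
  exact: (pcont_bm ipi (qrule_pcont pb _ n (F_ucont s v0 j))).
have B0 : 0 <= B tau M by rewrite mulr_ge0 ?vconst_ge0 ?powR_ge0.
have -> : (fun w => qrule (dig (b ^ M)) (b ^ M)
    (fun x => comb_trunc J s (anchored a v x) - comb_trunc J s (anchored a v' x)) (pi^~ w)) =
    (fun w => \sum_(L <= j < J) (qrule (dig n) n (F s v j) (pi^~ w) -
       qrule (dig n) n (F s v' j) (pi^~ w))).
  apply/funext => w; under eq_bigr do rewrite -qruleB.
  by rewrite -qrule_sum; apply: (eq_qrule pb) => x cx; rewrite (comb_trunc_diff _ _ LJ vv' uv').
apply: (le_trans (@Var_sum _ _ _ P _ (index_iota L J) _ (fun j => gamma (us j)) _ _)).
- by move=> j; exact: bmB.
- by move=> j; exact: (us_gt0 og).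
have VF v0 j : Var P (fun w => qrule (dig n) n (F s v0 j) (pi^~ w)) <=
    gamma (us j) ^+ 2 * (B tau M * gram (us j) s).
  have -> : (fun w => qrule (dig n) n (F s v0 j) (pi^~ w)) =
     (fun w => gamma (us j) * qrule (dig n) n (fun x => \sum_(c <- s) c.1 *
        kseq (us j) (anchored a v0 x) (sval c.2)) (pi^~ w)).
    by apply/funext => w; rewrite -qruleZ.
  rewrite VarZ; last first.
    apply: (pcont_bm ipi (qrule_pcont pb _ n _)); apply: ucont_sum => c.
    apply: ucontZ.
    apply: (@ucont_anchored R a v0 (fun x => kseq (us j) x (sval c.2))) => //.
    by apply/ucont_kseq/Xc; case: c.2.
  rewrite ler_wpM2l ?sqr_ge0//.
  exact: (single_Var pb ipi0 vb ipi Xc ca v0 s (@usI j) M0 tau3).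
apply: ler_pM => //.
- by apply: sumr_ge0.
- by apply: sumr_ge0 => j _; rewrite mulr_ge0 ?Var_ge0// invr_ge0.
- exact: sum_le_tail.
rewrite mulr_sumr; apply: ler_sum => j _; rewrite ler_pdivrMr ?(us_gt0 og)//.
apply: (le_trans (VarB P (bF _ _) (bF _ _))).
have := VF v j; have := VF v' j; rewrite expr2.
set x := Var _ _; set y := Var _ _; set g := gamma _; set G := gram _ _ => h1 h2.
have -> : 4 * B tau M * (g * G) * g = 4 * (g * g * (B tau M * G)) by ring.
lra.
Qed.

(** The two sides differ by the contribution of the empty set, the square of the sum of the
    coefficients. *)
Lemma sum_gram J s : \sum_(0 <= j < J) gamma (us j) * gram (us j) s <=
  \sum_(c <- s) \sum_(c' <- s) c.1 * c'.1 * kern_trunc gamma us J (sval c.2) (sval c'.2).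
Proof.
have -> : \sum_(c <- s) \sum_(c' <- s) c.1 * c'.1 * kern_trunc gamma us J (sval c.2) (sval c'.2) =
    (\sum_(c <- s) c.1) ^+ 2 + \sum_(0 <= j < J) gamma (us j) * gram (us j) s.
  rewrite expr2 mulr_suml /gram.
  under [X in _ = _ + X]eq_bigr do rewrite mulr_sumr.
  rewrite [X in _ = _ + X]exchange_big/= -big_split/=; apply: eq_bigr => c _.
  under [X in _ = _ + X]eq_bigr do rewrite mulr_sumr.
  rewrite [X in _ = _ + X]exchange_big/= mulr_sumr -big_split/=; apply: eq_bigr => c' _.
  rewrite /kern_trunc mulrDr mulr1 mulr_sumr; congr (_ + _).
  by apply: eq_bigr => j _; rewrite mulrCA.
by rewrite lerDr sqr_ge0.
Qed.

(** The constant is 40 = 2 * 4 * 5. The 2 comes from [Var_approx], the 4 from [comb_trunc_Var], and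
    5 = 2^2 + 1 bounds the Gram sums: the approximating combination has norm at most 2, and
    truncating the kernel changes its squared norm by at most 1. *)
Lemma level_Var (f : HK) L v v' M tau : `|f| <= 1 -> (v' `<=` v)%fset ->
  (forall j, (j < L)%N -> (us j `<=` v')%fset) -> (0 < M)%N -> 1 <= tau < 3 ->
  Var P (fun w => qrule (dig (b ^ M)) (b ^ M)
    (fun x => rkhs_ev f (anchored a v x) - rkhs_ev f (anchored a v' x)) (pi^~ w)) <=
  40 * B tau M * tail gamma us L.
Proof.
move=> f1 vv' uv' M0 tau3; pose n := (b ^ M)%N.
have B0 : 0 <= B tau M by rewrite mulr_ge0 ?vconst_ge0 ?powR_ge0.
apply/ler_addgt0Pr => e e0.
pose kap := 1 + 2 * tail gamma us 0.
have kap1 : 1 <= kap by rewrite lerDl mulr_ge0 ?(tail_ge0 wg og).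
(* The approximation term of [Var_approx] will be 2 * (4 h (kap + 1))^2 = h^2 * [Dn], which is at
   most [e] as h <= 1 and h * [Dn] <= e. *)
pose Dn := 32 * (kap + 1) ^+ 2.
have Dn0 : 0 < Dn by rewrite mulr_gt0// exprn_gt0//; lra.
pose h := Num.min 1 (e / Dn).
have h0 : 0 < h by rewrite lt_min ltr01 divr_gt0.
have h1 : h <= 1 by rewrite ge_min lexx.
have he : h * Dn <= e by rewrite -ler_pdivlMr// ge_min lexx orbT.
have [s fs] := comb_dense f h0.
(* [W] dominates the coefficients both in an evaluation and in the squared norm, so one choice of
   [J] controls the truncation in both. *)
pose W := \sum_(c <- s) `|c.1| + \sum_(c <- s) \sum_(c' <- s) `|c.1 * c'.1| + 1.
have W1 : 0 <= \sum_(c <- s) `|c.1| by exact: sumr_ge0.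
have W2 : 0 <= \sum_(c <- s) \sum_(c' <- s) `|c.1 * c'.1|.
  by apply: sumr_ge0 => c _; exact: sumr_ge0.
have W0 : 0 < W by rewrite /W; lra.
have [J0 J0h] := tail_cvg wg og (divr_gt0 h0 W0).
pose J := maxn J0 L; have LJ : (L <= J)%N by exact: leq_maxr.
have tJ : tail gamma us J * W <= h.
  rewrite -ler_pdivlMr// ltW// (le_lt_trans _ J0h)// (le_tail wg og)// leq_maxl//.
have t0 := tail_ge0 wg og J.
have cc (c : R * {y | domX gamma y}) : cube (sval c.2) by apply: Xc; case: c.2.
have near1 x : cube x -> `|rkhs_ev f x - comb_trunc J s x| <= h * kap + h.
  move=> cx; rewrite -(subrKA (rkhs_ev (comb HK s) x)) (le_trans (ler_normD _ _))// lerD//.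
    rewrite -revB; last exact: dX.
    apply: sqr_le_norm; first by rewrite mulr_ge0// ?ltW//; lra.
    rewrite (le_trans (rev_bound _ (dX cx)))// exprMn ler_pM ?sqr_ge0//.
    - by rewrite -(norm_ksec HK (dX cx)) sqr_ge0.
    - by rewrite ler_sqr ?nnegrE ?normr_ge0 ?(ltW h0)// ltW.
    rewrite (le_trans (ler_norm _))// (le_trans (kernK_bound wg og cx cx))//.
    by rewrite -/kap expr2 ler_peMr//; lra.
  rewrite ev_comb; last exact: dX.
  rewrite /comb_trunc -sumrB (le_trans (ler_norm_sum _ _ _))//.
  apply: le_trans tJ; apply: (@le_trans _ _ (tail gamma us J * \sum_(c <- s) `|c.1|)).
    rewrite mulr_sumr; apply: ler_sum => c _.
    by rewrite -mulrBr normrM mulrC ler_wpM2r// (kernK_trunc wg og).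
  by rewrite ler_wpM2l// /W; lra.
have cfJ : ucont (comb_trunc J s).
  apply: ucont_sum => c; apply: ucontZ; apply: ucontD.
    by move=> e' e'0; exists [::], 1; split=> // x y _ _ _; rewrite subrr normr0 ltW.
  by apply: ucont_sum => j; apply: ucontZ; exact: ucont_kseq.
have bX (g : (nat -> R) -> R) : ucont g -> bounded_mfun (fun w => qrule (dig n) n
    (fun x => g (anchored a v x) - g (anchored a v' x)) (pi^~ w)).
  move=> cg; apply: (pcont_bm ipi (qrule_pcont pb _ n _)).
  by apply: ucontB; exact: ucont_anchored.
have := @Var_approx _ _ _ P _ _ (2 * (h * kap + h)) (bX _ (HK_ucont wg og f)) (bX _ cfJ).
move=> /(_ _)/le_trans; apply.
  move=> w; apply: (qrule_dist pb) => x cx.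
  have := near1 _ (cube_anchored v ca cx); have := near1 _ (cube_anchored v' ca cx).
  by rewrite !ler_norml => /andP[? ?] /andP[? ?]; apply/andP; split; lra.
have G5 : \sum_(L <= j < J) gamma (us j) * gram (us j) s <= 5.
  apply: (@le_trans _ _ (\sum_(0 <= j < J) gamma (us j) * gram (us j) s)).
    rewrite [leRHS](@big_cat_nat _ _ _ L)//= lerDr sumr_ge0// => j _.
    by rewrite mulr_ge0//; exact: (gram_ge0 Hd Xc s (@usI j)).
  rewrite (le_trans (sum_gram J s))//.
  have : \sum_(c <- s) \sum_(c' <- s) c.1 * c'.1 * kern_trunc gamma us J (sval c.2) (sval c'.2) <=
      `|comb HK s| ^+ 2 + tail gamma us J * \sum_(c <- s) \sum_(c' <- s) `|c.1 * c'.1|.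
    rewrite norm_comb mulr_sumr -big_split/=; apply: ler_sum => c _.
    rewrite mulr_sumr -big_split/=; apply: ler_sum => c' _.
    rewrite -lerBlDl -mulrBr (le_trans (ler_norm _))// normrM mulrC ler_wpM2r//.
    by rewrite distrC (kernK_trunc wg og).
  move=> /le_trans; apply.
  have : tail gamma us J * \sum_(c <- s) \sum_(c' <- s) `|c.1 * c'.1| <= 1.
    apply: le_trans (le_trans tJ h1); rewrite ler_wpM2l// /W; lra.
  have : `|comb HK s| ^+ 2 <= 2 ^+ 2.
    rewrite ler_sqr ?nnegrE//; have := ler_distD f 0 (comb HK s).
    by rewrite !sub0r !normrN; lra.
  by rewrite expr2; lra.
have := comb_trunc_Var s LJ vv' uv' M0 tau3; set V := Var _ _ => HV.
have T0 := tail_ge0 wg og L.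
have {}HV : V <= 20 * B tau M * tail gamma us L.
  rewrite (le_trans HV)// mulrC; apply: ler_wpM2r => //.
  have : 0 <= B tau M * (5 - \sum_(L <= j < J) gamma (us j) * gram (us j) s).
    by rewrite mulr_ge0// subr_ge0.
  rewrite mulrBr; set u := \sum_(_ <= _ < _) _; move: (B tau M * u) (B tau M) => x y; lra.
have hk : 2 * (2 * (2 * (h * kap + h))) ^+ 2 <= e.
  have -> : 2 * (2 * (2 * (h * kap + h))) ^+ 2 = h * (h * Dn) by rewrite /Dn; ring.
  apply: le_trans he; rewrite ler_piMl//; rewrite mulr_ge0// ltW//.
lra.
Qed.

End Level.

(** * Cost *)

Section Sets.
Variables (R : realType) (gamma : weights R) (us : nat -> {fset nat}).
Variables (omega eta : nat).
Hypotheses (og : ordering gamma us) (fo : finite_order gamma omega).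
Hypothesis he : forall i : nat, ([set u | 0 < gamma u /\ i \in u] #<= `I_eta)%card.

Definition us_union J : {fset nat} := \big[fsetU/fset0]_(j < J) us j.

Lemma us_unionS J : us_union J.+1 = (us_union J `|` us J)%fset.
Proof. by rewrite /us_union big_ord_recr. Qed.

Lemma us_sub_union J j : (j < J)%N -> (us j `<=` us_union J)%fset.
Proof.
elim: J => [//|J IH]; rewrite ltnS leq_eqVlt us_unionS => /predU1P[->|/IH h].
  exact: fsubsetUr.
exact: fsubset_trans h (fsubsetUl _ _).
Qed.

Lemma us_union_mono I J : (I <= J)%N -> (us_union I `<=` us_union J)%fset.
Proof.
move/subnKC <-; elim: (J - I)%N => [|n IH]; first by rewrite addn0.
by rewrite addnS us_unionS; exact: fsubset_trans IH (fsubsetUl _ _).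
Qed.

Lemma us_card j : (#|` us j| <= omega)%N.
Proof.
rewrite leqNgt; apply/negP => /fo g0.
by have := us_gt0 og j; rewrite g0 ltxx.
Qed.

Lemma us_union_card J : (#|` us_union J| <= omega * J)%N.
Proof.
elim: J => [|J IH]; first by rewrite /us_union big_ord0 cardfs0.
rewrite us_unionS cardfsU mulnS addnC; apply: leq_trans (leq_subr _ _) _.
by apply: leq_add => //; exact: us_card.
Qed.

Lemma us_degree i J : (\sum_(j < J) (i \in us j) <= eta)%N.
Proof.
pose s := [seq us j | j <- iota 0 J & i \in us j].
have us_inj : injective us by case: og.
have -> : (\sum_(j < J) (i \in us j) = size s)%N.
  rewrite size_map size_filter -sum1_count -(big_mkord xpredT (fun j => nat_of_bool (i \in us j))).
  by rewrite /index_iota subn0 [RHS]big_mkcond; apply: eq_bigr => j _; case: (_ \in _).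
have sP k : (k < size s)%N -> [set u | 0 < gamma u /\ i \in u] (nth fset0 s k).
  move=> ks; have /mapP[j + ->] := mem_nth fset0 ks.
  by rewrite mem_filter => /andP[ij _]; split=> //; exact: us_gt0 og j.
have us_uniq : uniq s by rewrite map_inj_uniq// filter_uniq// iota_uniq.
rewrite -card_le_II; apply: card_le_trans (he i).
apply: (@card_le_trans _ _ _ (nth fset0 s @` `I_(size s))).
  have e : (nth fset0 s @` `I_(size s) #= `I_(size s))%card.
    apply: inj_card_eq => k l; rewrite !inE /= => ks ls /eqP.
    by rewrite nth_uniq// => /eqP.
  by rewrite (card_le_eqr e).
by apply: subset_card_le => _ [k /= ks <-]; exact: sP.
Qed.

(** Double counting: otherwise each of the first K = (eta * omega + 1) J sets meets the union of the
    first J. That union has at most omega * J elements, each in at most eta sets, so K <= eta *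
    omega * J, a contradiction. *)
Lemma us_union_proper J : (0 < J)%N -> (us_union J `<` us_union ((eta * omega).+1 * J))%fset.
Proof.
move=> J0; set K := ((eta * omega).+1 * J)%N.
have JK : (J <= K)%N by rewrite leq_pmull.
rewrite fproperE us_union_mono//=; apply/negP => KJ.
have : (K <= \sum_(j < K) \sum_(i <- (us_union J : seq nat)) (i \in us j))%N.
  rewrite -[leqLHS]card_ord -sum1_card; apply: leq_sum => j _.
  have /fset0Pn[i ij] := us_neq0 og j.
  have iJ : i \in us_union J.
    by apply/(fsubsetP KJ)/(fsubsetP (us_sub_union (ltn_ord j))).
  by rewrite (big_rem i)//= ij.
rewrite exchange_big/= => h.
have : (\sum_(i <- (us_union J : seq nat)) \sum_(j < K) (i \in us j) <= #|` us_union J| * eta)%N.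
  rewrite -sum1_size big_distrl/=; apply: leq_sum => i _; rewrite mul1n.
  exact: us_degree.
have := us_union_card J; move: h; rewrite /K; set S := \sum_(_ <- _) _; nia.
Qed.

End Sets.

(** The integral of a nonnegative function is a supremum over simple functions below it, hence
    monotone for arbitrary functions such as the random cost. *)
Lemma ge0_le_integral_nomeas (R : realType) d (T : measurableType d)
    (P : probability T R) (f : T -> \bar R) (c : R) :
  (forall w, (0 <= f w)%E) -> (forall w, (f w <= c%:E)%E) -> (\int[P]_w f w <= c%:E)%E.
Proof.
move=> f0 fc; rewrite -[leRHS](mule1) -(@probability_setT _ _ _ P) -integral_cst//.
have c0 w : (0 <= (cst c%:E : T -> \bar R) w)%E by exact: le_trans (f0 w) (fc w).
rewrite !ge0_integralTE//; apply: ereal_sup_le => _ [h hf <-]; exists h => // x.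
exact: le_trans (hf x) (fc x).
Qed.

Section Cost.
Variables (R : realType) (b d : nat).
Variables (p : nat -> {poly 'F_b}) (q : nat -> 'I_d -> {poly 'F_b}).
Variables (phi : nat -> 'I_d) (us : nat -> {fset nat}) (a : nat -> R).
Variables (m : nat) (L n : nat -> nat).
Variables (dsp : measure_display) (Omega : measurableType dsp) (P : probability Omega R).
Variable pi : (nat * nat) * seq 'F_b -> Omega -> {perm 'F_b}.
Variables (cost : nat -> R) (v : nat -> {fset nat}).
Hypothesis cost0 : forall nu, 0 <= cost nu.

Lemma ml_setE k : (0 < k)%N -> ml_set us L k = us_union us (L k).
Proof. by case: k. Qed.

Lemma point_cost_ge0 x : (0 <= point_cost cost v a x)%E.
Proof. by apply: le_ereal_inf_tmp => _ [i _ <-]; rewrite lee_fin. Qed.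

Lemma point_cost_le i x : (forall j, j \notin v i -> x j = a j) ->
  (point_cost cost v a x <= (cost #|` v i|)%:E)%E.
Proof. by move=> h; apply: ereal_inf_lbound; exists i. Qed.

Hypothesis vml : forall k, (0 < k <= m)%N -> exists i, v i = ml_set us L k.

(** A level evaluates f at each node and, except at the first level, also at the node anchored
    outside the previous set. Both points equal the anchor outside the current set, whence the
    factor 2. *)
Lemma ml_nodes_cost w :
  (\sum_(x <- ml_nodes p q phi us a m L n pi w) point_cost cost v a x <=
   (\sum_(1 <= k < m.+1) 2 * (n k)%:R * cost #|` ml_set us L k|)%:E)%E.
Proof.
rewrite /ml_nodes big_flatten big_map /index_iota subSS subn0.
rewrite -sumEFin big_seq [leRHS]big_seq; apply: lee_sum => k.
rewrite mem_iota add1n ltnS => km; have [i vi] := vml km.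
rewrite big_flatten big_map.
apply: (@le_trans _ _ (\sum_(j <- iota 0 (n k)) (2 * cost #|` v i|)%:E)%E).
  apply: lee_sum => j _; rewrite big_cons mulr_natl mulr2n EFinD; apply: leeD.
    by apply: point_cost_le => nu; rewrite vi /ml_point /anchored => /negPf ->.
  case: ifP => _; first by rewrite big_nil lee_fin.
  rewrite big_seq1; apply: point_cost_le => nu; rewrite vi /ml_point /anchored => /negPf ->.
  by case: ifP.
rewrite sumEFin lee_fin big_const_seq count_predT size_iota iter_addr_0 vi.
by rewrite -mulr_natl le_eqVlt; apply/orP; left; apply/eqP; ring.
Qed.

Lemma cost_var_le (X : set (nat -> R)) (Bl : set ((nat -> R) -> R)) :
  (forall i, v i != fset0) -> (forall i, (v i `<` v i.+1)%fset) -> X a ->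
  (cost_var P cost X Bl (fun _ => ml_nodes p q phi us a m L n pi) <=
   (\sum_(1 <= k < m.+1) 2 * (n k)%:R * cost #|` ml_set us L k|)%:E)%E.
Proof.
move=> v0 vS Xa.
apply: (@le_trans _ _ (ereal_sup [set (\int[P]_w \sum_(x <- ml_nodes p q phi us a m L n pi w)
    point_cost cost v a x)%E | f in Bl])).
  by apply: ereal_inf_lbound; exists v, a; split.
apply: ge_ereal_sup => _ [f _ <-]; apply: ge0_le_integral_nomeas => w.
  by apply: sume_ge0 => x _; exact: point_cost_ge0.
exact: ml_nodes_cost.
Qed.

End Cost.

(** Beyond some [n0] the asymptotic bound applies; below it monotonicity gives [cost n0], and nu^s
    >= 1 for positive nu. *)
Lemma cost_growth (R : realType) (cost : nat -> R) (s : R) :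
  (forall nu, 0 <= cost nu) -> {homo cost : i j / (i <= j)%N >-> i <= j} -> 0 < s ->
  cost =O_\oo (fun nu : nat => nu%:R `^ s : R) ->
  exists2 A, 0 <= A & forall nu x, (0 < nu)%N -> (nu%:R : R) <= x -> cost nu <= A * x `^ s.
Proof.
move=> cost0 cmono s0 /eqOP H.
have [k /= [k0 [n0 _ Hk]]] : exists k : R, 0 < k /\ \forall n \near \oo, `|cost n| <= k * `|(n%:R `^ s : R)|.
  have [k0 [_ Hk0]] := H; exists (`|k0| + 1); split; first by rewrite ltr_wpDl.
  by apply: Hk0; rewrite ltr_pwDr// ler_norm.
exists (k + cost n0); first by rewrite addr_ge0// ltW.
move=> nu x nu0 nux.
have xs1 : nu%:R `^ s <= x `^ s.
  apply: ge0_ler_powR => //; rewrite ?nnegrE//; first exact: ltW.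
  exact: le_trans nux.
have nu1 : 1 <= nu%:R `^ s :> R.
  have p1 : 1 `^ s = 1 :> R by rewrite powR1.
  rewrite -[leLHS]p1.
  by apply: ge0_ler_powR; [exact: ltW|rewrite nnegrE|rewrite nnegrE|rewrite ler1n].
have [nn0|n0n] := leqP n0 nu.
  have := Hk nu nn0; rewrite ger0_norm// ger0_norm ?powR_ge0// => /le_trans; apply.
  by rewrite mulrDl; have := cost0 n0; nra.
apply: (le_trans (cmono _ _ (ltnW n0n))); have := cost0 n0; nra.
Qed.

(** * Error of the multilevel algorithm *)

Section CubeIntegral.
Variables (R : realType) (mu : probability (seqsp R) R).
Hypothesis hmu : is_product_measure mu.
Variables (b : nat) (pb : prime b).
Implicit Types f g : (nat -> R) -> R.

Let bmc f : ucont f -> @bounded_mfun R _ (seqsp R) (f \_ (@cube R nat)).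
Proof. exact: (ucont_bm pb hmu). Qed.

Let cubeE f : \int[mu]_(x in cube (I:=nat)) f x =
  @Ex R _ (seqsp R) mu (f \_ (@cube R nat)).
Proof. exact: Rintegral_mkcond. Qed.

Lemma Rintegral_cubeB f g : ucont f -> ucont g ->
  \int[mu]_(x in cube (I:=nat)) (f x - g x) =
  \int[mu]_(x in cube (I:=nat)) f x - \int[mu]_(x in cube (I:=nat)) g x.
Proof.
move=> cf cg; rewrite !cubeE -(ExB mu (bmc cf) (bmc cg)).
congr Ex; apply/funext => x; by rewrite !patchE; case: ifP; rewrite ?subr0.
Qed.

Lemma Rintegral_cube_dist f g e : ucont f -> ucont g -> 0 <= e ->
  (forall x, cube x -> `|f x - g x| <= e) ->
  `|\int[mu]_(x in cube (I:=nat)) f x - \int[mu]_(x in cube (I:=nat)) g x| <= e.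
Proof.
move=> cf cg e0 fg; rewrite !cubeE.
apply: (Ex_dist mu (bmc cf) (bmc cg)) => x; rewrite !patchE; case: ifP => [/set_mem|_].
  exact: fg.
by rewrite subrr normr0.
Qed.

Lemma qrule_unbiased dsp (Omega : measurableType dsp) (P : probability Omega R)
    (pi : nat * seq 'F_b -> Omega -> {perm 'F_b}) dig M f :
  iid_uniform_perms P pi -> ucont f ->
  Ex P (fun w => qrule dig (b ^ M) f (pi^~ w)) = \int[mu]_(x in cube (I:=nat)) f x.
Proof.
move=> ipi cf; rewrite /qrule Ex_sum; last first.
  by move=> i; apply/bmZ/(pcont_bm ipi (ucont_pcont pb (dig i) cf)).
rewrite -[RHS](qrule_cst pb dig M _ (fun=> 1%g)) /qrule; apply: eq_bigr => i _.
rewrite ExZ; last exact: (pcont_bm ipi (ucont_pcont pb (dig i) cf)).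
by rewrite (scramble_unbiased pb hmu).
Qed.

End CubeIntegral.

(** A nonempty [B] makes the supremum nonnegative, so squaring undoes the square root. *)
Lemma error_sqr_le (R : realType) dsp (Omega : measurableType dsp)
    (P : probability Omega R) (mu : probability (seqsp R) R) (X : set (nat -> R))
    (B : set ((nat -> R) -> R)) (Q : ((nat -> R) -> R) -> Omega -> R) (r : R) :
  B !=set0 -> 
  (forall f, B f -> ('E_P[fun w => ((\int[mu]_(x in X) f x - Q f w) ^+ 2)%R] <= r%:E)%E) ->
  (error P mu X B Q ^+ 2 <= r%:E)%E.
Proof.
move=> [f0 Bf0] H; rewrite /error; set S := ereal_sup _.
have S0 : (0 <= S)%E.
  apply: le_trans (ereal_sup_ubound _); last by exists f0.
  by apply: expectation_ge0 => w; exact: sqr_ge0.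
have Sr : (S <= r%:E)%E by apply: ge_ereal_sup => _ [f Bf <-]; exact: H.
case: S S0 Sr => [x|//|//]; rewrite !lee_fin => x0 xr.
by rewrite powR12_sqrt// -expr2 sqr_sqrtr.
Qed.

Section Error.
Variables (R : realType) (d b : nat).
Variables (p : nat -> {poly 'F_b}) (q : nat -> 'I_d -> {poly 'F_b}).
Variables (dsp0 : measure_display) (Omega0 : measurableType dsp0).
Variables (P0 : probability Omega0 R) (pi0 : 'I_d * seq 'F_b -> Omega0 -> {perm 'F_b}).
Variable Hd : forall u : {set 'I_d}, rkhs (@cube R 'I_d) (@kprod R d u).
Hypotheses (pb : prime b) (ipi0 : iid_uniform_perms P0 pi0).
Hypothesis vb : variance_bound p q P0 pi0 Hd.
Variables (gamma : weights R) (us : nat -> {fset nat}).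
Hypotheses (wg : is_weights gamma) (og : ordering gamma us).
Variable HK : rkhs (domX gamma) (kernK gamma).
Variable phi : nat -> 'I_d.
Hypothesis phiI : forall u, 0 < gamma u -> {in u &, injective phi}.
Variables (mu : probability (seqsp R) R) (hmu : is_product_measure mu).
Variables (dsp : measure_display) (Omega : measurableType dsp).
Variables (P : probability Omega R) (pi : (nat * nat) * seq 'F_b -> Omega -> {perm 'F_b}).
Hypothesis ipi : iid_uniform_perms P pi.
Variables (a : nat -> R) (ca : cube a).
Variables (m : nat) (L M : nat -> nat) (tau : R).
Hypotheses (m0 : (0 < m)%N) (M0 : forall k, (0 < k)%N -> (0 < M k)%N) (tau3 : 1 <= tau < 3).
Hypothesis Lmono : forall k, (0 < k)%N -> (L k <= L k.+1)%N.

Local Notation v := (ml_set us L).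
Local Notation dig n := (fun i nu => lattice_digit p q n i (phi nu)).
Local Notation npts := (fun k => b ^ M k)%N.

Definition level_perm k : nat * seq 'F_b -> Omega -> {perm 'F_b} :=
  fun nus => pi ((k, nus.1), nus.2).

Lemma iid_level k : iid_uniform_perms P (level_perm k).
Proof.
rewrite (_ : level_perm k = pi \o (fun nus => ((k, nus.1), nus.2))); last first.
  by apply/funext => -[nu z].
by apply: iid_sub ipi => -[nu z] [nu' z'] /= [-> ->].
Qed.

Lemma anchored_sub (v1 v2 : {fset nat}) x : (v1 `<=` v2)%fset ->
  anchored a v1 (anchored a v2 x) = anchored a v1 x.
Proof.
move=> /fsubsetP v12; apply/funext => j; rewrite /anchored; case: ifP => // /v12 ->.
by [].
Qed.

Lemma ml_set_sub k : (v k `<=` v k.+1)%fset.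
Proof.
case: k => [|k]; first exact: fsub0set.
by rewrite /=; exact: (us_union_mono us (Lmono _)).
Qed.

(* [Psi] is zero at level 0, not evaluation at the anchor: the first level keeps
   the constant [f a], which does not contribute to the variance. *)
Definition increment (f : (nat -> R) -> R) k (x : nat -> R) : R :=
  f (anchored a (v k.+1) x) - (if k == 0%N then 0 else f (anchored a (v k) x)).

(** Levels count from 1, increments from 0. A node is already anchored outside the larger set, and
    anchoring it again outside the smaller one equals anchoring the scrambled point there
    directly. *)
Lemma ml_levelE f k w : ml_level p q phi us a L npts pi k.+1 (f \- Psi us a L k f) w =
  qrule (dig (b ^ M k.+1)) (b ^ M k.+1) (increment f k) ((level_perm k.+1)^~ w).
Proof.
apply: eq_bigr => i _; congr (_ * _); rewrite /increment /ml_point /=.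
congr (_ - _); case: k i => [//|k] i /=.
by rewrite anchored_sub//; exact: ml_set_sub k.+1.
Qed.

Variable f : HK.
Hypothesis f1 : `|f| <= 1.
Local Notation F := (rkhs_ev f).

Let cF v0 : ucont (fun x => F (anchored a v0 x)).
Proof. exact/ucont_anchored/(HK_ucont wg og). Qed.

Lemma increment_ucont k : ucont (increment F k).
Proof.
apply: ucontB; first exact: cF.
by case: k => [|k] /=; [move=> e e0; exists [::], 1; split=> // x y _ _ _; rewrite subrr normr0 ltW|exact: cF].
Qed.

(** The first increment differs from the difference treated by [level_Var] by the constant F a,
    which leaves the variance unchanged. It starts from the empty set and so meets the full tail,
    whatever [L 0] is. *)
Lemma level_Var_increment k :
  Var P (fun w => qrule (dig (b ^ M k.+1)) (b ^ M k.+1) (increment F k) ((level_perm k.+1)^~ w)) <=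
  40 * (vconst d b tau * ((b ^ M k.+1)%:R - 1) `^ (- tau)) *
    tail gamma us (if k == 0%N then 0%N else L k).
Proof.
have h := @level_Var R d b p q _ _ P0 pi0 Hd pb ipi0 vb gamma us wg og HK phi phiI
  _ _ P _ (iid_level k.+1) a ca f (if k == 0%N then 0%N else L k) (v k.+1) (v k) (M k.+1) tau f1
  (ml_set_sub k).
apply: le_trans (h _ (M0 _) tau3) => //; last first.
  case: k {h} => [//|k] j jL; exact: us_sub_union.
rewrite /increment; case: k {h} => [|k] /=; last exact: lexx.
rewrite le_eqVlt; apply/orP; left; apply/eqP.
rewrite -[RHS](@VarDc _ _ _ P (F a)); last first.
  exact: (pcont_bm (iid_level 1) (qrule_pcont pb _ _ (ucontB (cF _) (cF _)))).
congr Var; apply/funext => w.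
rewrite -[X in _ + X](qrule_cst pb (dig (b ^ M 1)) (M 1) (F a) ((level_perm 1)^~ w)).
have a0 x : anchored a fset0 x = a by apply/funext => j; rewrite /anchored inE.
have e0 : qrule (dig (b ^ M 1)) (b ^ M 1) (fun x => F (anchored a fset0 x))
    ((level_perm 1)^~ w) = qrule (dig (b ^ M 1)) (b ^ M 1) (fun=> F a) ((level_perm 1)^~ w).
  by apply: (eq_qrule pb) => x _; rewrite a0.
rewrite [in RHS]qruleB e0 subrK.
by apply: (eq_qrule pb) => x _; rewrite subr0.
Qed.

(** The factor m + 1 counts the bias and the m levels in Cauchy-Schwarz. *)
Definition err_bound : R := (m.+1)%:R * (4 * tail gamma us (L m) +
  \sum_(0 <= k < m) 40 * (vconst d b tau * ((b ^ M k.+1)%:R - 1) `^ (- tau)) *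
    tail gamma us (if k == 0%N then 0%N else L k)).

Local Notation Ic g := (\int[mu]_(x in cube (I:=nat)) g x).

Lemma sum_increment k : \sum_(0 <= k < k.+1) Ic (increment F k) = Ic (fun x => F (anchored a (v k.+1) x)).
Proof.
elim: k => [|k IH].
  rewrite big_nat1; congr (Rintegral _ _ _); apply/funext => x.
  by rewrite /increment subr0.
rewrite big_nat_recr//= IH.
have -> : Ic (increment F k.+1) = Ic (fun x => F (anchored a (v k.+2) x)) -
    Ic (fun x => F (anchored a (v k.+1) x)) by exact: (Rintegral_cubeB hmu pb).
by rewrite addrC subrK.
Qed.

Lemma bias_sqr : (Ic F - Ic (fun x => F (anchored a (v m) x))) ^+ 2 <= 4 * tail gamma us (L m).
Proof.
have t0 : 0 <= 4 * tail gamma us (L m) by rewrite mulr_ge0// (tail_ge0 wg og).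
rewrite -[leRHS](sqr_sqrtr t0) -[leLHS]real_normK ?num_real// ler_sqr ?nnegrE ?sqrtr_ge0//.
apply: (Rintegral_cube_dist hmu pb) => [|||x cx].
- exact: (HK_ucont wg og f).
- exact: cF.
- exact: sqrtr_ge0.
apply: sqr_le_norm; first exact: sqrtr_ge0.
rewrite sqr_sqrtr// (le_trans (HK_near wg og f (J := L m) cx (cube_anchored (v m) ca cx) _))//.
  move=> j i jL ij; rewrite /anchored.
  have -> // : i \in v m.
  by move: m0 jL; case: (m) => // m' _ jL; exact: (fsubsetP (us_sub_union us jL)).
by rewrite ler_piMl// -[leRHS]mul1r expr2 ler_pM.
Qed.

(** Each level is unbiased for the integral of its increment, and these integrals telescope. So the
    error is the bias minus the sum of the centred levels. *)
Lemma ml_error : ('E_P[fun w => ((\int[mu]_(x in domX gamma) F x -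
    ml_alg p q phi us a m L npts pi F w) ^+ 2)%R] <= err_bound%:E)%E.
Proof.
have -> : \int[mu]_(x in domX gamma) F x = Ic F.
  by move: (F) => g; rewrite (domX_cube wg).
pose Y k w := qrule (dig (b ^ M k.+1)) (b ^ M k.+1) (increment F k) ((level_perm k.+1)^~ w).
have bY k : bounded_mfun (Y k).
  exact: (pcont_bm (iid_level k.+1) (qrule_pcont pb _ _ (increment_ucont k))).
have EY k : Ex P (Y k) = Ic (increment F k).
  exact: (qrule_unbiased hmu pb _ _ (iid_level k.+1) (increment_ucont k)).
have QE w : ml_alg p q phi us a m L npts pi F w = \sum_(0 <= k < m) Y k w.
  by rewrite /ml_alg big_add1; apply: eq_bigr => k _; rewrite ml_levelE.
pose beta := Ic F - Ic (fun x => F (anchored a (v m) x)).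
have dE w : Ic F - ml_alg p q phi us a m L npts pi F w =
    beta - \sum_(0 <= k < m) (Y k w - Ex P (Y k)).
  rewrite QE sumrB; under [X in _ - (_ - X)]eq_bigr do rewrite EY.
  have := sum_increment m.-1; rewrite prednK// => ->.
  by rewrite /beta opprB addrA subrK.
have bdev k : bounded_mfun (fun w => (Y k w - Ex P (Y k)) ^+ 2) by exact: bm_dev.
have bS : bounded_mfun (fun w => \sum_(0 <= k < m) (Y k w - Ex P (Y k)) ^+ 2) by exact: bm_sum.
have bD : bounded_mfun (fun w => (Ic F - ml_alg p q phi us a m L npts pi F w) ^+ 2).
  under eq_fun do rewrite QE; apply: bm_sqr; apply: bmB; first exact: bm_cst.
  exact: bm_sum.
rewrite ExE// lee_fin.
apply: (@le_trans _ _ (Ex P (fun w => m.+1%:R * (beta ^+ 2 +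
    \sum_(0 <= k < m) (Y k w - Ex P (Y k)) ^+ 2)))).
  apply: Ex_le => //; first by apply: bmZ; apply: bmD => //; exact: bm_cst.
  move=> w; rewrite dE.
  pose x (k : nat) := if k is k'.+1 then - (Y k' w - Ex P (Y k')) else beta.
  have := sum_CS (index_iota 0 m.+1) x (fun=> ltr01).
  rewrite big_nat_recl// [X in _ <= _ * X]big_nat_recl//= sumrN big_const_nat iter_addr_0 subn0.
  move=> /le_trans; apply; rewrite ler_wpM2l// invr1 mul1r lerD2l.
  by apply: ler_sum => k _; rewrite mul1r sqrrN.
rewrite ExZ; last by apply: bmD => //; exact: bm_cst.
rewrite /err_bound ler_wpM2l// ExD//; last exact: bm_cst.
rewrite Ex_cst lerD ?bias_sqr// Ex_sum//; apply: ler_sum => k _.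
exact: level_Var_increment.
Qed.

End Error.

(** * Choice of the parameters *)

Section PowR.
Variable R : realType.
Implicit Types x y z r : R.

Lemma ler_powR2 x y r : 0 <= x -> x <= y -> 0 <= r -> x `^ r <= y `^ r.
Proof.
move=> x0 xy r0; apply: ge0_ler_powR => //; rewrite ?nnegrE//.
exact: le_trans xy.
Qed.

Lemma ler_powRN x y r : 0 < x -> x <= y -> 0 <= r -> y `^ (- r) <= x `^ (- r).
Proof.
move=> x0 xy r0; rewrite !powRN lef_pV2 ?posrE ?powR_gt0//; last exact: lt_le_trans xy.
by apply: ler_powR2 => //; exact: ltW.
Qed.

Lemma powR_gt1 x r : 1 < x -> 0 < r -> 1 < x `^ r.
Proof.
move=> x1 r0; have p1 : 1 `^ r = 1 :> R by rewrite powR1.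
rewrite -[ltLHS]p1; apply: gt0_ltr_powR => //; rewrite nnegrE//.
by rewrite ltW// (lt_trans _ x1).
Qed.

Lemma powR_ge_of_le x y r : 0 <= x -> 0 < r -> x `^ r^-1 <= y -> x <= y `^ r.
Proof.
move=> x0 r0 xy; have -> : x = (x `^ r^-1) `^ r.
  by rewrite -powRrM mulVf ?gt_eqF// powRr1.
by apply: ler_powR2 => //; [exact: powR_ge0|exact: ltW].
Qed.

Lemma bernoulli_ge x n : 0 <= x -> 1 + n%:R * x <= (1 + x) ^+ n.
Proof.
move=> x0; elim: n => [|n IH]; first by rewrite mul0r addr0 expr0.
rewrite exprS (le_trans _ (ler_wpM2l _ IH)) ?addr_ge0//.
rewrite -natr1; have : 0 <= n%:R * (x * x) by rewrite !mulr_ge0.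
by move: (n%:R : R) => u; lra.
Qed.

Lemma log_floor (beta y : R) : 1 < beta -> beta <= y ->
  exists m, [/\ (0 < m)%N, beta ^+ m <= y & y < beta ^+ m.+1].
Proof.
move=> b1 by1.
have ex : exists m, y < beta ^+ m.+1.
  exists (Num.truncn (y / (beta - 1))).
  have b10 : 0 < beta - 1 by rewrite subr_gt0.
  apply: (@lt_le_trans _ _ (1 + (Num.truncn (y / (beta - 1))).+1%:R * (beta - 1))).
    rewrite ltr_pwDl// ltW// -ltr_pdivrMr//; exact: truncnS_gt.
  by rewrite (le_trans (bernoulli_ge _ (ltW b10)))// subrKC.
pose m := ex_minn ex; exists m; rewrite /m; case: ex_minnP => k yk kmin; split=> //.
  by case: k yk {kmin} => //; rewrite expr1 ltNge by1.
case: k yk kmin => [yk _|k yk kmin]; first by rewrite expr0 (le_trans _ by1)// ltW.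
by rewrite leNgt; apply/negP => /kmin; rewrite ltnn.
Qed.

End PowR.

Section Params.
Variables (R : realType) (b : nat) (beta A rho kap V : R).
Hypotheses (b1 : (1 < b)%N) (beta1 : 1 < beta) (A0 : 0 <= A) (V0 : 0 <= V).
Hypotheses (rho3 : 0 <= rho < 3) (kap0 : 0 < kap) (kap4 : kap <= 4^-1).

(** The variance bound requires an exponent at least 1, whereas the decay of the weights may only
    allow a smaller [rho]. *)
Let tau := Num.max 1 rho.

(** Each level may cost about Y = N^(1 - 2 kap). For the total cost one N^kap absorbs the number of
    levels and one the constants. The error has order Y^(-rho), times two factors m + 1 and a
    constant, each absorbed by N^kap. *)
Lemma level_sizes : exists N0 : R, forall N, N0 <= N -> exists (m : nat) (M : nat -> nat),
  [/\ (0 < m)%N, (forall k, (0 < k)%N -> (0 < M k)%N) &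
      (forall k, (M k.+1 <= M k)%N)] /\
  \sum_(1 <= k < m.+1) 2 * (b ^ M k)%:R * (A * beta ^+ k) <= N /\
  m.+1%:R * (4 * (V * (beta ^+ m) `^ (- rho)) +
     \sum_(0 <= k < m) V * ((b ^ M k.+1)%:R - 1) `^ (- tau) * (beta ^+ k) `^ (- rho)) <=
  N `^ (3 * kap - rho * (1 - 2 * kap)).
Proof.
move: kap0 kap4 => k0 k4; have /andP[r0 r3] := rho3.
have tau0 : 0 <= tau by rewrite le_max ler01.
have rt : rho <= tau by rewrite le_max lexx orbT.
have bR0 : (0 : R) < b%:R by rewrite ltr0n ltnW.
have bR1 : (1 : R) <= b%:R by rewrite ler1n ltnW.
have be0 : 0 < beta by rewrite (lt_trans _ beta1).
have beX k : 0 < beta ^+ k by rewrite exprn_gt0.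
pose gk := beta `^ kap.
have gk1 : 0 < gk - 1 by rewrite subr_gt0 powR_gt1.
pose E := 1 + (gk - 1)^-1.
have E0 : 0 < E by rewrite addr_gt0// invr_gt0.
pose K1 := 2 * A * E.
pose W := 4 * V * (b%:R * beta) `^ rho + V * (2 * b%:R * beta) `^ tau.
have W0 : 0 <= W by rewrite addr_ge0// !mulr_ge0// powR_ge0.
pose K2 := E ^+ 2 * W.
have K10 : 0 <= K1 by rewrite !mulr_ge0// ltW.
have K20 : 0 <= K2 by rewrite mulr_ge0// sqr_ge0.
(* The summands ensure N >= 1, Y >= b * beta (so at least one level fits), and that N^kap exceeds
   the constants [K1] of the cost and [K2] of the error. *)
pose N0 := 1 + (b%:R * beta) `^ (1 - 2 * kap)^-1 + K1 `^ kap^-1 + K2 `^ kap^-1.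
have k12 : 0 < 1 - 2 * kap by lra.
exists N0 => N N0N.
have p1 := powR_ge0 (b%:R * beta) (1 - 2 * kap)^-1.
have p2 := powR_ge0 K1 kap^-1; have p3 := powR_ge0 K2 kap^-1.
have [N1 NP1 NP2 NP3] : [/\ 1 <= N, (b%:R * beta) `^ (1 - 2 * kap)^-1 <= N,
    K1 `^ kap^-1 <= N & K2 `^ kap^-1 <= N].
  move: N0N p1 p2 p3; rewrite /N0; move: (_ `^ _) (K1 `^ _) (K2 `^ _) => x y z *.
  by split; lra.
have Ngt0 : 0 < N by exact: lt_le_trans N1.
have NK1 : K1 <= N `^ kap by exact: powR_ge_of_le.
have NK2 : K2 <= N `^ kap by exact: powR_ge_of_le.
pose Y := N `^ (1 - 2 * kap).
have Y0 : 0 < Y by exact: powR_gt0.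
have YN : Y <= N by apply: ler1_powR => //; lra.
have Yb : b%:R * beta <= Y.
  by apply: powR_ge_of_le => //; rewrite mulr_ge0// ltW.
have [m [m0 mY Ym]] : exists m, [/\ (0 < m)%N, beta ^+ m <= Y / b%:R & Y / b%:R < beta ^+ m.+1].
  by apply: log_floor => //; rewrite ler_pdivlMr// mulrC.
have mkY k : (k <= m)%N -> b%:R * beta ^+ k <= Y.
  move=> km; rewrite mulrC -ler_pdivlMr//; apply: le_trans mY.
  by rewrite ler_eXn2l.
(* Bernoulli's inequality for (beta^kap)^m = (beta^m)^kap <= N^kap. *)
have mE : m.+1%:R <= E * N `^ kap.
  have h1 : 1 + m%:R * (gk - 1) <= N `^ kap.
    apply: le_trans (bernoulli_ge _ (ltW gk1)) _; rewrite subrKC.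
    have -> : gk ^+ m = (beta ^+ m) `^ kap.
      by rewrite -(powR_mulrn m (powR_ge0 _ _)) -(powR_mulrn m (ltW be0)) /gk powRAC.
    apply: ler_powR2; [exact: ltW| |exact: ltW].
    apply: le_trans YN; apply: le_trans mY _.
    by rewrite ler_pdivrMr// ler_peMr// ltW.
  rewrite /E mulrDl mul1r -natr1 addrC; apply: lerD.
    by apply: le_trans h1; rewrite lerDl mulr_ge0// ltW.
  rewrite mulrC ler_pdivlMr//; lra.
(* Level [k] gets about [Y / beta ^ k] points, which makes all levels equally
   expensive; [m] is the last level with at least [b] points. *)
pose M k := maxn 1 (trunc_log b (Num.truncn (Y / beta ^+ k))).
have M_le k : (k <= m)%N -> (b ^ M k)%:R * beta ^+ k <= Y.
  move=> km; have Yk0 : 0 <= Y / beta ^+ k by rewrite divr_ge0 ?ltW.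
  have bt : (b <= Num.truncn (Y / beta ^+ k))%N.
    by rewrite truncn_ge_nat// ler_pdivlMr// mkY.
  have t0 : (0 < Num.truncn (Y / beta ^+ k))%N by apply: leq_trans bt; exact: ltnW.
  have -> : M k = trunc_log b (Num.truncn (Y / beta ^+ k)).
    by apply/maxn_idPr; apply: trunc_log_max => //; rewrite expn1.
  rewrite -ler_pdivlMr//; apply: (@le_trans _ _ (Num.truncn (Y / beta ^+ k))%:R).
    by rewrite ler_nat trunc_logP.
  by rewrite truncn_le.
have M_gt k : Y < (b * b ^ M k)%:R * beta ^+ k.
  rewrite -ltr_pdivrMr// (lt_le_trans (truncnS_gt _))// ler_nat -expnS.
  apply: leq_trans (trunc_log_ltn _ b1) _.
  by rewrite leq_exp2l// ltnS leq_maxr.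
exists m, M; split.
  split=> // [k _|k]; first by rewrite /M leq_max.
  rewrite /M geq_max leq_maxl/= leq_max; apply/orP; right; apply/leq_trunc_log/le_truncn.
  apply: ler_wpM2l; first exact: ltW.
  rewrite lef_pV2 ?posrE//.
  by rewrite exprS ler_peMl// ltW.
split.
  apply: (@le_trans _ _ (\sum_(1 <= k < m.+1) 2 * A * Y)).
    rewrite big_nat [leRHS]big_nat; apply: ler_sum => k; rewrite ltnS => /andP[_ km].
    by rewrite mulrACA ler_wpM2l ?mulr_ge0// M_le.
  rewrite sumr_const_nat subn1/= -[_ *+ m]mulr_natl.
  apply: (@le_trans _ _ (E * N `^ kap * (2 * A * Y))).
    apply: ler_wpM2r; first by rewrite mulr_ge0 ?(ltW Y0)// mulr_ge0.
    apply: le_trans mE.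
    by rewrite ler_nat.
  have -> : E * N `^ kap * (2 * A * Y) = K1 * (N `^ kap * Y) by rewrite /K1; ring.
  apply: (@le_trans _ _ (N `^ kap * (N `^ kap * Y))).
    by rewrite ler_wpM2r// mulr_ge0// ?powR_ge0// ltW.
  rewrite /Y -!powRD ?(gt_eqF Ngt0) ?implybT//.
  have -> : kap + (kap + (1 - 2 * kap)) = 1 by ring.
  by rewrite powRr1// ltW.
have Yr : 0 < Y `^ (- rho) by exact: powR_gt0.
(* By maximality of [m], beta^m >= Y / (b * beta). *)
have T1 : V * (beta ^+ m) `^ (- rho) <= V * ((b%:R * beta) `^ rho * Y `^ (- rho)).
  rewrite ler_wpM2l//.
  have bb0 : 0 < b%:R * beta by rewrite mulr_gt0.
  have -> : (b%:R * beta) `^ rho * Y `^ (- rho) = (Y / (b%:R * beta)) `^ (- rho).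
    rewrite (@powRM _ Y) ?invr_ge0 ?(ltW Y0) ?(ltW bb0)// mulrC; congr (_ * _).
    by rewrite -(powR_inv1 (ltW bb0)) -powRrM mulrNN mul1r.
  apply: ler_powRN => //; first by rewrite divr_gt0.
  rewrite ler_pdivrMr//; move: Ym; rewrite ltr_pdivrMr// exprS => Ym.
  by rewrite ltW// (lt_le_trans Ym)// le_eqVlt; apply/orP; left; apply/eqP; ring.
(* With z = beta^k, n - 1 >= n / 2 gives n - 1 >= Y / (2 b beta z). Since z <= Y, the power (z /
   Y)^tau is at most (z / Y)^rho, and z^rho cancels the factor z^(-rho). *)
have T2 k : (k < m)%N -> V * ((b ^ M k.+1)%:R - 1) `^ (- tau) * (beta ^+ k) `^ (- rho) <=
    V * ((2 * b%:R * beta) `^ tau * Y `^ (- rho)).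
  move=> km; rewrite -mulrA ler_wpM2l//.
  set z := beta ^+ k; have z0 : 0 < z by exact: beX.
  pose c := 2 * b%:R * beta; have c0 : 0 < c by rewrite !mulr_gt0.
  have zY : z <= Y.
    apply: le_trans (mkY k (ltnW km)); rewrite ler_peMl// ltW//.
  have n2 : 2 <= (b ^ M k.+1)%:R :> R.
    rewrite ler_nat; apply: leq_trans b1 _; rewrite -[leqLHS]expn1 leq_exp2l//.
    by rewrite /M leq_maxl.
  have nY : Y / (c * z) <= (b ^ M k.+1)%:R - 1.
    rewrite ler_pdivrMr ?mulr_gt0//.
    have := M_gt k.+1; rewrite natrM exprS -/z.
    move: ((b ^ M k.+1)%:R : R) n2 => n n2 h; apply: (le_trans (ltW h)).
    have -> : b%:R * n * (beta * z) = (n / 2) * (c * z) by rewrite /c; field.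
    apply: ler_wpM2r; first by rewrite mulr_ge0 ?(ltW c0) ?(ltW z0).
    by move: n2 => /=; lra.
  apply: (@le_trans _ _ ((Y / (c * z)) `^ (- tau) * z `^ (- rho))).
    rewrite ler_wpM2r ?powR_ge0//; apply: ler_powRN => //.
    by rewrite divr_gt0// mulr_gt0.
  have -> : (Y / (c * z)) `^ (- tau) = c `^ tau * (z / Y) `^ tau.
    have zY0 : 0 < z / Y by rewrite divr_gt0.
    rewrite -(powRM tau (ltW c0) (ltW zY0)).
    have -> : Y / (c * z) = (c * (z / Y))^-1.
      by rewrite !invfM invrK mulrCA [z^-1 * Y]mulrC.
    have cz0 : 0 <= c * (z / Y) by rewrite mulr_ge0 ?(ltW c0) ?(ltW zY0).
    by rewrite -(powR_inv1 cz0) -powRrM mulrNN mul1r.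
  rewrite -mulrA ler_wpM2l ?powR_ge0//.
  have zY1 : 0 < z / Y <= 1 by rewrite divr_gt0//= ler_pdivrMr// mul1r.
  apply: (@le_trans _ _ ((z / Y) `^ rho * z `^ (- rho))).
    by rewrite ler_wpM2r ?powR_ge0//; exact: ger_powR.
  rewrite (@powRM _ z) ?invr_ge0 ?(ltW Y0) ?(ltW z0)// -(powR_inv1 (ltW Y0)) -powRrM mulN1r mulrAC -powRD.
    by rewrite subrr powRr0 mul1r.
  by rewrite (gt_eqF z0) implybT.
apply: (@le_trans _ _ (m.+1%:R * (m.+1%:R * (W * Y `^ (- rho))))).
  rewrite ler_wpM2l//.
  have -> : m.+1%:R * (W * Y `^ (- rho)) = W * Y `^ (- rho) + m%:R * (W * Y `^ (- rho)).
    by rewrite -natr1; ring.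
  have q1 : 0 <= V * ((2 * b%:R * beta) `^ tau * Y `^ (- rho)) by rewrite !mulr_ge0 ?powR_ge0.
  have q2 : 0 <= 4 * (V * ((b%:R * beta) `^ rho * Y `^ (- rho))) by rewrite !mulr_ge0 ?powR_ge0.
  have WE : W * Y `^ (- rho) = 4 * (V * ((b%:R * beta) `^ rho * Y `^ (- rho))) +
      V * ((2 * b%:R * beta) `^ tau * Y `^ (- rho)) by rewrite /W; ring.
  apply: lerD; first by rewrite WE; lra.
  apply: (@le_trans _ _ (\sum_(0 <= k < m) W * Y `^ (- rho))).
    rewrite big_nat [leRHS]big_nat; apply: ler_sum => k /andP[_ km].
    by rewrite (le_trans (T2 k km))// WE; lra.
  by rewrite sumr_const_nat subn0 -[_ *+ m]mulr_natl.
apply: (@le_trans _ _ (E * N `^ kap * (E * N `^ kap * (W * Y `^ (- rho))))).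
  have q3 : 0 <= W * Y `^ (- rho) by rewrite mulr_ge0 ?powR_ge0.
  apply: ler_pM => //; first by rewrite mulr_ge0.
  by rewrite ler_wpM2r.
have -> : E * N `^ kap * (E * N `^ kap * (W * Y `^ (- rho))) =
    K2 * (N `^ kap * N `^ kap * Y `^ (- rho)) by rewrite /K2; ring.
apply: (@le_trans _ _ (N `^ kap * (N `^ kap * N `^ kap * Y `^ (- rho)))).
  by rewrite ler_wpM2r// !mulr_ge0 ?powR_ge0.
rewrite /Y -powRrM -!powRD ?(gt_eqF Ngt0) ?implybT//.
by apply: ler_powR => //; lra.
Qed.

End Params.

(** * Polynomial decay of the tails *)

Section TailDecay.
Variable R : realType.

(** A mean value estimate for x^(-t) on [x, x + 1], obtained from exp(y) >= 1 + y: once for u^(-t)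
    with u = x / (x + 1), once for ln u <= u - 1. *)
Lemma powR_step (x t : R) : 0 < x -> 0 < t ->
  t * (x + 1) `^ (- (1 + t)) <= x `^ (- t) - (x + 1) `^ (- t).
Proof.
move=> x0 t0; have x1 : 0 < x + 1 by rewrite addr_gt0.
pose u := x / (x + 1); have u0 : 0 < u by rewrite divr_gt0.
have -> : x `^ (- t) = (x + 1) `^ (- t) * u `^ (- t).
  rewrite -powRM ?ltW// /u mulrCA mulfV ?mulr1// gt_eqF//.
have -> : (x + 1) `^ (- (1 + t)) = (x + 1) `^ (- t) * (x + 1)^-1.
  rewrite (_ : - (1 + t) = - t + -1); last by ring.
  by rewrite powRD ?(gt_eqF x1) ?implybT// (powR_inv1 (ltW x1)).
have h : 1 + t * (x + 1)^-1 <= u `^ (- t).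
  rewrite /powR gt_eqF//; apply: le_trans (expR_ge1Dx _).
  rewrite lerD2l mulNr -mulrN ler_pM2l// lerNr.
  have := expR_ge1Dx (ln u); rewrite lnK ?posrE// => lnu.
  have : u = 1 - (x + 1)^-1 by rewrite /u; field; rewrite gt_eqF.
  lra.
have X0 := powR_ge0 (x + 1) (- t).
rewrite -subr_ge0.
have -> : (x + 1) `^ (- t) * u `^ (- t) - (x + 1) `^ (- t) -
    t * ((x + 1) `^ (- t) * (x + 1)^-1) =
    (x + 1) `^ (- t) * (u `^ (- t) - (1 + t * (x + 1)^-1)) by ring.
by rewrite mulr_ge0// subr_ge0.
Qed.

Lemma psum_bound (t : R) J : 0 < t ->
  \sum_(0 <= j < J) (j.+1%:R : R) `^ (- (1 + t)) <= 1 + t^-1.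
Proof.
move=> t0; have ti : 0 < t^-1 by rewrite invr_gt0.
case: J => [|J]; first by rewrite big_geq// addr_ge0// ltW.
(* Induction needs this stronger bound, which telescopes under [powR_step]. *)
apply: (@le_trans _ _ (1 + t^-1 * (1 - J.+1%:R `^ (- t)))); last first.
  by rewrite lerD2l ler_piMr// ?ltW// gerBl powR_ge0.
elim: J => [|J IH].
  by rewrite big_nat1 powR1 subrr mulr0 addr0.
rewrite big_nat_recr//= (le_trans (lerD IH (lexx _)))//.
have := @powR_step J.+1%:R t (ltr0Sn _ _) t0; rewrite natr1 => h.
have : J.+2%:R `^ (- (1 + t)) <= t^-1 * (J.+1%:R `^ (- t) - J.+2%:R `^ (- t)).
  by rewrite mulrC ler_pdivlMr// mulrC.
by rewrite !mulrBr; lra.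
Qed.

Variables (gamma : weights R) (us : nat -> {fset nat}).
Hypotheses (wg : is_weights gamma) (og : ordering gamma us).

(** Write q = r + (1 + t) with t > 0: the factor with exponent -r is largest at the first index, and
    the series with exponent -(1 + t) converges. *)
Lemma tail_decay (K q r : R) : 0 <= K -> 0 <= r -> r < q - 1 ->
  (forall j, gamma (us j) <= K * j.+1%:R `^ (- q)) ->
  exists2 C, 0 <= C & forall L, tail gamma us L <= C * L.+1%:R `^ (- r).
Proof.
move=> K0 r0 rq H; pose t := q - 1 - r; have t0 : 0 < t by rewrite /t; lra.
have ti : 0 < t^-1 by rewrite invr_gt0.
exists (K * (1 + t^-1)); first by rewrite mulr_ge0// addr_ge0// ltW.
move=> L; apply/ler_addgt0Pr => e e0.
have [J0 J0e] := tail_cvg wg og e0.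
pose J := maxn J0 L; have LJ : (L <= J)%N by exact: leq_maxr.
rewrite -(sum_tail wg og LJ); apply: lerD; last first.
  by rewrite (le_trans _ (ltW J0e))// (le_tail wg og)// leq_maxl.
apply: (@le_trans _ _ (K * L.+1%:R `^ (- r) * \sum_(L <= j < J) j.+1%:R `^ (- (1 + t)))).
  rewrite mulr_sumr big_nat [leRHS]big_nat; apply: ler_sum => j /andP[Lj _].
  rewrite (le_trans (H j))// -mulrA ler_wpM2l//.
  have -> : - q = - r + - (1 + t) by rewrite /t; ring.
  rewrite powRD ?pnatr_eq0 ?implybT// ler_wpM2r ?powR_ge0//.
  by apply: ler_powRN => //; rewrite ler_nat ltnS.
rewrite mulrAC ler_wpM2r ?powR_ge0// ler_wpM2l//.
apply: le_trans (psum_bound J t0).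
rewrite [leRHS](@big_cat_nat _ _ _ L)//= lerDr; apply: sumr_ge0 => j _; exact: powR_ge0.
Qed.

(** Some exponent above [x] is admissible in the supremum, and a convergent sequence is bounded.
    Since k(1/2, 1/2) = 1/12, passing from [gamma_hat] to [gamma] costs at most 12^omega. *)
Lemma decay_bound (omega : nat) (x : R) : finite_order gamma omega ->
  (x%:E < decay gamma us)%E -> exists2 q, x < q &
  exists2 K, 0 <= K & forall j, gamma (us j) <= K * j.+1%:R `^ (- q).
Proof.
move=> fo /ereal_sup_gt[_ [q Hq <-]]; rewrite lte_fin => xq; exists q => //.
have /cvg_seq_bounded[M [_ HM]] : cvgn (fun j => gamma_hat gamma (us j) * j.+1%:R `^ q).
  by apply/cvg_ex; exists 0.
have k12 : kern 2^-1 2^-1 = 12^-1 :> R by rewrite /kern maxxx; field.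
exists (12 ^+ omega * (`|M| + 1)); first by rewrite mulr_ge0.
move=> j; have := HM (`|M| + 1); rewrite ltr_pwDr ?ler_norm// => /(_ isT j I) /=.
have X0 : 0 < (j.+1%:R : R) `^ q by exact: powR_gt0.
rewrite /gamma_hat k12 => h; rewrite powRN -mulrA -ler_pdivrMl ?exprn_gt0//.
rewrite ler_pdivlMr//; apply: le_trans h; apply: le_trans (ler_norm _).
rewrite ler_pM2r// mulrC ler_wpM2l//; first by rewrite ltW// (us_gt0 og).
rewrite exprVn lef_pV2 ?posrE ?exprn_gt0// ler_weXn2l//; first by rewrite ler1n.
exact: (us_card og fo).
Qed.

(* The exponent [rho] is [D - delta / 2] truncated at [0], where [D] is the
   exponent in the theorem without its loss [delta]. *)
Lemma decay_exponent (omega : nat) (s delta : R) : finite_order gamma omega ->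
  0 < s -> 0 < delta -> exists rho C,
  [/\ 0 <= rho < 3, 0 <= C,
      (forall L, tail gamma us L <= C * L.+1%:R `^ (- (rho * s))),
      ((1 + 3 * s)%:E <= decay gamma us)%E -> 3 - delta / 2 <= rho &
      (1 < decay gamma us < (1 + 3 * s)%:E)%E ->
        (fine (decay gamma us) - 1) / s - delta / 2 <= rho].
Proof.
move=> fo s0 d0; case: (boolP (decay gamma us <= 1)%E) => [d1|]; last rewrite -ltNge => d1.
  (* For decay at most 1 no rate is claimed, but an algorithm within the cost bound is still
     required; exponent 0 provides it. *)
  exists 0, (tail gamma us 0); split=> //.
  - by rewrite lexx ltr0n.
  - exact: (tail_ge0 wg og).
  - by move=> L; rewrite mul0r oppr0 powRr0 mulr1 (le_tail wg og).
  - by move=> /le_trans/(_ d1); rewrite lee_fin; lra.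
  - by move=> /andP[/lt_le_trans/(_ d1)]; rewrite ltxx.
have [D [D0 D3 Dd D1 D2]] : exists D, [/\ 0 < D, D <= 3,
    ((1 + D * s)%:E <= decay gamma us)%E,
    ((1 + 3 * s)%:E <= decay gamma us)%E -> D = 3 &
    (1 < decay gamma us < (1 + 3 * s)%:E)%E -> (fine (decay gamma us) - 1) / s = D].
  case: (boolP ((1 + 3 * s)%:E <= decay gamma us)%E) => [h|]; last rewrite -ltNge => h.
    by exists 3; split=> //; case/andP=> _ h'; move: (le_lt_trans h h'); rewrite ltxx.
  exists ((fine (decay gamma us) - 1) / s).
  case: (decay gamma us) d1 h => [x|//|//] d1 h /=; move: d1 h; rewrite !lte_fin => d1 h.
  split=> //.
  - by rewrite divr_gt0// subr_gt0.
  - by rewrite ler_pdivrMr//; lra.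
  - by rewrite lee_fin divfK ?gt_eqF//; lra.
pose rho := Num.max 0 (D - delta / 2).
have rho0 : 0 <= rho by rewrite le_max lexx.
have rhoD : rho < D by rewrite gt_max D0/=; lra.
have [q xq [K K0 HK]] : exists2 q, 1 + rho * s < q &
    exists2 K, 0 <= K & forall j, gamma (us j) <= K * j.+1%:R `^ (- q).
  apply: (decay_bound fo); apply: lt_le_trans Dd.
  by rewrite lte_fin ltrD2l ltr_pM2r.
have [C C0 HC] := tail_decay K0 (mulr_ge0 rho0 (ltW s0)) (q := q) (ltac:(lra)) HK.
exists rho, C; split=> //.
- by rewrite rho0 (lt_le_trans rhoD).
- by move=> /D1 <-; rewrite le_max lexx orbT.
- by move=> /D2 ->; rewrite le_max lexx orbT.
Qed.

End TailDecay.

Theorem corollary5p2 (R : realType) (d : nat) (delta : R) :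
  0 < delta ->
  exists C : R,
  forall
    (gamma : weights R) (omega eta : nat) (us : nat -> {fset nat})
    (phi : nat -> 'I_d)
    (cost : nat -> R) (s : R)
    (mu : probability (seqsp R) R)
    (HK : rkhs (domX gamma) (kernK gamma))
    (Hd : forall u : {set 'I_d}, rkhs (@cube R 'I_d) (@kprod R d u))
    (b : nat) (p : nat -> {poly 'F_b}) (q : nat -> 'I_d -> {poly 'F_b})
    (dsp0 : measure_display) (Omega0 : measurableType dsp0)
    (P0 : probability Omega0 R)
    (pi0 : 'I_d * seq 'F_b -> Omega0 -> {perm 'F_b})
    (dsp : measure_display) (Omega : measurableType dsp)
    (P : probability Omega R)
    (pi : (nat * nat) * seq 'F_b -> Omega -> {perm 'F_b}),
  is_weights gamma ->
  finite_intersection gamma omega ->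
  (forall i : nat, ([set u | 0 < gamma u /\ i \in u] #<= `I_eta)%card) ->
  d = (eta * (omega - 1) + 1)%N ->
  ordering gamma us ->
  (forall u, 0 < gamma u -> {in u &, injective phi}) ->
  (forall nu, 0 <= cost nu) ->
  {homo cost : i j / (i <= j)%N >-> i <= j} ->
  0 < s ->
  cost =O_\oo (fun nu : nat => nu%:R `^ s : R) ->
  is_product_measure mu ->
  prime b ->
  (forall M, size (p M) = M.+1) ->
  iid_uniform_perms P0 pi0 ->
  variance_bound p q P0 pi0 Hd ->
  iid_uniform_perms P pi ->
  let a : nat -> R := fun=> 2^-1 in
  exists N0 : R, forall N : R, N0 <= N ->
  exists (m : nat) (L n : nat -> nat),
    [/\ (0 < m)%N, (0 < L 1)%N &
        (forall k, (1 <= k < m)%N -> (L k < L k.+1)%N)] /\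
    [/\ (0 < n m)%N &
        (forall k, (1 <= k < m)%N -> (n k.+1 <= n k)%N)] /\
    let Q := ml_alg p q phi us a m L n pi in
    let nodes := fun _ => ml_nodes p q phi us a m L n pi in
    let e := error P mu (domX gamma) (rkhs_ball HK) Q in
    [/\ (cost_var P cost (domX gamma) (rkhs_ball HK) nodes <= N%:E)%E,
        ((1 + 3 * s)%:E <= decay gamma us)%E ->
          (e ^+ 2 <= (C * N `^ (- 3 + delta))%:E)%E &
        (1 < decay gamma us < (1 + 3 * s)%:E)%E ->
          (e ^+ 2 <= (C * N `^ (- ((fine (decay gamma us) - 1) / s) + delta))%:E)%E].
Proof.
move=> d0; exists 1 => gamma omega eta us phi cost s mu HK Hd b p q dsp0 Omega0 P0 pi0
  dsp Omega P pi wg [fo _] he _ og phiI cost0 cmono s0 costO hmu pb _ ipi0 vb ipi a.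
have ca : cube a by move=> j; rewrite /a; apply/andP; split; lra.
have [i iu0] := fset0Pn _ (us_neq0 og 0).
have omega0 : (0 < omega)%N.
  apply: leq_trans (us_card og fo 0); rewrite cardfs_gt0; exact: (us_neq0 og 0).
have eta0 : (0 < eta)%N.
  by apply: leq_trans (us_degree og he i 1); rewrite big_ord1 iu0.
(* The ratio from [us_union_proper]: with L k = B^k every level set gains a variable. *)
pose B := (eta * omega).+1.
have B1 : (1 < B)%N by rewrite ltnS muln_gt0 eta0.
have BR0 : (0 : R) < B%:R by rewrite ltr0n.
pose beta : R := B%:R `^ s.
have beta1 : 1 < beta by apply: powR_gt1 => //; rewrite ltr1n.
have betaE k : (B ^ k)%:R `^ s = beta ^+ k :> R.
  by rewrite natrX -(powR_mulrn k (ltW BR0)) -(powR_mulrn k (powR_ge0 _ _)) powRAC.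
have [A A0 HA] := cost_growth cost0 cmono s0 costO.
have [rho [Ct [rho3 Ct0 HCt rho1 rho2]]] := decay_exponent wg og fo s0 d0.
have /andP[r0 r3] := rho3.
pose tau : R := Num.max 1 rho.
have tau3 : 1 <= tau < 3 by rewrite le_max lexx gt_max r3 andbT/= ltr1n.
pose V := 40 * vconst d b tau * Ct + Ct.
have vc0 : 0 <= vconst d b tau by exact: vconst_ge0.
have V0 : 0 <= V by rewrite addr_ge0// !mulr_ge0.
(* As rho < 3, the exponent in [level_sizes] exceeds -rho by at most 9 kap < delta / 2; [rho] itself
   gave up the other delta / 2. *)
pose kap := Num.min 4^-1 (delta / 32).
have kap0 : 0 < kap by rewrite lt_min invr_gt0 divr_gt0//= ltr0n.
have kap4 : kap <= 4^-1 by rewrite ge_min lexx.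
have kapd : kap <= delta / 32 by rewrite ge_min lexx orbT.
have As0 : 0 <= A * omega%:R `^ s by rewrite mulr_ge0// powR_ge0.
have [N0 HN0] := level_sizes (prime_gt1 pb) beta1 As0 V0 rho3 kap0 kap4.
exists (Num.max 1 N0) => N; rewrite ge_max => /andP[N1 /HN0].
move=> [m [M [[m0 M0 Mmono] [Hcost Herr]]]].
pose L k := (B ^ k)%N.
exists m, L, (fun k => b ^ M k)%N; split.
  by split=> // k _; rewrite /L ltn_exp2l.
split.
  by split=> [|k _]; rewrite ?expn_gt0 ?prime_gt0// leq_exp2l ?prime_gt1.
have tailL k : tail gamma us (if k == 0%N then 0%N else L k) <= Ct * (beta ^+ k) `^ (- rho).
  apply: le_trans (HCt _) _; rewrite ler_wpM2l//.
  rewrite -betaE -powRrM mulrN mulrC; apply: ler_powRN => //.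
  - by rewrite ltr0n expn_gt0.
  - by rewrite ler_nat; case: k => [|k]//=; exact: leqnSn.
  - by rewrite mulr_ge0// ltW.
have err : err_bound d b gamma us m L M tau <= N `^ (3 * kap - rho * (1 - 2 * kap)).
  apply: le_trans Herr; rewrite /err_bound ler_wpM2l//; apply: lerD.
    rewrite ler_wpM2l//; have := tailL m; rewrite -[m == 0%N]negbK -lt0n m0/=.
    move=> /le_trans; apply; rewrite ler_wpM2r ?powR_ge0// /V lerDr.
    by rewrite !mulr_ge0.
  apply: ler_sum => k _; have := tailL k.
  set z := _ `^ (- rho); set w := _ `^ (- tau); set T := tail _ _ _ => Tz.
  have w0 : 0 <= w by exact: powR_ge0.
  have z0 : 0 <= z by exact: powR_ge0.
  apply: (@le_trans _ _ (40 * (vconst d b tau * w) * (Ct * z))).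
    by rewrite ler_wpM2l// !mulr_ge0.
  have -> : V * w * z = 40 * (vconst d b tau * w) * (Ct * z) + Ct * w * z.
    by rewrite /V; ring.
  by rewrite lerDl !mulr_ge0.
have He : (error P mu (domX gamma) (rkhs_ball HK)
    (ml_alg p q phi us a m L (fun k => b ^ M k)%N pi) ^+ 2 <=
    (N `^ (3 * kap - rho * (1 - 2 * kap)))%:E)%E.
  apply: error_sqr_le; first by exists (rkhs_ev (0 : HK)), 0 => //=; rewrite normr0.
  move=> _ [f /= f1 <-].
  apply: le_trans (ml_error pb ipi0 vb wg og phiI hmu ipi ca m0 M0 tau3 _ f1) _.
    by move=> k _; rewrite /L leq_exp2l// leqnSn.
  by rewrite lee_fin.
have expo D : D - delta / 2 <= rho -> 3 * kap - rho * (1 - 2 * kap) <= - D + delta.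
  move=> Dr; have : rho * kap <= 3 * kap by rewrite ler_pM2r// ltW.
  lra.
split.
- have vP k : (B ^ k > 0)%N by rewrite expn_gt0.
  (* The infimum over sequences and anchors is tested with the unions of the first B^i sets; level k
     uses member k of this chain. *)
  apply: le_trans (@cost_var_le _ _ _ _ _ _ _ _ _ _ _ _ _ P _ _ (fun i => us_union us (B ^ i)) cost0 _ _ _ _ _ _) _.
  + move=> k /andP[k0 _]; exists k; by rewrite ml_setE.
  + move=> k; have /fsubsetP sub := us_sub_union us (vP k).
    have [j ju] := fset0Pn _ (us_neq0 og 0).
    by apply/fset0Pn; exists j; exact: sub.
  + by move=> k; rewrite expnS; exact: (us_union_proper og fo he).
  + by rewrite (domX_cube wg).
  rewrite lee_fin; apply: le_trans Hcost; rewrite big_nat [leRHS]big_nat.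
  apply: ler_sum => k /andP[k0 _]; rewrite ler_wpM2l ?mulr_ge0// ml_setE//.
  apply: (@le_trans _ _ (A * (omega * B ^ k)%:R `^ s)).
    apply: HA; last by rewrite ler_nat; exact: (us_union_card og fo).
    have /fsubsetP sub := us_sub_union us (vP k).
    by rewrite cardfs_gt0; apply/fset0Pn; exists i; exact: sub.
  by rewrite natrM powRM// betaE mulrA.
- move=> /rho1 h; apply: le_trans He _; rewrite mul1r lee_fin.
  by apply: ler_powR => //; exact: expo.
- move=> /rho2 h; apply: le_trans He _; rewrite mul1r lee_fin.
  by apply: ler_powR => //; exact: expo.
Qed.
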